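(* Let $0<l<\infty$ and let $\Phi_1(x)$ be an $m_2\times m_1$ matrix function which is boundedly differentiable on the interval $[0,l]$. Let the operator $S$ on $L^2_{m_2}(0,l)$ be given by $$(Sf)(x)=\big(I_{m_2}+\Phi_1(0)\Phi_1(0)^*\big)f(x)+\int_0^l s(x,t)f(t)\,dt,$$ $$s(x,t)=\int_0^{\min(x,t)}\Phi_1'(x-\zeta)\Phi_1'(t-\zeta)^*\,d\zeta+\begin{cases}\Phi_1'(x-t)\Phi_1(0)^*, & x>t,\\ \Phi_1(0)\Phi_1'(t-x)^*, & t>x.\end{cases}$$ Then $S$ is the unique operator in $B\big(L^2_{m_2}(0,l)\big)$ satisfying the operator identity $$\mathrm{i}\,(AS-SA^* )=\Pi\Pi^*.$$
   Context: $m_1,m_2$ are positive integers and $m=m_1+m_2$; $I_k$ is the $k\times k$ identity matrix; matrices and scalars are complex. $L^2_{m_2}(0,l)$ is the Hilbert space of square-integrable $\mathbb{C}^{m_2}$-valued functions on $(0,l)$. $B(\mathbf H_1,\mathbf H_2)$ denotes the bounded linear operators from $\mathbf H_1$ to $\mathbf H_2$, and $B(\mathbf H)=B(\mathbf H,\mathbf H)$. ''Boundedly differentiable'' means differentiable with bounded derivative. The operator $A\in B\big(L^2_{m_2}(0,l)\big)$ is $(Af)(x)=-\mathrm{i}\int_0^x f(t)\,dt$. The operator $\Pi=[\Phi_1\ \ \Phi_2]\in B\big(\mathbb{C}^m,L^2_{m_2}(0,l)\big)$ is built from $\Phi_1\in B\big(\mathbb{C}^{m_1},L^2_{m_2}(0,l)\big)$,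 $(\Phi_1 g)(x)=\Phi_1(x)g$ (the same symbol denotes the matrix function and the multiplication operator), and $\Phi_2\in B\big(\mathbb{C}^{m_2},L^2_{m_2}(0,l)\big)$, $(\Phi_2 g)(x)\equiv g$; i.e. $\Pi\begin{bmatrix}g_1\\ g_2\end{bmatrix}=\Phi_1 g_1+\Phi_2 g_2$. The star denotes the adjoint operator (or conjugate transpose of a matrix). *)

(* Defs.v *)
From HB Require Import structures.
From mathcomp Require Import all_boot all_order all_algebra.
From mathcomp Require Import ring_quotient complex.
From mathcomp Require Import all_classical all_reals all_analysis.

Set Implicit Arguments.
Unset Strict Implicit.
Unset Printing Implicit Defensive.
Import Order.TTheory GRing.Theory Num.Theory.
Import numFieldNormedType.Exports.
Import Quotient.Exports.

Local Open Scope classical_set_scope.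
Local Open Scope ring_scope.
Local Open Scope quotient_scope.

Section ComplexAnalysis.
Context {R : realType}.
Local Notation mu := (@lebesgue_measure R).

Definition cintegral (D : set R) (f : R -> R[i]) : R[i] :=
  Complex (\int[mu]_(x in D) complex.Re (f x)) (\int[mu]_(x in D) complex.Im (f x)).

Definition mxintegral m n (D : set R) (F : R -> 'M[R[i]]_(m, n)) : 'M[R[i]]_(m, n) :=
  \matrix_(i, j) cintegral D (fun x => F x i j).

Definition adjmx m n (M : 'M[R[i]]_(m, n)) : 'M[R[i]]_(n, m) := (map_mx conjc M)^T.

(* The difference quotients are restricted to points of D, so that at the
   endpoints of D = [a, b] these are the one-sided derivatives. *)
Definition derivable_within (D : set R) (f : R -> R) (x : R) : Prop :=
  cvg ((f y - f x) / (y - x) @[y --> within D x^']).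

Definition derive_within (D : set R) (f : R -> R) (x : R) : R :=
  lim ((f y - f x) / (y - x) @[y --> within D x^']).

Definition mx_derivable_within m n (D : set R) (F : R -> 'M[R[i]]_(m, n)) (x : R) :=
  forall i j, derivable_within D (fun y => complex.Re (F y i j)) x /\
              derivable_within D (fun y => complex.Im (F y i j)) x.

Definition mx_derive_within m n (D : set R) (F : R -> 'M[R[i]]_(m, n)) (x : R) :
    'M[R[i]]_(m, n) :=
  \matrix_(i, j) Complex (derive_within D (fun y => complex.Re (F y i j)) x)
                         (derive_within D (fun y => complex.Im (F y i j)) x).

Definition boundedly_differentiable m n (D : set R) (F : R -> 'M[R[i]]_(m, n)) : Prop :=
  (forall x, D x -> mx_derivable_within D F x) /\
  exists M : R, forall x, D x ->
    forall i j, `|mx_derive_within D F x i j| <= (M%:C)%C.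

End ComplexAnalysis.

Section SquareIntegrable.
Context {R : realType}.
Variables (l : R) (n : nat).
Local Notation mu := (@lebesgue_measure R).
Local Notation F := (R -> 'cV[R[i]]_n).

(* [g \_ D] is the extension of [g] by 0 outside D; values of f outside ]0, l[
   are thus irrelevant. *)
Definition square_integrable : {pred F} :=
  [pred f : F | `[< forall i,
    ((fun x => complex.Re (f x i ord0)) \_ `]0, l[) \in Lfun mu 2%:E /\
    ((fun x => complex.Im (f x i ord0)) \_ `]0, l[) \in Lfun mu 2%:E >]].

Lemma square_integrable_submod_closed : submod_closed square_integrable.
Proof.
have p1 : (1 <= 2%:E :> \bar R)%E by rewrite lee_fin ler1n.
have [L0 LD] := Lfun_submod_closed mu p1.
have LZ a f : f \in Lfun mu 2%:E -> a *: f \in Lfun mu 2%:E.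
  by move=> fL; rewrite -[a *: f]addr0; exact: LD.
have LA f g : f \in Lfun mu 2%:E -> g \in Lfun mu 2%:E -> f + g \in Lfun mu 2%:E.
  by move=> fL gL; rewrite -[f]scale1r; exact: LD.
split.
  apply/asboolP => i.
  have E0 : (fun=> 0) \_ `]0, l[ = 0 :> (R -> R).
    by apply/funext => x; rewrite /patch; case: ifP.
  have Z0 : (fun x : R => complex.Re ((0 : F) x i ord0)) = fun=> 0.
    by apply/funext => x; rewrite mxE.
  have Z1 : (fun x : R => complex.Im ((0 : F) x i ord0)) = fun=> 0.
    by apply/funext => x; rewrite mxE.
  by rewrite Z0 Z1 E0.
move=> a f g /asboolP fL /asboolP gL; apply/asboolP => i.
have [f1 f2] := fL i; have [g1 g2] := gL i.
split.
- have -> : (fun x => complex.Re ((a *: f + g) x i ord0)) \_ `]0, l[ =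
    (complex.Re a *: ((fun x => complex.Re (f x i ord0)) \_ `]0, l[) +
     (- complex.Im a) *: ((fun x => complex.Im (f x i ord0)) \_ `]0, l[)) +
     (fun x => complex.Re (g x i ord0)) \_ `]0, l[.
    apply/funext => x; rewrite !fctE /patch; case: ifP => _; last first.
      by rewrite !scaler0 !addr0.
    rewrite !mxE; case: a (f x i _) (g x i _) => [a1 a2] [b1 b2] [c1 c2] /=.
    by rewrite /GRing.scale /= mulNr.
  by apply: (LA _ _ (LA _ _ _ _)) => //; exact: LZ.
- have -> : (fun x => complex.Im ((a *: f + g) x i ord0)) \_ `]0, l[ =
    (complex.Re a *: ((fun x => complex.Im (f x i ord0)) \_ `]0, l[) +
     complex.Im a *: ((fun x => complex.Re (f x i ord0)) \_ `]0, l[)) +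
     (fun x => complex.Im (g x i ord0)) \_ `]0, l[.
    apply/funext => x; rewrite !fctE /patch; case: ifP => _; last first.
      by rewrite !scaler0 !addr0.
    by rewrite !mxE; case: a (f x i _) (g x i _) => [a1 a2] [b1 b2] [c1 c2].
  by apply: (LA _ _ (LA _ _ _ _)) => //; exact: LZ.
Qed.

HB.instance Definition _ :=
  GRing.isSubmodClosed.Build _ _ square_integrable square_integrable_submod_closed.

Record L2fun := MkL2fun { L2fun_val :> F ; _ : L2fun_val \in square_integrable }.

HB.instance Definition _ := [isSub for L2fun_val].
HB.instance Definition _ := [Choice of L2fun by <:].
HB.instance Definition _ := [SubChoice_isSubLmodule of L2fun by <:].

Definition null_fun : {pred L2fun} :=
  [pred f : L2fun | `[< {ae mu, forall x, `]0, l[%classic x -> f x = 0} >]].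

Lemma null_fun_zmod_closed : zmod_closed null_fun.
Proof.
split; first by apply/asboolP; apply: aeW => x _.
move=> f g /asboolP fN /asboolP gN; apply/asboolP.
apply: (@filterS2 _ _ (ae_filter_ringOfSetsType mu) _ _ _ _ fN gN) => x f0 g0 Dx.
rewrite (_ : (f - g) x = f x - g x)//; rewrite f0// g0// subr0//.
Qed.

HB.instance Definition _ := GRing.isZmodClosed.Build _ null_fun null_fun_zmod_closed.

Definition L2 : Type := Quotient.quot null_fun.
HB.instance Definition _ := GRing.Zmodule.on L2.
HB.instance Definition _ := EqQuotient.on L2.

Definition L2scale (a : R[i]) (f : L2) : L2 := \pi_L2 (a *: repr f).

Lemma L2scale_pi a (f : L2fun) : L2scale a (\pi_L2 f) = \pi_L2 (a *: f).
Proof.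
apply/eqP; rewrite /L2scale -(Quotient.idealrBE null_fun) -scalerBr.
have : repr (\pi_L2 f) - f \in null_fun.
  by rewrite (Quotient.idealrBE null_fun) reprK.
move=> /asboolP fN; apply/asboolP.
apply: (@filterS _ _ (ae_filter_ringOfSetsType mu) _ _ _ fN) => x /[apply].
rewrite [in X in _ -> X](_ : (a *: (repr (\pi_L2 f) - f)) x = a *: (repr (\pi_L2 f) - f) x)//.
by move=> ->; rewrite scaler0.
Qed.

Lemma L2piP (f : L2) : exists g : L2fun, f = \pi_L2 g.
Proof. by exists (repr f); rewrite reprK. Qed.

Lemma L2piD (f g : L2fun) : \pi_L2 (f + g) = \pi_L2 f + \pi_L2 g.
Proof. exact: (@Quotient.pi_add _ null_fun). Qed.

Lemma L2scaleA a b (f : L2) : L2scale a (L2scale b f) = L2scale (a * b) f.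
Proof. by have [g ->] := L2piP f; rewrite !L2scale_pi scalerA. Qed.

Lemma L2scale1 : left_id 1 L2scale.
Proof. by move=> f; have [g ->] := L2piP f; rewrite L2scale_pi scale1r. Qed.

Lemma L2scaleDr : right_distributive L2scale +%R.
Proof.
move=> a f g; have [f' ->] := L2piP f; have [g' ->] := L2piP g.
by rewrite -L2piD !L2scale_pi -L2piD scalerDr.
Qed.

Lemma L2scaleDl (f : L2) : {morph L2scale^~ f : a b / a + b}.
Proof.
by move=> a b; have [g ->] := L2piP f; rewrite !L2scale_pi -L2piD scalerDl.
Qed.

HB.instance Definition _ :=
  GRing.Zmodule_isLmodule.Build R[i] L2 L2scaleA L2scale1 L2scaleDr L2scaleDl.

(* A representative of the class f; only its values on ]0, l[ matter, and only
   up to a null set. *)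
Definition L2rep (f : L2) : F := repr f.

(* The class of f; it is meaningful only if f is square integrable, and is the
   default value 0 otherwise. *)
Definition L2class (f : F) : L2 := \pi_L2 (insubd (0 : L2fun) f).

Lemma L2pi_eqP (f g : L2fun) :
  \pi_L2 f = \pi_L2 g <-> {ae mu, forall x, `]0, l[%classic x -> f x = g x}.
Proof.
split=> [/eqP|fg].
  rewrite -(Quotient.idealrBE null_fun) => /asboolP fg.
  apply: (@filterS _ _ (ae_filter_ringOfSetsType mu) _ _ _ fg) => x /[apply].
  by move=> fgx; apply/eqP; rewrite -subr_eq0; apply/eqP.
apply/eqP; rewrite -(Quotient.idealrBE null_fun); apply/asboolP.
apply: (@filterS _ _ (ae_filter_ringOfSetsType mu) _ _ _ fg) => x /[apply].
by move=> fgx; rewrite (_ : (f - g) x = f x - g x)// fgx subrr.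
Qed.

Lemma L2_eqP (f g : L2) :
  f = g <-> {ae mu, forall x, `]0, l[%classic x -> L2rep f x = L2rep g x}.
Proof. by rewrite -L2pi_eqP !reprK. Qed.

Lemma L2classK (f : F) : f \in square_integrable ->
  {ae mu, forall x, `]0, l[%classic x -> L2rep (L2class f) x = f x}.
Proof.
move=> f2; have : \pi_L2 (repr (L2class f)) = \pi_L2 (insubd (0 : L2fun) f).
  by rewrite reprK.
by move=> /L2pi_eqP; rewrite insubdK.
Qed.

End SquareIntegrable.

Arguments square_integrable {R} l n.

Section Operators.
Context {R : realType}.
Local Notation C := R[i].

Definition dotC n (u v : 'cV[C]_n) : C := \sum_i u i ord0 * conjc (v i ord0).

Definition dotL2 (l : R) n (f g : L2 l n) : C :=
  cintegral `]0, l[ (fun x => dotC (L2rep f x) (L2rep g x)).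

Definition normL2 (l : R) n (f : L2 l n) : R := Num.sqrt (complex.Re (dotL2 f f)).

Definition bounded_operator (l : R) n (T : L2 l n -> L2 l n) : Prop :=
  linear T /\ exists M : R, forall f, normL2 (T f) <= M * normL2 f.

Definition is_adjoint (U V : lmodType C) (dU : U -> U -> C) (dV : V -> V -> C)
    (T : U -> V) (T' : V -> U) : Prop :=
  forall u v, dV (T u) v = dU u (T' v).

(* The adjoint of T; the default value 0 is used only if T has no adjoint. *)
Definition adjoint (U V : lmodType C) (dU : U -> U -> C) (dV : V -> V -> C)
    (T : U -> V) : V -> U :=
  xget (fun=> 0) [set T' | is_adjoint dU dV T T'].

Definition opA (l : R) n (f : L2 l n) : L2 l n :=
  L2class l (fun x => - 'i%C *: mxintegral `]0, x[ (L2rep f)).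

Definition opPhi1 (l : R) m1 m2 (Phi1 : R -> 'M[C]_(m2, m1)) (g : 'cV[C]_m1) : L2 l m2 :=
  L2class l (fun x => Phi1 x *m g).

Definition opPhi2 (l : R) m2 (g : 'cV[C]_m2) : L2 l m2 := L2class l (fun=> g).

Definition opPi (l : R) m1 m2 (Phi1 : R -> 'M[C]_(m2, m1)) (g : 'cV[C]_(m1 + m2)) :
    L2 l m2 :=
  opPhi1 l Phi1 (usubmx g) + opPhi2 l (dsubmx g).

Definition opA_adj (l : R) n : L2 l n -> L2 l n :=
  adjoint (@dotL2 l n) (@dotL2 l n) (@opA l n).

Definition opPi_adj (l : R) m1 m2 (Phi1 : R -> 'M[C]_(m2, m1)) :
    L2 l m2 -> 'cV[C]_(m1 + m2) :=
  adjoint (@dotC (m1 + m2)) (@dotL2 l m2) (opPi l Phi1).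

(* The value chosen on the diagonal x = t is irrelevant. *)
Definition kernel_s (l : R) m1 m2 (Phi1 : R -> 'M[C]_(m2, m1)) (x t : R) : 'M[C]_m2 :=
  let dPhi1 := mx_derive_within `[0, l] Phi1 in
  mxintegral `[0, Num.min x t]
    (fun z => dPhi1 (x - z) *m adjmx (dPhi1 (t - z)))
  + (if t < x then dPhi1 (x - t) *m adjmx (Phi1 0)
     else if x < t then Phi1 0 *m adjmx (dPhi1 (t - x))
     else 0).

Definition S_fun (l : R) m1 m2 (Phi1 : R -> 'M[C]_(m2, m1)) (f : R -> 'cV[C]_m2) (x : R) :
    'cV[C]_m2 :=
  (1%:M + Phi1 0 *m adjmx (Phi1 0)) *m f x
  + mxintegral `]0, l[ (fun t => kernel_s l Phi1 x t *m f t).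

Definition opS (l : R) m1 m2 (Phi1 : R -> 'M[C]_(m2, m1)) (f : L2 l m2) : L2 l m2 :=
  L2class l (S_fun l Phi1 (L2rep f)).

End Operators.

(* Main.v *)
(* Existence. With V the Volterra operator (V f)(x) = int_0^x f, one has A = -i V, and the
   identity reads V S + S V^* = Pi Pi^*. All these operators are integral operators with
   bounded kernels (plus a constant matrix for S), so by Fubini the identity reduces to
     Phi(0) Phi(0)^* + int_0^x s(t,u) dt + int_0^u s(x,t) dt = Phi(x) Phi(u)^*,
   which is bilinear in the real and imaginary parts of the entries of Phi, hence a
   scalar identity; it follows from the fundamental theorem of calculus for everywhere
   differentiable functions with bounded derivative.

   Uniqueness. The difference X of two solutions is bounded and V X = - X V^*. Let e_x be
   the indicator of (0,x) and p_x(s) = max(x - s, 0), each times a basis vector. Then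
   V^* e_x = p_x and (d/dx) p_x = e_x in L2, so W(x,y) = <X p_x, p_y> satisfies
   W_x + W_y = <X e_x, V^* e_y> + <X V^* e_x, e_y> = 0 and vanishes on both axes, so W = 0.
   Differentiating, <X e_x, e_y> = 0 for all x, y, so X kills all steps e_x. Each V^* f is
   uniformly close to a combination of steps, so X V^* f = 0, i.e. V X f = 0, and X f = 0. *)

Require Import Defs.
From mathcomp Require Import all_boot all_order all_algebra.
From mathcomp Require Import complex.
From mathcomp Require Import all_classical all_reals all_analysis.
From mathcomp Require Import measurable_realfun.
From mathcomp Require Import ring lra.

Set Implicit Arguments.
Unset Strict Implicit.
Unset Printing Implicit Defensive.
Import Order.TTheory GRing.Theory Num.Theory.
Import numFieldNormedType.Exports.

Local Open Scope classical_set_scope.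
Local Open Scope ring_scope.

(** * The fundamental theorem of calculus for bounded derivatives *)

(** The derivative of [Phi] is only bounded and may be discontinuous everywhere it matters. It is
    handled as the pointwise limit of difference quotients with increments [harmonic n], which makes
    it measurable and opens the way to dominated convergence. Differentiability at [0] and [l] is
    one-sided, so each real and imaginary part is continued along its endpoint tangents to the whole
    line, where two-sided calculus applies with the same bound on the derivative. Adjoints and
    classes carry default values, so the operators are brought to explicit integral form before any
    algebra. For uniqueness, no derivative in L2 is ever taken. Replacing a difference of ramps by
    [h] times a step leaves a remainder of squared norm at most [h ^+ 3], which beats the [h ^+ 2]
    lost by dividing; this quantitative substitute serves both along diagonals and in each variable
    separately. Estimates are mostly on squared norms, with generous constants. The approximation by
    steps is made only on the range of [V^*], whose elements are Hoelder of exponent 1/2 by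
    Cauchy-Schwarz; injectivity of [V] then does the rest. *)

Section FundamentalTheorem.
Context {R : realType}.
Local Notation mu := (@lebesgue_measure R).
Implicit Types (F : R -> R).

Lemma derivable_continuous F : (forall t, derivable F t 1) -> continuous F.
Proof. by move=> dF t; apply/differentiable_continuous/derivable1_diffP. Qed.

(** Sampling the increment along [harmonic n] turns the derivative into a sequential limit, the form
    needed for measurability of limits and for dominated convergence. *)
Lemma harmonic_quotient_cvg F t : derivable F t 1 ->
  (F (t + harmonic n) - F t) / harmonic n @[n --> \oo] --> (derive1 F) t.
Proof.
move=> dF.
have := dF; rewrite /derivable => /cvg_ex[d Fd].
have Fd' : d = (derive1 F) t by rewrite derive1E /derive; apply/esym/cvg_lim.
rewrite Fd' in Fd.
have h0 : (@harmonic R) n @[n --> \oo] --> 0^'.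
  apply: (@cvg_trans _ (within (fun x : R => x != 0) (nbhs (0 : R)))) => //.
  move=> A [e /= e0 eA].
  have /cvgrPdist_lt /(_ _ e0) := @cvg_harmonic R.
  apply: filterS => n /= hn; apply: eA => //.
have := cvg_comp _ _ h0 Fd; apply: cvg_trans; apply: near_eq_cvg.
near=> n => /=.
by rewrite /GRing.scale /= mulr1 mulrC [_ + t]addrC.
Unshelve. all: by end_near. Qed.

(** [derive1 F] may be discontinuous; it is still a pointwise limit of continuous difference
    quotients. *)
Lemma measurable_derive1 F : (forall t, derivable F t 1) ->
  measurable_fun setT (derive1 F).
Proof.
move=> dF.
apply: (@measurable_fun_cvg _ _ _ _ (fun n (t : R) => (F (t + harmonic n) - F t) / harmonic n)).
- move=> n; apply: measurable_funM => //; apply: continuous_measurable_fun.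
  move=> t; apply: cvgB; last exact: derivable_continuous.
  apply: (@continuous_comp _ _ _ (fun t : R => t + harmonic n) F).
    by apply: cvgD; [exact: cvg_id|exact: cvg_cst].
  exact: derivable_continuous.
- by move=> t _; exact: harmonic_quotient_cvg.
Qed.

Lemma is_derive_shift F h t : derivable F (t + h) 1 ->
  is_derive t 1 (fun u => F (u + h)) ((derive1 F) (t + h)).
Proof.
move=> dF.
have dFt : is_derive ((fun u => u + h) t) 1 F ((derive1 F) (t + h)).
  by apply: DeriveDef => //; rewrite derive1E.
have ds : is_derive t (1 : R) (fun u : R => u + h) 1.
  by rewrite -[X in is_derive _ _ _ X]addr0; apply: is_deriveD.
have := @is_derive1_comp _ F (fun u : R => u + h) t _ _ dFt ds.
by rewrite mulr1.
Qed.

Lemma mean_value_bound F (M x y : R) : (forall t, derivable F t 1) ->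
  (forall t, t \in `[x, y] -> `|(derive1 F) t| <= M) -> x <= y ->
  `|F y - F x| <= M * (y - x).
Proof.
move=> dF FM xy.
have [c cxy ->] := @MVT_segment _ F (derive1 F) x y xy
  (fun t _ => DeriveDef (dF t) (esym (derive1E _ _)))
  (continuous_subspaceT (derivable_continuous dF)).
by rewrite normrM [X in _ * X]ger0_norm ?subr_ge0// ler_wpM2r ?subr_ge0// FM.
Qed.

Lemma continuous_integrable F x y : continuous F ->
  mu.-integrable `[x, y] (EFin \o F).
Proof.
move=> cF; apply: continuous_compact_integrable; first exact: segment_compact.
exact: continuous_subspaceT.
Qed.

Lemma continuous_antiderivative F x : continuous F ->
  exists G : R -> R, forall t, x <= t -> derivable G t 1 /\ (derive1 G) t = F t.
Proof.
(* Integrating from [x - 1] makes [x] itself an interior point, so that the derivative there is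
   two-sided. *)
move=> cF; exists (fun z => \int[mu]_(t in `[x - 1, z]) F t) => t xt.
apply: (@continuous_FTC1_closed _ _ _ _ (t + 1)).
- by rewrite ltrDl.
- exact: continuous_integrable.
- by rewrite (lt_le_trans _ xt)// ltrBlDr ltrDl.
- exact: cF.
Qed.

Lemma Rintegral_continuous_FTC2 F G (x y : R) : x < y -> continuous F ->
  (forall t, x <= t -> is_derive t 1 G (F t)) ->
  \int[mu]_(t in `[x, y]) F t = G y - G x.
Proof.
move=> xy cF dG.
have cG t : x <= t -> G z @[z --> t] --> G t.
  move=> xt; apply: differentiable_continuous; apply/derivable1_diffP.
  by have [] := dG t xt.
rewrite /Rintegral (@continuous_FTC2 _ F G)//.
- exact: continuous_subspaceT.
- split.
  + by move=> t /itvP tx; have [] := dG t; rewrite ?tx// ltW// tx.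
  + exact/cvg_at_right_filter/cG.
  + by apply/cvg_at_left_filter/cG; exact: ltW.
- move=> t /itvP tx; rewrite derive1E; apply: derive_val; apply: dG.
  by rewrite ltW// tx.
Qed.

(* The integrals of the difference quotients of F are difference quotients of an
   antiderivative of F. *)
Lemma FTC_bounded_derivative F (M x y : R) : x <= y ->
  (forall t, derivable F t 1) ->
  (forall t, t \in `[x, y + 1] -> `|(derive1 F) t| <= M) ->
  \int[mu]_(t in `[x, y]) (derive1 F) t = F y - F x.
Proof.
rewrite le_eqVlt => /predU1P[<- _ _|xy dF FM].
  by rewrite set_itv1 Rintegral_set1 subrr.
have cF := derivable_continuous dF.
have [G dG] := continuous_antiderivative x cF.
have iG t : x <= t -> is_derive t 1 G (F t).
  by move=> xt; have [d1 d2] := dG t xt; apply: DeriveDef => //; rewrite -derive1E.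
have h_gt0 n := @harmonic_gt0 R n.
have h_le1 n : harmonic n <= 1 :> R by rewrite /= invf_le1 ?ltr0n// ler1n.
pose q (H : R -> R) n t : R := (H (t + harmonic n) - H t) / harmonic n.
have cFs n : continuous (fun t : R => F (t + harmonic n)).
  move=> t; apply: (@continuous_comp _ _ _ (fun t : R => t + harmonic n) F).
    by apply: cvgD; [exact: cvg_id|exact: cvg_cst].
  exact: cF.
have cq n : continuous (q F n).
  by move=> t; apply: cvgMl; apply: cvgB; [exact: cFs|exact: cF].
have intq n : \int[mu]_(t in `[x, y]) q F n t = q G n y - q G n x.
  rewrite /q RintegralZr//; last first.
    by apply: continuous_integrable => t; apply: cvgB; [exact: cFs|exact: cF].
  rewrite RintegralB//; [|exact: continuous_integrable..].
  rewrite (Rintegral_continuous_FTC2 xy cF iG).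
  have -> : \int[mu]_(t in `[x, y]) F (t + harmonic n) =
            G (y + harmonic n) - G (x + harmonic n).
    apply: (@Rintegral_continuous_FTC2 _ (fun t => G (t + harmonic n)) _ _ xy (cFs n)).
    move=> t xt; have xth : x <= t + harmonic n by rewrite (le_trans xt)// lerDl ltW.
    by have [d1 d2] := dG _ xth; rewrite -d2; exact: is_derive_shift.
  by rewrite -mulrBl; congr (_ / _); ring.
have lim1 : \int[mu]_(t in `[x, y]) q F n t @[n --> \oo] --> F y - F x.
  under eq_fun do rewrite intq.
  have [dy <-] := dG y (ltW xy); have [dx <-] := dG x (lexx x).
  by apply: cvgB; exact: harmonic_quotient_cvg.
(* The mean value theorem is used on [[t, t + harmonic n]], which may overrun [y] by at most 1;
   hence the bound on the derivative up to [y + 1]. *)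
have qM n t : t \in `[x, y] -> `|q F n t| <= M.
  move=> /itvP txy.
  rewrite /q normrM normfV (gtr0_norm (h_gt0 n)) ler_pdivrMr//.
  have := @mean_value_bound F M t (t + harmonic n) dF.
  rewrite [_ + _ - t]addrAC subrr add0r; apply.
    move=> z /itvP zt; apply: FM; rewrite in_itv/=.
    by rewrite (le_trans _ (_ : t <= z)) ?zt ?txy//= (le_trans (_ : z <= t + harmonic n)) ?zt// lerD// txy.
  by rewrite lerDl ltW.
have lim2 : \int[mu]_(t in `[x, y]) q F n t @[n --> \oo] --> \int[mu]_(t in `[x, y]) (derive1 F) t.
  have := @dominated_convergence _ _ _ mu `[x, y]%classic (measurable_itv _)
    (fun n => EFin \o q F n) (EFin \o (derive1 F)) (cst M%:E).
  case.
  - by move=> n; apply/measurable_EFinP; apply: measurable_funTS; exact: continuous_measurable_fun.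
  - apply/measurable_EFinP; apply: measurable_funTS; exact: measurable_derive1.
  - apply: aeW => t _; apply: cvg_EFin; first by apply: nearW.
    exact: harmonic_quotient_cvg.
  - by apply: continuous_integrable; exact: cst_continuous.
  - by apply: aeW => t n txy; rewrite /= lee_fin qM.
  move=> iF _; rewrite /= -[X in _ --> X](fineK (integrable_fin_num _ iF))//.
  by move=> /fine_cvgP[_].
by rewrite (cvg_unique _ lim2 lim1).
Qed.

End FundamentalTheorem.

(** * Tangent extension of a differentiable function *)

Section TangentExtension.
Context {R : realType}.
Variables (l : R) (f : R -> R).
Hypothesis l_gt0 : 0 < l.
Hypothesis df : forall x, `[0, l]%classic x -> derivable_within `[0, l] f x.
Local Notation df_ := (derive_within `[0, l] f).

(** Nearest point of [[0, l]]. It lets the single formula [df_ (clamp x)] give the slope of the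
    extension on all three pieces. *)
Definition clamp (x : R) := Num.max 0 (Num.min x l).

(** Following the endpoint tangents keeps the function differentiable at [0] and [l], and the
    derivative takes no value that [df_] does not take on [[0, l]], so its bound survives. *)
Definition tangent_extension (x : R) : R :=
  if x < 0 then f 0 + df_ 0 * x else
  if x <= l then f x else f l + df_ l * (x - l).
Local Notation g := tangent_extension.

Lemma derive_within_quotient x : `[0, l]%classic x -> forall e, 0 < e ->
  exists2 d, 0 < d & forall y, 0 <= y <= l -> y != x -> `|y - x| < d ->
    `|df_ x - (f y - f x) / (y - x)| < e.
Proof.
move=> x0l e e0.
have /= xl : 0 <= x <= l by move: x0l; rewrite /= in_itv.
(* [x] is an accumulation point of [[0, l]]: from the left half of the interval one moves right by
   [m], from the right half one moves left, without leaving the interval. *)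
have PF : ProperFilter (within `[0, l] x^').
  apply: Build_ProperFilter => -[d /= d0 dA].
  have [xl2|lx2] := ltP x (l / 2).
    pose m := Num.min (d / 2) (l / 2).
    have m0 : 0 < m by rewrite lt_min !divr_gt0.
    have md : m < d by rewrite gt_min; apply/orP; left; lra.
    have ml : m <= l / 2 by rewrite ge_min lexx orbT.
    apply: (dA (x + m)) => /=.
    - by rewrite opprD addrA subrr add0r normrN gtr0_norm.
    - by rewrite gt_eqF// ltrDl.
    - by rewrite in_itv/=; lra.
  pose m := Num.min (d / 2) (l / 2).
  have m0 : 0 < m by rewrite lt_min !divr_gt0.
  have md : m < d by rewrite gt_min; apply/orP; left; lra.
  have ml : m <= l / 2 by rewrite ge_min lexx orbT.
  apply: (dA (x - m)) => /=.
  - by rewrite opprD addrA subrr add0r opprK gtr0_norm.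
  - by rewrite lt_eqF// gtrBl.
  - by rewrite in_itv/=; lra.
have := df x0l; rewrite /derivable_within => /cvgrPdist_lt /(_ _ e0).
move=> [d /= d0 dA]; exists d => // y yl yx yd.
by apply: dA => //=; rewrite ?in_itv//= distrC.
Qed.

Lemma is_derive_quotient (h : R -> R) (x d : R) :
  (forall e, 0 < e -> exists2 r, 0 < r & forall y, y != x -> `|y - x| < r ->
    `|d - (h y - h x) / (y - x)| < e) -> is_derive x 1 h d.
Proof.
move=> H.
have hd : (fun k => k^-1 *: ((h \o shift x) (k *: (1 : R^o)) - h x)) @ 0^' --> d.
  apply/cvgrPdist_lt => e e0; have [r r0 hr] := H e e0.
  exists r => //= k /= kr k0.
  have := hr (k + x); rewrite addrK -subr_eq0 addrK.
  rewrite sub0r normrN in kr.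
  by move=> /(_ k0 kr); rewrite /GRing.scale/= mulr1 [_^-1 * _]mulrC.
by apply: DeriveDef; [apply/cvg_ex; exists d|exact/cvg_lim].
Qed.

Lemma tangent_extensionE x : 0 <= x <= l -> g x = f x.
Proof. by move=> /andP[x0 xl]; rewrite /g ltNge x0/= xl. Qed.

Lemma is_derive_tangent_extension (x : R) : is_derive x 1 g (df_ (clamp x)).
Proof.
apply: is_derive_quotient => e e0.
have lin (c y : R) : y != x -> c - c * (y - x) / (y - x) = 0.
  by move=> yx; rewrite mulfK ?subrr// subr_eq0.
have [x0|x0] := ltP x 0.
  exists (- x); first by rewrite oppr_gt0.
  move=> y yx yd; have y0 : y < 0 by have := ler_norm (y - x); lra.
  have -> : clamp x = 0.
    by rewrite /clamp (min_idPl _) ?(max_idPl _)// ltW// (lt_trans x0).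
  rewrite /g x0 y0 (_ : _ - (_ + _) = df_ 0 * (y - x)); last by ring.
  by rewrite lin// normr0.
have [xl|lx] := leP x l; last first.
  exists (x - l); first by rewrite subr_gt0.
  move=> y yx yd; have ly : l < y by have := ler_norm (x - y); rewrite distrC; lra.
  have -> : clamp x = l by rewrite /clamp (min_idPr _) ?(max_idPr _)// ltW.
  rewrite /g (ltNge x) x0/= (leNgt x) lx/= (ltNge y) (ltW (lt_trans l_gt0 ly))/= (leNgt y) ly/=.
  rewrite (_ : _ - (_ + _) = df_ l * (y - x)); last by ring.
  by rewrite lin// normr0.
have -> : clamp x = x by rewrite /clamp (min_idPl _) ?(max_idPr _).
have x0l : `[0, l]%classic x by rewrite /= in_itv/= x0.
have [d d0 dA] := derive_within_quotient x0l e0.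
(* This radius keeps an endpoint out of the neighbourhood unless [x] is that endpoint. A point [y]
   outside [[0, l]] then occurs only for [x] equal to [0] or [l], where the quotient is exactly the
   tangent slope. *)
pose r := Num.min d (Num.min (if 0 < x then x else d) (if x < l then l - x else d)).
have r0 : 0 < r.
  rewrite /r !lt_min d0/=; apply/andP; split; case: ifPn => // xl'.
  by rewrite subr_gt0.
exists r => // y yx yr.
have yd : `|y - x| < d by rewrite (lt_le_trans yr)// ge_min lexx.
have [y0|y0] := ltP y 0.
  have [xp|xn] := ltP 0 x.
    have rx : r <= x by rewrite /r xp !ge_min lexx !orbT.
    by have := ler_norm (x - y); rewrite distrC; lra.
  have xE : x = 0 by apply/eqP; rewrite eq_le xn x0.
  rewrite xE in yx *; rewrite /g y0 ltxx (ltW l_gt0) subr0 [f 0 + _]addrC addrK mulfK//.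
  by rewrite subrr normr0.
have [yl|ly] := leP y l.
  by rewrite tangent_extensionE ?y0// tangent_extensionE ?x0//; apply: dA; rewrite ?y0.
have [xp|xn] := ltP x l.
  have rx : r <= l - x by rewrite /r xp !ge_min lexx !orbT.
  by have := ler_norm (y - x); lra.
have xE : x = l by apply/eqP; rewrite eq_le xn xl.
rewrite xE in yx *; rewrite /g (ltNge y) y0/= (leNgt y) ly/= (ltNge l) (ltW l_gt0)/= lexx.
by rewrite [f l + _]addrC addrK mulfK ?subr_eq0// subrr normr0.
Qed.

Lemma derivable_tangent_extension (x : R) : derivable g x 1.
Proof. by have [] := is_derive_tangent_extension x. Qed.

Lemma derive1_tangent_extension x : derive1 g x = df_ (clamp x).
Proof. by rewrite derive1E; apply: derive_val; exact: is_derive_tangent_extension. Qed.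

Lemma clamp_itv x : `[0, l]%classic (clamp x).
Proof.
by rewrite /= in_itv/= /clamp le_max lexx/= ge_max (ltW l_gt0)/= ge_min lexx orbT.
Qed.

Lemma clamp_id x : 0 <= x <= l -> clamp x = x.
Proof. by move=> /andP[x0 xl]; rewrite /clamp (min_idPl _) ?(max_idPr _). Qed.

End TangentExtension.

(** * Parameter integrals and the Fubini theorem on the line *)

Section RealIntegrals.
Context {R : realType}.
Local Notation mu := (@lebesgue_measure R).

Lemma restrict_setX d1 d2 (T1 : measurableType d1) (T2 : measurableType d2)
    (E : set T1) (D : set T2) (G : T1 * T2 -> R) x :
  (fun y => (G \_ (E `*` D)) (x, y)) = if x \in E then (fun y => G (x, y)) \_ D else cst 0.
Proof.
apply/funext => y; rewrite /patch.
case: ifPn => [/set_mem[/= Ex Dy]|nED]; first by rewrite (mem_set Ex) (mem_set Dy).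
case: ifPn => // xE; case: ifPn => // yD; move: nED; rewrite mem_set//.
by split => /=; exact: set_mem.
Qed.

(** The integral is [fine] of a difference of two nonnegative parameter integrals, each measurable
    by Tonelli; measurability thus holds even across parameters where the section is not
    integrable. *)
Lemma measurable_fun_Rintegral d (T : measurableType d) (E : set T) (D : set R)
    (G : T * R -> R) : measurable E -> measurable D ->
  measurable_fun (E `*` D) G ->
  measurable_fun E (fun x => \int[mu]_(y in D) G (x, y)).
Proof.
move=> mE mD mG; have mX := measurableX mE mD.
pose H := G \_ (E `*` D).
have mH : measurable_fun setT (EFin \o H).
  by apply/measurable_EFinP; apply/(measurable_restrictT _ mX).
apply: (@eq_measurable_fun _ _ _ _ _ (fun x => \int[mu]_y H (x, y))).
  move=> x xE; rewrite [in RHS]Rintegral_mkcond; apply: eq_Rintegral => y _.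
  by have := restrict_setX E D G x; rewrite xE => /(congr1 (@^~ y)).
apply: measurable_funTS.
apply: (@measurableT_comp _ _ _ _ _ _ fine); first exact: fine_measurable.
rewrite (_ : (fun x => _) = (fubini_F mu (fun z => (EFin \o H)^\+ z) \-
                             fubini_F mu (fun z => (EFin \o H)^\- z))%E); last first.
  apply/funext => x; rewrite integralE /fubini_F; congr (_ - _)%E.
    by apply: eq_integral => y _; rewrite !funeposE.
  by apply: eq_integral => y _; rewrite !funenegE.
apply: emeasurable_funB.
  apply: measurable_fun_fubini_tonelli_F => //; exact: measurable_funepos.
apply: measurable_fun_fubini_tonelli_F => //; exact: measurable_funeneg.
Qed.

Lemma measurable_fun_section d (T : measurableType d) (E : set T) (D : set R)
    (G : T * R -> R) x : measurable E -> measurable D ->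
  measurable_fun (E `*` D) G -> E x -> measurable_fun D (fun y => G (x, y)).
Proof.
move=> mE mD mG Ex; have mX := measurableX mE mD.
apply/(measurable_restrictT _ mD).
move/(measurable_restrictT _ mX) : mG => mG.
have := restrict_setX E D G x; rewrite mem_set// => <-.
exact: (measurableT_comp mG (pair1_measurable x)).
Qed.

Lemma integrable_dominated (D : set R) (f g : R -> R) : measurable D ->
  measurable_fun D f -> mu.-integrable D (EFin \o g) ->
  (forall x, D x -> `|f x| <= g x) -> mu.-integrable D (EFin \o f).
Proof.
move=> mD mf ig fg; apply: le_integrable ig => //; first exact/measurable_EFinP.
move=> x Dx /=; rewrite lee_fin (le_trans (fg x Dx))//; exact: ler_norm.
Qed.

Lemma integrable_cstM (D : set R) (f : R -> R) (c : R) : measurable D ->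
  mu.-integrable D (EFin \o f) -> mu.-integrable D (EFin \o (fun x => c * f x)).
Proof.
move=> mD fi; rewrite (_ : EFin \o _ = (fun x => c%:E * (EFin \o f) x)%E).
  exact: integrableZl.
by apply/funext => x /=; rewrite EFinM.
Qed.

Lemma integrable_addr (D : set R) (f g : R -> R) : measurable D ->
  mu.-integrable D (EFin \o f) -> mu.-integrable D (EFin \o g) ->
  mu.-integrable D (EFin \o (fun x => f x + g x)).
Proof.
by move=> mD fi gi; rewrite (_ : EFin \o _ = (EFin \o f) \+ (EFin \o g))%E//; exact: integrableD.
Qed.

Section Fubini.
Variables (D1 D2 : set R) (G : R -> R -> R) (p q : R -> R).
Hypotheses (mD1 : measurable D1) (mD2 : measurable D2).
Hypothesis mG : measurable_fun (D1 `*` D2) (fun z => G z.1 z.2).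
Hypothesis ip : mu.-integrable D1 (EFin \o p).
Hypothesis iq : mu.-integrable D2 (EFin \o q).
Hypothesis Gpq : forall x y, D1 x -> D2 y -> `|G x y| <= p x * q y.

Lemma integrable_section x : D1 x -> mu.-integrable D2 (EFin \o G x).
Proof.
move=> D1x; apply: (integrable_dominated mD2 _ (integrable_cstM (p x) mD2 iq)).
  exact: (measurable_fun_section mD1 mD2 mG D1x).
by move=> y D2y; exact: Gpq.
Qed.

Lemma le_Rintegral_section x : D1 x ->
  `|\int[mu]_(y in D2) G x y| <= (\int[mu]_(y in D2) q y) * p x.
Proof.
move=> D1x; have iG := integrable_section D1x.
apply: (le_trans (le_normr_Rintegral _ iG)) => //.
rewrite mulrC -RintegralZl//; apply: le_Rintegral => //.
- exact: integrable_norm iG.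
- exact: integrable_cstM.
- by move=> y D2y; exact: Gpq.
Qed.

Lemma integrable_Rintegral_section :
  mu.-integrable D1 (EFin \o (fun x => \int[mu]_(y in D2) G x y)).
Proof.
apply: (integrable_dominated mD1 _ (integrable_cstM (\int[mu]_(y in D2) q y) mD1 ip)).
  exact: (measurable_fun_Rintegral mD1 mD2 mG).
by move=> x D1x; exact: le_Rintegral_section.
Qed.

Lemma integral_Rintegral_section :
  (\int[mu]_(x in D1) (\int[mu]_(y in D2) G x y)%:E =
   \int[mu]_x \int[mu]_y (((fun z => G z.1 z.2) \_ (D1 `*` D2)) (x, y))%:E)%E.
Proof.
rewrite integral_mkcond; apply: eq_integral => x _; rewrite /patch.
case: ifPn => xD; last first.
  rewrite integral0_eq// => y _.
  have /(congr1 (@^~ y)) /= := restrict_setX D1 D2 (fun z => G z.1 z.2) x.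
  by rewrite (negbTE xD) /patch => ->.
rewrite fineK; last by apply: integrable_fin_num => //; apply: integrable_section; exact: set_mem.
rewrite integral_mkcond; apply: eq_integral => y _.
have /(congr1 (@^~ y)) /= := restrict_setX D1 D2 (fun z => G z.1 z.2) x.
by rewrite xD /patch => ->; case: ifP.
Qed.

(** Extension by zero turns Fubini on a rectangle into Fubini on the plane. For fixed [x] the inner
    absolute integral is at most [c] times the absolute value of [p x], and [p] is integrable. *)
Lemma integrable_patch_setX :
  ((mu \x mu)%E).-integrable setT (EFin \o ((fun z => G z.1 z.2) \_ (D1 `*` D2))).
Proof.
have mX := measurableX mD1 mD2.
apply/integrable12ltyP.
  by apply/measurable_EFinP; apply/(measurable_restrictT _ mX).
pose c := (\int[mu]_(y in D2) `|q y|%:E)%E.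
have cfin : c \is a fin_num.
  exact: (integrable_fin_num _ (integrable_norm iq)).
have ipc : mu.-integrable D1 (fun x => c * `|p x|%:E)%E.
  rewrite -(fineK cfin); apply: integrableZl => //; exact: integrable_norm ip.
have := ipc => /integrableP[_]; apply: le_lt_trans.
rewrite [leRHS]integral_mkcond.
apply: ge0_le_integral => //.
- by move=> x _; apply: integral_ge0.
- have := @measurable_fun_fubini_tonelli_F _ _ _ _ _ mu
    (fun z => `|(EFin \o ((fun z => G z.1 z.2) \_ (D1 `*` D2))) z|)%E; apply => //.
  apply: measurableT_comp => //.
  by apply/measurable_EFinP; apply/(measurable_restrictT _ mX).
- apply/(measurable_restrictT _ mD1); apply: measurableT_comp => //.
  exact: measurable_int ipc.
- move=> x _ /=.
  apply: (@le_trans _ _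
    (\int[mu]_y `|(if x \in D1 then (G x) \_ D2 else cst 0) y|%:E)%E).
    rewrite le_eqVlt; apply/orP; left; apply/eqP; apply: eq_integral => y _.
    by have /(congr1 (@^~ y)) /= -> := restrict_setX D1 D2 (fun z => G z.1 z.2) x.
  rewrite [leRHS]/patch; case: ifPn => xD; last by rewrite integral0_eq//= => y _; rewrite normr0.
  rewrite muleC /c -ge0_integralZl//; last exact: measurable_int (integrable_norm iq).
  rewrite gee0_abs; last by apply: integral_ge0 => y _; rewrite mule_ge0.
  rewrite [leRHS]integral_mkcond; apply: ge0_le_integral => //.
  + apply/measurable_EFinP; apply: measurableT_comp => //.
    apply/(measurable_restrictT _ mD2).
    by apply: (measurable_fun_section mD1 mD2 mG); exact: set_mem.
  + apply/(measurable_restrictT _ mD2); apply: measurable_funeM.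
    exact: measurable_int (integrable_norm iq).
  + move=> y _; rewrite /patch; case: ifPn => yD /=; last by rewrite normr0.
    rewrite -EFinM lee_fin -normrM.
    by rewrite (le_trans (Gpq (set_mem xD) (set_mem yD)))// ler_norm.
Qed.

End Fubini.

(** Domination by a product [p x * q y] is the shape produced by a bounded kernel placed between two
    integrable functions. *)
Lemma Rintegral_Fubini (D1 D2 : set R) (G : R -> R -> R) (p q : R -> R) :
  measurable D1 -> measurable D2 ->
  measurable_fun (D1 `*` D2) (fun z => G z.1 z.2) ->
  mu.-integrable D1 (EFin \o p) -> mu.-integrable D2 (EFin \o q) ->
  (forall x y, D1 x -> D2 y -> `|G x y| <= p x * q y) ->
  \int[mu]_(x in D1) \int[mu]_(y in D2) G x y =
  \int[mu]_(y in D2) \int[mu]_(x in D1) G x y.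
Proof.
move=> mD1 mD2 mG ip iq Gpq.
have mX := measurableX mD1 mD2; have mX' := measurableX mD2 mD1.
have mG' : measurable_fun (D2 `*` D1) (fun z => G z.2 z.1).
  apply: (@measurable_comp _ _ _ _ _ _ (D1 `*` D2) (fun z => G z.1 z.2) (D2 `*` D1) (fun z => (z.2, z.1))) => //.
    by move=> _ [[a b] [/= ? ?] <-].
  by apply: measurable_funTS; apply: measurable_fun_pair.
have Gqp y x : D2 y -> D1 x -> `|G x y| <= q y * p x.
  by move=> D2y D1x; rewrite mulrC Gpq.
rewrite /Rintegral -/(Rintegral mu _ _); congr fine.
rewrite (integral_Rintegral_section mD1 mD2 mG iq Gpq).
rewrite (integral_Rintegral_section mD2 mD1 mG' ip Gqp).
rewrite (Fubini (integrable_patch_setX mD1 mD2 mG ip iq Gpq)).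
apply: eq_integral => y _; apply: eq_integral => x _; congr EFin.
rewrite /patch (_ : ((x, y) \in D1 `*` D2) = ((y, x) \in D2 `*` D1))//.
by apply/idP/idP => /set_mem[/= ? ?]; apply/mem_set.
Qed.

End RealIntegrals.

(** * Complex-valued functions *)

Section ComplexFunctions.
Context {R : realType}.
Local Notation mu := (@lebesgue_measure R).
Local Notation C := R[i].
Local Notation Re := complex.Re.
Local Notation Im := complex.Im.

Lemma complexP (z w : C) : Re z = Re w -> Im z = Im w -> z = w.
Proof. by case: z w => [a b] [c d] /= -> ->. Qed.

Lemma ReDc (z w : C) : Re (z + w) = Re z + Re w. Proof. by case: z w => [? ?] []. Qed.
Lemma ImDc (z w : C) : Im (z + w) = Im z + Im w. Proof. by case: z w => [? ?] []. Qed.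
Lemma ReNc (z : C) : Re (- z) = - Re z. Proof. by case: z. Qed.
Lemma ImNc (z : C) : Im (- z) = - Im z. Proof. by case: z. Qed.
Lemma ReMc (z w : C) : Re (z * w) = Re z * Re w - Im z * Im w.
Proof. by case: z w => [? ?] []. Qed.
Lemma ImMc (z w : C) : Im (z * w) = Re z * Im w + Im z * Re w.
Proof. by case: z w => [? ?] []. Qed.
Lemma Re_conjc (z : C) : Re (conjc z) = Re z. Proof. by case: z. Qed.
Lemma Im_conjc (z : C) : Im (conjc z) = - Im z. Proof. by case: z. Qed.
Lemma Re_sum I (r : seq I) (P : pred I) (F : I -> C) :
  Re (\sum_(i <- r | P i) F i) = \sum_(i <- r | P i) Re (F i).
Proof. by elim/big_rec2: _ => //= i x y _ <-; rewrite ReDc. Qed.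
Lemma Im_sum I (r : seq I) (P : pred I) (F : I -> C) :
  Im (\sum_(i <- r | P i) F i) = \sum_(i <- r | P i) Im (F i).
Proof. by elim/big_rec2: _ => //= i x y _ <-; rewrite ImDc. Qed.

(** A real-valued submultiplicative norm that dominates both parts at once, so domination arguments
    for complex integrands reduce to real ones without square roots. It agrees with the modulus up
    to the factor in [norm1_sqr_le]. *)
Definition norm1 (z : C) : R := `|Re z| + `|Im z|.
Definition norm2sq (z : C) : R := Re z ^+ 2 + Im z ^+ 2.

Lemma norm1_ge0 z : 0 <= norm1 z. Proof. exact: addr_ge0. Qed.
Lemma norm1_0 : norm1 0 = 0. Proof. by rewrite /norm1 /= normr0 addr0. Qed.
Lemma norm2sq_ge0 z : 0 <= norm2sq z. Proof. by rewrite addr_ge0// sqr_ge0. Qed.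
Lemma Re_le_norm1 z : `|Re z| <= norm1 z. Proof. by rewrite lerDl. Qed.
Lemma Im_le_norm1 z : `|Im z| <= norm1 z. Proof. by rewrite lerDr. Qed.
Lemma norm1D z w : norm1 (z + w) <= norm1 z + norm1 w.
Proof. by rewrite /norm1 ReDc ImDc addrACA lerD// ler_normD. Qed.
Lemma norm1_conj z : norm1 (conjc z) = norm1 z.
Proof. by rewrite /norm1 Re_conjc Im_conjc normrN. Qed.
Lemma norm1M z w : norm1 (z * w) <= norm1 z * norm1 w.
Proof.
rewrite /norm1 ReMc ImMc.
have := ler_normB (Re z * Re w) (Im z * Im w).
have := ler_normD (Re z * Im w) (Im z * Re w).
rewrite !normrM; nra.
Qed.
Lemma norm1_sum I (r : seq I) (P : pred I) (F : I -> C) :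
  norm1 (\sum_(i <- r | P i) F i) <= \sum_(i <- r | P i) norm1 (F i).
Proof.
apply: (big_ind2 (fun z x => norm1 z <= x)) => //; first by rewrite norm1_0.
by move=> z x w y zx wy; rewrite (le_trans (norm1D _ _))// lerD.
Qed.
Lemma norm1_sqr_le z : norm1 z ^+ 2 <= 2 * norm2sq z.
Proof.
rewrite /norm1 /norm2sq -(real_normK (num_real (Re z))) -(real_normK (num_real (Im z))).
by have := sqr_ge0 (`|Re z| - `|Im z|); nra.
Qed.
Lemma norm2sq_le_norm1 z : norm2sq z <= norm1 z ^+ 2.
Proof.
rewrite /norm1 /norm2sq -(real_normK (num_real (Re z))) -(real_normK (num_real (Im z))).
have := normr_ge0 (Re z); have := normr_ge0 (Im z); nra.
Qed.
Lemma norm2sqE z : z * conjc z = (norm2sq z)%:C%C.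
Proof. by case: z => a b; apply: complexP; rewrite /norm2sq /=; ring. Qed.
Lemma norm2sqN z : norm2sq (- z) = norm2sq z.
Proof. by rewrite /norm2sq ReNc ImNc !sqrrN. Qed.
Lemma norm2sqM z w : norm2sq (z * w) = norm2sq z * norm2sq w.
Proof. by rewrite /norm2sq ReMc ImMc; ring. Qed.
Lemma norm2sqD z w : norm2sq (z + w) <= 2 * norm2sq z + 2 * norm2sq w.
Proof.
rewrite /norm2sq ReDc ImDc.
have := sqr_ge0 (Re z - Re w); have := sqr_ge0 (Im z - Im w); nra.
Qed.
Lemma norm2sqD4 z1 z2 z3 z4 : norm2sq ((z1 + z2) + (z3 + z4)) <=
  4 * (norm2sq z1 + norm2sq z2 + (norm2sq z3 + norm2sq z4)).
Proof.
by have := norm2sqD (z1 + z2) (z3 + z4); have := norm2sqD z1 z2; have := norm2sqD z3 z4; lra.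
Qed.
Lemma norm2sq_eq0 z : norm2sq z = 0 -> z = 0.
Proof.
move=> /eqP; rewrite /norm2sq paddr_eq0 ?sqr_ge0// !sqrf_eq0 => /andP[/eqP a /eqP b].
exact: complexP.
Qed.

Section Measurable.
Context d (T : measurableType d).
Implicit Types (E : set T) (f g : T -> C).

Definition cmeasurable E f :=
  measurable_fun E (fun x => Re (f x)) /\ measurable_fun E (fun x => Im (f x)).

Lemma cmeasurable_cst E (c : C) : cmeasurable E (fun=> c).
Proof. by split. Qed.
Lemma cmeasurable_conj E f : cmeasurable E f -> cmeasurable E (fun x => conjc (f x)).
Proof.
move=> [f1 f2]; split; [under eq_fun do rewrite Re_conjc|under eq_fun do rewrite Im_conjc] => //.
exact: measurableT_comp.
Qed.
Lemma cmeasurableD E f g : cmeasurable E f -> cmeasurable E g ->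
  cmeasurable E (fun x => f x + g x).
Proof.
move=> [f1 f2] [g1 g2]; split; [under eq_fun do rewrite ReDc|under eq_fun do rewrite ImDc];
exact: measurable_funD.
Qed.
Lemma cmeasurableM E f g : cmeasurable E f -> cmeasurable E g ->
  cmeasurable E (fun x => f x * g x).
Proof.
move=> [f1 f2] [g1 g2]; split; [under eq_fun do rewrite ReMc|under eq_fun do rewrite ImMc].
  by apply: measurable_funB; exact: measurable_funM.
by apply: measurable_funD; exact: measurable_funM.
Qed.
Lemma cmeasurable_sum E I (r : seq I) (F : I -> T -> C) :
  (forall i, cmeasurable E (F i)) -> cmeasurable E (fun x => \sum_(i <- r) F i x).
Proof.
move=> mF; split; [under eq_fun do rewrite Re_sum|under eq_fun do rewrite Im_sum];
by apply: measurable_sum => i; case: (mF i).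
Qed.
Lemma eq_cmeasurable E f g : (forall x, E x -> f x = g x) -> cmeasurable E f -> cmeasurable E g.
Proof.
move=> fg [f1 f2]; split.
  by apply: eq_measurable_fun f1 => x /set_mem Ex; rewrite fg.
by apply: eq_measurable_fun f2 => x /set_mem Ex; rewrite fg.
Qed.
Lemma measurable_norm2sq E f : cmeasurable E f -> measurable_fun E (fun x => norm2sq (f x)).
Proof. by move=> [f1 f2]; apply: measurable_funD; exact: measurable_funX. Qed.
End Measurable.

Section Integral.
Implicit Types (D : set R) (f g : R -> C).

Definition cintegrable D f :=
  mu.-integrable D (EFin \o (fun x => Re (f x))) /\
  mu.-integrable D (EFin \o (fun x => Im (f x))).

Lemma cintegrable_measurable D f : cintegrable D f -> cmeasurable D f.
Proof.
move=> [f1 f2]; split; apply/measurable_EFinP.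
  exact: measurable_int f1.
exact: measurable_int f2.
Qed.
Lemma cintegrable_dominated D f (g : R -> R) : measurable D ->
  cmeasurable D f -> mu.-integrable D (EFin \o g) ->
  (forall x, D x -> norm1 (f x) <= g x) -> cintegrable D f.
Proof.
move=> mD [f1 f2] ig fg; split; apply: integrable_dominated ig _ => // x Dx.
  by rewrite (le_trans _ (fg x Dx))// Re_le_norm1.
by rewrite (le_trans _ (fg x Dx))// Im_le_norm1.
Qed.
Lemma integrable_norm1 D f : measurable D -> cintegrable D f ->
  mu.-integrable D (EFin \o (fun x => norm1 (f x))).
Proof.
move=> mD [f1 f2].
by apply: integrable_addr => //; exact: integrable_norm.
Qed.
Lemma cintegrableD D f g : measurable D -> cintegrable D f -> cintegrable D g ->
  cintegrable D (fun x => f x + g x).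
Proof.
move=> mD [f1 f2] [g1 g2]; split.
  under eq_fun do rewrite ReDc; exact: integrable_addr.
under eq_fun do rewrite ImDc; exact: integrable_addr.
Qed.
Lemma cintegrableZ D f (c : C) : measurable D -> cintegrable D f ->
  cintegrable D (fun x => c * f x).
Proof.
move=> mD fi; apply: (cintegrable_dominated mD _ (integrable_cstM (norm1 c) mD (integrable_norm1 mD fi))).
  by apply: cmeasurableM; [exact: cmeasurable_cst|exact: cintegrable_measurable].
by move=> x _; exact: norm1M.
Qed.
Lemma eq_cintegrable D f g : measurable D -> (forall x, D x -> f x = g x) ->
  cintegrable D f -> cintegrable D g.
Proof.
move=> mD fg fi; apply: (cintegrable_dominated mD _ (integrable_norm1 mD fi)).
  exact: eq_cmeasurable fg (cintegrable_measurable fi).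
by move=> x Dx; rewrite fg.
Qed.
Lemma cintegrable_conj D f : measurable D -> cintegrable D f ->
  cintegrable D (fun x => conjc (f x)).
Proof.
move=> mD fi; apply: (cintegrable_dominated mD _ (integrable_norm1 mD fi)).
  by apply: cmeasurable_conj; exact: cintegrable_measurable.
by move=> x _; rewrite norm1_conj.
Qed.
Lemma cintegrable_sum D I (r : seq I) (F : I -> R -> C) : measurable D ->
  (forall i, cintegrable D (F i)) -> cintegrable D (fun x => \sum_(i <- r) F i x).
Proof.
move=> mD Fi; elim: r => [|i r IH].
  under eq_fun do rewrite big_nil.
  by split; exact: integrable0.
under eq_fun do rewrite big_cons.
exact: cintegrableD.
Qed.

Lemma eq_cintegral D f g : (forall x, D x -> f x = g x) ->
  cintegral D f = cintegral D g.
Proof.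
by move=> fg; congr Complex; apply: eq_Rintegral => x /set_mem Dx; rewrite fg.
Qed.
Lemma cintegralD D f g : measurable D -> cintegrable D f -> cintegrable D g ->
  cintegral D (fun x => f x + g x) = cintegral D f + cintegral D g.
Proof.
move=> mD [f1 f2] [g1 g2]; apply: complexP => /=.
  by rewrite -RintegralD//; apply: eq_Rintegral => x _; rewrite ReDc.
by rewrite -RintegralD//; apply: eq_Rintegral => x _; rewrite ImDc.
Qed.
Lemma cintegralZ D f (c : C) : measurable D -> cintegrable D f ->
  cintegral D (fun x => c * f x) = c * cintegral D f.
Proof.
move=> mD [f1 f2]; apply: complexP; rewrite ?ReMc ?ImMc /=.
  rewrite -!RintegralZl// -RintegralB//; [|exact: integrable_cstM..].
  by apply: eq_Rintegral => x _; rewrite ReMc.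
rewrite -!RintegralZl// -RintegralD//; [|exact: integrable_cstM..].
by apply: eq_Rintegral => x _; rewrite ImMc.
Qed.
Lemma cintegral_conj D f : measurable D -> cintegrable D f ->
  cintegral D (fun x => conjc (f x)) = conjc (cintegral D f).
Proof.
move=> mD [f1 f2]; apply: complexP; rewrite ?Re_conjc ?Im_conjc /=.
  by apply: eq_Rintegral => x _; rewrite Re_conjc.
rewrite -mulN1r -RintegralZl//.
by apply: eq_Rintegral => x _; rewrite Im_conjc mulN1r.
Qed.
Lemma cintegral0 D : cintegral D (fun=> 0) = 0.
Proof.
by apply: complexP => /=; rewrite /Rintegral integral0_eq.
Qed.
Lemma cintegral_sum D I (r : seq I) (F : I -> R -> C) : measurable D ->
  (forall i, cintegrable D (F i)) ->
  cintegral D (fun x => \sum_(i <- r) F i x) = \sum_(i <- r) cintegral D (F i).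
Proof.
move=> mD Fi; elim: r => [|i r IH].
  by rewrite [RHS]big_nil -[RHS](cintegral0 D); apply: eq_cintegral => x _; rewrite big_nil.
rewrite big_cons -IH -cintegralD//; last exact: cintegrable_sum.
by apply: eq_cintegral => x _; rewrite big_cons.
Qed.
Lemma ae_eq_cintegral D f g : measurable D -> cmeasurable D f -> cmeasurable D g ->
  {ae mu, forall x, D x -> f x = g x} -> cintegral D f = cintegral D g.
Proof.
move=> mD [f1 f2] [g1 g2] fg; congr Complex; congr fine; apply: ae_eq_integral => //;
  try exact/measurable_EFinP.
  by apply: (@filterS _ _ (ae_filter_ringOfSetsType mu) _ _ _ fg) => x /[apply] ->.
by apply: (@filterS _ _ (ae_filter_ringOfSetsType mu) _ _ _ fg) => x /[apply] ->.
Qed.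
Lemma cmeasurable_cintegral d (T : measurableType d) (E : set T) D (G : T -> R -> C) :
  measurable E -> measurable D ->
  cmeasurable (E `*` D) (fun z => G z.1 z.2) ->
  cmeasurable E (fun x => cintegral D (G x)).
Proof.
move=> mE mD [G1 G2]; split.
  exact: (@measurable_fun_Rintegral _ _ _ E D (fun z => Re (G z.1 z.2))).
exact: (@measurable_fun_Rintegral _ _ _ E D (fun z => Im (G z.1 z.2))).
Qed.
Lemma cmeasurable_section d (T : measurableType d) (E : set T) D (G : T -> R -> C) x :
  measurable E -> measurable D ->
  cmeasurable (E `*` D) (fun z => G z.1 z.2) -> E x -> cmeasurable D (G x).
Proof.
move=> mE mD [G1 G2] Ex; split.
  exact: (@measurable_fun_section _ _ _ E D (fun z => Re (G z.1 z.2))).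
exact: (@measurable_fun_section _ _ _ E D (fun z => Im (G z.1 z.2))).
Qed.

Section CFubini.
Variables (D1 D2 : set R) (G : R -> R -> C) (p q : R -> R).
Hypotheses (mD1 : measurable D1) (mD2 : measurable D2).
Hypothesis mG : cmeasurable (D1 `*` D2) (fun z => G z.1 z.2).
Hypothesis ip : mu.-integrable D1 (EFin \o p).
Hypothesis iq : mu.-integrable D2 (EFin \o q).
Hypothesis Gpq : forall x y, D1 x -> D2 y -> norm1 (G x y) <= p x * q y.

Lemma cintegral_Fubini : cintegral D1 (fun x => cintegral D2 (fun y => G x y)) =
  cintegral D2 (fun y => cintegral D1 (fun x => G x y)).
Proof.
have [G1 G2] := mG.
have Rb x y : D1 x -> D2 y -> `|Re (G x y)| <= p x * q y.
  by move=> D1x D2y; exact: le_trans (Re_le_norm1 _) (Gpq D1x D2y).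
have Ib x y : D1 x -> D2 y -> `|Im (G x y)| <= p x * q y.
  by move=> D1x D2y; exact: le_trans (Im_le_norm1 _) (Gpq D1x D2y).
apply: complexP => /=.
  exact: (@Rintegral_Fubini _ D1 D2 (fun x y => Re (G x y)) p q mD1 mD2 G1 ip iq Rb).
exact: (@Rintegral_Fubini _ D1 D2 (fun x y => Im (G x y)) p q mD1 mD2 G2 ip iq Ib).
Qed.

Lemma cintegrable_cintegral : cintegrable D1 (fun x => cintegral D2 (fun y => G x y)).
Proof.
have [G1 G2] := mG.
split; apply: (integrable_Rintegral_section _ _ _ ip iq) => // x y D1x D2y.
  exact: le_trans (Re_le_norm1 _) (Gpq D1x D2y).
exact: le_trans (Im_le_norm1 _) (Gpq D1x D2y).
Qed.
End CFubini.

End Integral.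
End ComplexFunctions.

(** * The Hilbert space L2 *)

Section HilbertSpace.
Context {R : realType}.
Local Notation mu := (@lebesgue_measure R).
Local Notation C := R[i].
Local Notation Re := complex.Re.
Local Notation Im := complex.Im.
Variables (l : R) (n : nat).
Local Notation D := (`]0, l[%classic : set R).
Local Notation V := (R -> 'cV[C]_n).
Local Notation sq := (square_integrable l n).
Local Notation cls := (@L2class R l n).

Let mD : measurable D. Proof. exact: measurable_itv. Qed.

Lemma lebesgue_measure_itv_oo_lty : (mu D < +oo)%E.
Proof. by rewrite lebesgue_measure_itv/=; case: ifP => // _; rewrite -EFinB ltry. Qed.

Lemma integrable_cst_itv_oo (c : R) : mu.-integrable D (EFin \o (fun=> c)).
Proof.
apply: measurable_bounded_integrable => //; first exact: lebesgue_measure_itv_oo_lty.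
exact: bounded_cst.
Qed.

(** Replaces the library's membership in the space of exponent 2, stated for an extension by zero,
    by measurability and integrability on [D]. *)
Lemma Lfun2P (f : R -> R) : f \_ D \in Lfun mu 2%:E <->
  measurable_fun D f /\ mu.-integrable D (EFin \o (fun x => f x ^+ 2)).
Proof.
have fE : EFin \o (fun x => (f \_ D) x ^+ 2) = (EFin \o (fun x => f x ^+ 2)) \_ D.
  by apply/funext => x; rewrite /patch /=; case: ifP => // _; rewrite expr0n.
split=> [fL|[mf f2]].
  have := fL; rewrite inE => /andP[]; rewrite inE/= => mf _; split.
    exact/(measurable_restrictT _ mD).
  by apply/integrable_mkcond => //; rewrite -fE; exact: Lfun2_integrable_sqr.
rewrite inE; apply/andP; split; rewrite inE/=.
  exact/(measurable_restrictT _ mD).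
rewrite /finite_norm unlock /Lnorm poweR_lty//.
have /integrableP[_] : mu.-integrable setT (EFin \o (fun x => (f \_ D) x ^+ 2)).
  rewrite fE; move: f2 => /integrable_mkcond H. exact: H.
apply: le_lt_trans; apply: ge0_le_integral => //.
- by move=> x _; rewrite lee_fin powR_ge0.
- apply/measurable_EFinP; apply: (@measurableT_comp _ _ _ _ _ _ (fun z => z `^ 2)) => //.
  by apply: measurableT_comp => //; exact/(measurable_restrictT _ mD).
- apply/measurable_EFinP; apply: measurableT_comp => //; apply: measurable_funX.
  exact/(measurable_restrictT _ mD).
- by move=> x _; rewrite /= lee_fin powR_mulrn// normrX.
Qed.

Lemma square_integrableP (u : V) : u \in sq <-> forall i,
  cmeasurable D (fun x => u x i ord0) /\
  mu.-integrable D (EFin \o (fun x => norm2sq (u x i ord0))).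
Proof.
split=> [/asboolP H i|H].
  have [/Lfun2P[m1 i1] /Lfun2P[m2 i2]] := H i; split; first by split.
  exact: integrable_addr.
apply/asboolP => i; have [mu_ u2] := H i.
have [m1 m2] := mu_; split; apply/Lfun2P; split => //;
  apply: integrable_dominated u2 _ => //; try exact: measurable_funX.
  by move=> x _; rewrite ger0_norm ?sqr_ge0// lerDl sqr_ge0.
by move=> x _; rewrite ger0_norm ?sqr_ge0// lerDr sqr_ge0.
Qed.

Lemma square_integrable_bounded (u : V) (B : R) :
  (forall i, cmeasurable D (fun x => u x i ord0)) ->
  (forall i x, D x -> norm1 (u x i ord0) <= B) -> u \in sq.
Proof.
move=> mu_ uB; apply/square_integrableP => i; split => //.
apply: (integrable_dominated _ _ (integrable_cst_itv_oo (B ^+ 2))) => //.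
  exact: measurable_norm2sq.
move=> x Dx; rewrite ger0_norm ?norm2sq_ge0// (le_trans (norm2sq_le_norm1 _))//.
by rewrite lerXn2r// ?nnegrE ?norm1_ge0// ?uB// (le_trans (norm1_ge0 _) (uB i x Dx)).
Qed.

Lemma sq_cmeasurable (u : V) i : u \in sq -> cmeasurable D (fun x => u x i ord0).
Proof. by move=> /square_integrableP /(_ i)[]. Qed.

Lemma sq_integrable (u : V) i : u \in sq ->
  mu.-integrable D (EFin \o (fun x => norm2sq (u x i ord0))).
Proof. by move=> /square_integrableP /(_ i)[]. Qed.

(** The interval has finite measure, and [2 * r <= r ^+ 2 + 1] dominates a function by its square
    plus a constant. *)
Lemma sq_cintegrable (u : V) i : u \in sq -> cintegrable D (fun x => u x i ord0).
Proof.
move=> su; have iu := sq_integrable i su.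
apply: (@cintegrable_dominated _ _ _ (fun x => norm2sq (u x i ord0) + 1)) => //.
- exact: sq_cmeasurable.
- by apply: integrable_addr => //; exact: integrable_cst_itv_oo.
- move=> x _; have := norm1_sqr_le (u x i ord0).
  have := sqr_ge0 (norm1 (u x i ord0) - 1); have := norm2sq_ge0 (u x i ord0); nra.
Qed.

Lemma sq_mul_cintegrable (u v : V) i j : u \in sq -> v \in sq ->
  cintegrable D (fun x => u x i ord0 * conjc (v x j ord0)).
Proof.
move=> su sv.
apply: (@cintegrable_dominated _ _ _ (fun x => norm2sq (u x i ord0) + norm2sq (v x j ord0))) => //.
- by apply: cmeasurableM; last apply: cmeasurable_conj; exact: sq_cmeasurable.
- by apply: integrable_addr => //; exact: sq_integrable.
- move=> x _; rewrite (le_trans (norm1M _ _))// norm1_conj.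
  have := norm1_sqr_le (u x i ord0); have := norm1_sqr_le (v x j ord0).
  have := sqr_ge0 (norm1 (u x i ord0) - norm1 (v x j ord0)); nra.
Qed.

Lemma sqD (u v : V) : u \in sq -> v \in sq -> (fun x => u x + v x) \in sq.
Proof. by move=> su sv; rewrite (_ : (fun _ => _) = u + v)// rpredD. Qed.

Lemma sqZ (a : C) (u : V) : u \in sq -> (fun x => a *: u x) \in sq.
Proof. by move=> su; rewrite (_ : (fun _ => _) = a *: u)// rpredZ. Qed.

Lemma sqN (u : V) : u \in sq -> (fun x => - u x) \in sq.
Proof. by move=> su; rewrite (_ : (fun _ => _) = - u)// rpredN. Qed.

Lemma L2rep_sq (f : L2 l n) : L2rep f \in sq.
Proof. exact: (valP (repr f)). Qed.

Lemma L2class_eq (u v : V) : u \in sq -> v \in sq ->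
  {ae mu, forall x, D x -> u x = v x} -> cls u = cls v.
Proof. by move=> su sv uv; apply/L2pi_eqP; rewrite !insubdK. Qed.

Lemma L2class_rep (f : L2 l n) : cls (L2rep f) = f.
Proof.
apply/L2_eqP; exact: L2classK (L2rep_sq f).
Qed.

Lemma L2classD (u v : V) : u \in sq -> v \in sq ->
  cls (fun x => u x + v x) = cls u + cls v.
Proof.
move=> su sv; rewrite /L2class -L2piD; congr (\pi_(L2 l n)%qT _); apply: val_inj.
by rewrite insubdK ?sqD// /= !insubdK.
Qed.

Lemma L2classZ (a : C) (u : V) : u \in sq -> cls (fun x => a *: u x) = a *: cls u.
Proof.
move=> su; rewrite /L2class [RHS](L2scale_pi a); congr (\pi_(L2 l n)%qT _); apply: val_inj.
by rewrite insubdK ?sqZ// /= !insubdK.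
Qed.

(** Inner products may be computed on any representative. Later proofs rely on this: they write a
    class as [cls (L2rep f)] and then generalise [L2rep f] to an arbitrary square integrable
    function. *)
Lemma dotL2_class (u v : V) : u \in sq -> v \in sq ->
  dotL2 (cls u) (cls v) = \sum_i cintegral D (fun x => u x i ord0 * conjc (v x i ord0)).
Proof.
move=> su sv.
rewrite -(@cintegral_sum _ _ _ _ (fun i x => u x i ord0 * conjc (v x i ord0)))//; last first.
  by move=> i; exact: sq_mul_cintegrable.
apply: ae_eq_cintegral => //.
- by apply: cmeasurable_sum => i; apply: cintegrable_measurable;
    apply: sq_mul_cintegrable; exact: L2rep_sq.
- by apply: cmeasurable_sum => i; apply: cintegrable_measurable; exact: sq_mul_cintegrable.
- apply: (@filterS2 _ _ (ae_filter_ringOfSetsType mu) _ _ _ _ (L2classK su) (L2classK sv)).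
  by move=> x uE vE Dx; rewrite uE// vE.
Qed.

Lemma dotL2_linear (a : C) (f g h : L2 l n) :
  dotL2 (a *: f + g) h = a * dotL2 f h + dotL2 g h.
Proof.
rewrite -(L2class_rep f) -(L2class_rep g) -(L2class_rep h).
move: (L2rep f) (L2rep_sq f) (L2rep g) (L2rep_sq g) (L2rep h) (L2rep_sq h) => u su v sv w sw.
rewrite -L2classZ// -L2classD ?sqZ// !dotL2_class ?sqD ?sqZ//.
rewrite mulr_sumr -big_split; apply: eq_bigr => i _ /=.
rewrite -cintegralZ//; last exact: sq_mul_cintegrable.
rewrite -cintegralD//; last 2 first.
- by apply: cintegrableZ => //; exact: sq_mul_cintegrable.
- exact: sq_mul_cintegrable.
by apply: eq_cintegral => x _; rewrite !mxE mulrDl mulrA.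
Qed.

Lemma dotL2_conj (f g : L2 l n) : dotL2 f g = conjc (dotL2 g f).
Proof.
rewrite -(L2class_rep f) -(L2class_rep g).
move: (L2rep f) (L2rep_sq f) (L2rep g) (L2rep_sq g) => u su v sv.
rewrite !dotL2_class// rmorph_sum; apply: eq_bigr => i _ /=.
apply/esym; apply: etrans (esym (cintegral_conj mD (sq_mul_cintegrable i i sv su))) _.
by apply: eq_cintegral => x _; rewrite rmorphM /= conjcK mulrC.
Qed.

Lemma dotL2Dl (f g h : L2 l n) : dotL2 (f + g) h = dotL2 f h + dotL2 g h.
Proof. by have := dotL2_linear 1 f g h; rewrite scale1r mul1r. Qed.
Lemma dotL20l (h : L2 l n) : dotL2 0 h = 0.
Proof. by apply: (addrI (dotL2 0 h)); rewrite -dotL2Dl !addr0. Qed.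
Lemma dotL2Zl a (f h : L2 l n) : dotL2 (a *: f) h = a * dotL2 f h.
Proof. by have := dotL2_linear a f 0 h; rewrite dotL20l !addr0. Qed.
Lemma dotL2Nl (f h : L2 l n) : dotL2 (- f) h = - dotL2 f h.
Proof. by rewrite -scaleN1r dotL2Zl mulN1r. Qed.
Lemma dotL2Dr (f g h : L2 l n) : dotL2 h (f + g) = dotL2 h f + dotL2 h g.
Proof. by rewrite ![dotL2 h _]dotL2_conj dotL2Dl rmorphD. Qed.
Lemma dotL2Zr a (f h : L2 l n) : dotL2 h (a *: f) = conjc a * dotL2 h f.
Proof. by rewrite ![dotL2 h _]dotL2_conj dotL2Zl rmorphM. Qed.
Lemma dotL2Nr (f h : L2 l n) : dotL2 h (- f) = - dotL2 h f.
Proof. by rewrite ![dotL2 h _]dotL2_conj dotL2Nl rmorphN. Qed.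
Lemma dotL20r (h : L2 l n) : dotL2 h 0 = 0.
Proof. by rewrite dotL2_conj dotL20l rmorph0. Qed.

Definition normsqL2 (f : L2 l n) : R := Re (dotL2 f f).

Lemma normsqL2_class (u : V) : u \in sq ->
  normsqL2 (cls u) = \sum_i \int[mu]_(x in D) norm2sq (u x i ord0).
Proof.
move=> su; rewrite /normsqL2 dotL2_class// Re_sum; apply: eq_bigr => i _ /=.
by apply: eq_Rintegral => x _; rewrite norm2sqE.
Qed.

Lemma normsqL2_ge0 (f : L2 l n) : 0 <= normsqL2 f.
Proof.
rewrite -(L2class_rep f) normsqL2_class ?L2rep_sq//; apply: sumr_ge0 => i _.
by apply: Rintegral_ge0 => x _; exact: norm2sq_ge0.
Qed.

Lemma dotL2_normsqL2 (f : L2 l n) : dotL2 f f = (normsqL2 f)%:C%C.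
Proof.
apply: complexP => //=; have := dotL2_conj f f => /(congr1 (@complex.Im R)).
rewrite Im_conjc => /eqP; rewrite -addr_eq0 -mulr2n mulrn_eq0/= => /eqP ->//.
Qed.

Lemma normsqL2N (f : L2 l n) : normsqL2 (- f) = normsqL2 f.
Proof. by rewrite /normsqL2 dotL2Nl dotL2Nr opprK. Qed.

Lemma normsqL2_eq0 (f : L2 l n) : normsqL2 f = 0 -> f = 0.
Proof.
rewrite -(L2class_rep f); have su := L2rep_sq f; move: (L2rep f) su => u su.
rewrite normsqL2_class// => /eqP.
rewrite psumr_eq0; last by move=> i _; apply: Rintegral_ge0 => x _; exact: norm2sq_ge0.
move=> /allP u0.
have u0' i : {ae mu, forall x, D x -> u x i ord0 = 0}.
  have /eqP ui0 := u0 i (mem_index_enum _).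
  have iu := sq_integrable i su.
  have : (\int[mu]_(x in D) `|(norm2sq (u x i ord0))%:E| = 0)%E.
    transitivity ((\int[mu]_(x in D) norm2sq (u x i ord0))%R%:E); last by rewrite ui0.
    rewrite /Rintegral fineK; last exact: (integrable_fin_num _ iu).
    by apply: eq_integral => x _; rewrite gee0_abs// lee_fin norm2sq_ge0.
  move=> /(ae_eq_integral_abs _ _ (measurable_int _ iu)) => /(_ mD).
  apply: (@filterS _ _ (ae_filter_ringOfSetsType mu)) => x ux Dx.
  by apply: norm2sq_eq0; have := ux Dx => -[].
rewrite -[RHS](L2class_rep 0); apply: L2class_eq => //; first exact: L2rep_sq.
have z0 : {ae mu, forall x, D x -> L2rep (0 : L2 l n) x = 0}.
  have /L2classK : (fun=> 0 : 'cV[C]_n) \in sq by rewrite (_ : (fun _ => _) = 0)// rpred0.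
  rewrite (_ : L2class l (fun=> 0) = 0)//.
  rewrite -(scale0r (cls u)) -L2classZ//; congr L2class.
  by apply/funext => x; rewrite scale0r.
(* The exceptional null set must not depend on the coordinate; finitely many are merged by induction
   over the list of indices. *)
have u0all : {ae mu, forall x, D x -> forall i, u x i ord0 = 0}.
  suff : {ae mu, forall x, D x -> forall i, i \in index_enum 'I_n -> u x i ord0 = 0}.
    apply: (@filterS _ _ (ae_filter_ringOfSetsType mu)) => x ux Dx i.
    by apply: ux => //; exact: mem_index_enum.
  elim: (index_enum 'I_n) => [|i s IH]; first by apply: aeW => x _ i; rewrite in_nil.
  apply: (@filterS2 _ _ (ae_filter_ringOfSetsType mu) _ _ _ _ (u0' i) IH) => x ui us Dx j.
  by rewrite inE => /predU1P[->|js]; [exact: ui|exact: us].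
apply: (@filterS2 _ _ (ae_filter_ringOfSetsType mu) _ _ _ _ u0all z0) => x ux zx Dx.
by rewrite zx//; apply/colP => i; rewrite mxE ux.
Qed.

Lemma Cauchy_Schwarz (f g : L2 l n) : norm2sq (dotL2 f g) <= normsqL2 f * normsqL2 g.
Proof.
have [g0|/eqP g0] := eqVneq (normsqL2 g) 0.
  rewrite (normsqL2_eq0 g0) dotL20r /norm2sq/= expr0n addr0.
  by rewrite mulr_ge0 ?normsqL2_ge0.
have gp : 0 < normsqL2 g by rewrite lt_def normsqL2_ge0 andbT; apply/eqP.
(* This is the component of [f] orthogonal to [g], multiplied by the squared norm of [g] so that
   nothing has to be divided. *)
have := normsqL2_ge0 ((normsqL2 g)%:C%C *: f - dotL2 f g *: g).
suff -> : normsqL2 ((normsqL2 g)%:C%C *: f - dotL2 f g *: g) =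
    normsqL2 g * (normsqL2 f * normsqL2 g - norm2sq (dotL2 f g)).
  by rewrite pmulr_rge0// subr_ge0.
rewrite {1}/normsqL2 !(dotL2Dl, dotL2Dr, dotL2Nl, dotL2Nr, dotL2Zl, dotL2Zr).
rewrite !dotL2_normsqL2 (dotL2_conj g f).
case: (dotL2 f g) => a b; rewrite /norm2sq !(ReMc, ReDc, ReNc, ImMc, ImDc, ImNc)/=; ring.
Qed.

Lemma normsqL2D (f g : L2 l n) : normsqL2 (f + g) <= 2 * normsqL2 f + 2 * normsqL2 g.
Proof.
have := normsqL2_ge0 (f - g).
rewrite /normsqL2 !dotL2Dl !dotL2Dr !dotL2Nl !dotL2Nr !ReDc !ReNc.
move: (Re _) (Re _) (Re _) (Re _) => *; lra.
Qed.

Lemma normL2_sqr (f : L2 l n) : normL2 f ^+ 2 = normsqL2 f.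
Proof. by rewrite sqr_sqrtr// normsqL2_ge0. Qed.

(** Passing to squares supplies a nonnegative constant even when [M] is negative: [M * normL2 f] is
    nonnegative anyway, because it bounds a norm. *)
Lemma bounded_operatorP (T : L2 l n -> L2 l n) : bounded_operator T <->
  linear T /\ exists2 c, 0 <= c & forall f, normsqL2 (T f) <= c * normsqL2 f.
Proof.
split=> -[lT].
  move=> [M TM]; split=> //; exists (M ^+ 2); first exact: sqr_ge0.
  move=> f; have := TM f; rewrite -!normL2_sqr => TMf; rewrite -exprMn.
  by rewrite lerXn2r// ?nnegrE ?sqrtr_ge0// (le_trans _ TMf) ?sqrtr_ge0.
move=> [c c0 Tc]; split=> //; exists (Num.sqrt c) => f.
by rewrite /normL2 -sqrtrM//; apply: ler_wsqrtr; exact: Tc.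
Qed.

End HilbertSpace.

(** * Integral operators with bounded kernels *)

Section KernelOperators.
Context {R : realType}.
Local Notation mu := (@lebesgue_measure R).
Local Notation C := R[i].
Variables (l : R) (n : nat).
Local Notation D := (`]0, l[%classic : set R).
Local Notation V := (R -> 'cV[C]_n).
Local Notation sq := (square_integrable l n).
Local Notation cls := (@L2class R l n).
Local Notation kernel := (R -> R -> 'M[C]_n).

Let mD : measurable D. Proof. exact: measurable_itv. Qed.
Let mDD : measurable (D `*` D). Proof. exact: measurableX. Qed.

Lemma cmeasurable_snd (b : R -> C) : cmeasurable D b ->
  cmeasurable (D `*` D) (fun z : R * R => b z.2).
Proof.
have aux (h : R -> R) : measurable_fun D h -> measurable_fun (D `*` D) (fun z : R * R => h z.2).
  move=> mh; apply: (@measurable_comp _ _ _ _ _ _ D h (D `*` D) snd) => //.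
    by move=> _ [[a b'] [/= ? ?] <-].
  by apply: measurable_funTS.
by move=> [b1 b2]; split; [exact: aux b1|exact: aux b2].
Qed.

Lemma cmeasurable_swap (G : R -> R -> C) : cmeasurable (D `*` D) (fun z => G z.1 z.2) ->
  cmeasurable (D `*` D) (fun z => G z.2 z.1).
Proof.
have aux (h : R * R -> R) : measurable_fun (D `*` D) h ->
    measurable_fun (D `*` D) (fun z : R * R => h (z.2, z.1)).
  move=> mh; apply: (@measurable_comp _ _ _ _ _ _ (D `*` D) h (D `*` D) (fun z => (z.2, z.1))) => //.
    by move=> _ [[a b'] [/= ? ?] <-].
  by apply: measurable_funTS; apply: measurable_fun_pair.
by move=> [b1 b2]; split; [exact: aux b1|exact: aux b2].
Qed.

Lemma cmeasurable_fst (b : R -> C) : cmeasurable D b ->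
  cmeasurable (D `*` D) (fun z : R * R => b z.1).
Proof. by move=> mb; exact: (cmeasurable_swap (G := fun _ t => b t) (cmeasurable_snd mb)). Qed.

(** The factor 2 comes from estimating the real and imaginary parts separately. *)
Lemma norm1_cintegral_le (f : R -> C) (B : R) : cmeasurable D f ->
  (forall x, D x -> norm1 (f x) <= B) ->
  norm1 (cintegral D f) <= 2 * (B * fine (mu D)).
Proof.
move=> mf fB; have [f1 f2] := cintegrable_dominated mD mf (integrable_cst_itv_oo l B) fB.
have bd (h : R -> R) : mu.-integrable D (EFin \o h) -> (forall x, D x -> `|h x| <= B) ->
    `|\int[mu]_(x in D) h x| <= B * fine (mu D).
  move=> hi hB; apply: (le_trans (le_normr_Rintegral _ hi)) => //.
  rewrite -Rintegral_cst//; apply: le_Rintegral => //; first exact: integrable_norm hi.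
  exact: integrable_cst_itv_oo.
rewrite /norm1 [2 * _]mulrDl mul1r; apply: lerD; apply: bd => // x Dx.
  exact: le_trans (Re_le_norm1 _) (fB x Dx).
exact: le_trans (Im_le_norm1 _) (fB x Dx).
Qed.

Section ScalarKernel.
Variables (k : R -> R -> C) (B : R).
Hypothesis mk : cmeasurable (D `*` D) (fun z => k z.1 z.2).
Hypothesis kB : forall x t, D x -> D t -> norm1 (k x t) <= B.

Lemma cintegrable_kernelM (b : R -> C) x : cintegrable D b -> D x ->
  cintegrable D (fun t => k x t * b t).
Proof.
move=> ib Dx; apply: (cintegrable_dominated mD _ (integrable_cstM B mD (integrable_norm1 mD ib))).
  apply: cmeasurableM; last exact: cintegrable_measurable.
  exact: (cmeasurable_section mD mD mk Dx).
move=> t Dt; rewrite (le_trans (norm1M _ _))// ler_wpM2r ?norm1_ge0//.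
exact: kB.
Qed.

Section Integrands.
Variables a b : R -> C.
Hypotheses (ia : cintegrable D a) (ib : cintegrable D b).

Let mG : cmeasurable (D `*` D) (fun z => a z.1 * (k z.1 z.2 * b z.2)).
Proof.
apply: cmeasurableM; first exact/cmeasurable_fst/cintegrable_measurable.
by apply: cmeasurableM => //; exact/cmeasurable_snd/cintegrable_measurable.
Qed.

Let ip : mu.-integrable D (EFin \o (fun x => B * norm1 (a x))).
Proof. by apply: integrable_cstM => //; exact: integrable_norm1. Qed.

Let GB x t : D x -> D t -> norm1 (a x * (k x t * b t)) <= B * norm1 (a x) * norm1 (b t).
Proof.
move=> Dx Dt; rewrite (le_trans (norm1M _ _))// mulrAC [leRHS]mulrC.
rewrite ler_wpM2l ?norm1_ge0// (le_trans (norm1M _ _))//.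
by rewrite ler_wpM2r ?norm1_ge0// kB.
Qed.

Let GE x : D x -> cintegral D (fun t => a x * (k x t * b t)) =
  a x * cintegral D (fun t => k x t * b t).
Proof. by move=> Dx; rewrite cintegralZ//; exact: cintegrable_kernelM. Qed.

Lemma cintegrable_mul_kernel :
  cintegrable D (fun x => a x * cintegral D (fun t => k x t * b t)).
Proof.
exact: eq_cintegrable mD GE (cintegrable_cintegral mD mD mG ip (integrable_norm1 mD ib) GB).
Qed.

(** The one exchange behind both operator rules: for adjoints [a] is a conjugated component of the
    test function, for compositions it is an entry of the outer kernel at a fixed first argument. *)
Lemma cintegral_kernel_Fubini :
  cintegral D (fun x => a x * cintegral D (fun t => k x t * b t)) =
  cintegral D (fun t => b t * cintegral D (fun x => k x t * a x)).
Proof.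
transitivity (cintegral D (fun x => cintegral D (fun t => a x * (k x t * b t)))).
  by apply: eq_cintegral => x Dx; rewrite GE.
rewrite (cintegral_Fubini mD mD mG ip (integrable_norm1 mD ib) GB).
apply: eq_cintegral => t Dt; rewrite -cintegralZ//; last first.
  apply: (cintegrable_dominated mD _ (integrable_cstM B mD (integrable_norm1 mD ia))).
    apply: cmeasurableM; last exact: cintegrable_measurable.
    exact: (cmeasurable_section (G := fun t x => k x t) mD mD (cmeasurable_swap (G := k) mk) Dt).
  move=> x Dx; rewrite (le_trans (norm1M _ _))// ler_wpM2r ?norm1_ge0//.
  exact: kB.
by apply: eq_cintegral => x Dx; ring.
Qed.

End Integrands.
End ScalarKernel.

(** A class closed under sums, products, adjoints and compositions, and large enough for all kernels
    at hand. It constrains [k] on the open square only, where the tangent extensions agree with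
    [Phi]. *)
Definition bounded_kernel (k : kernel) : Prop :=
  (forall i j, cmeasurable (D `*` D) (fun z => k z.1 z.2 i j)) /\
  exists2 B, 0 <= B & forall i j x t, D x -> D t -> norm1 (k x t i j) <= B.

Definition kfun (k : kernel) (u : V) (x : R) : 'cV[C]_n :=
  mxintegral D (fun t => k x t *m u t).

Definition kop (k : kernel) (f : L2 l n) : L2 l n := cls (kfun k (L2rep f)).

Section BoundedKernel.
Variable k : kernel.
Hypothesis bk : bounded_kernel k.

Lemma kernelM_cintegrable (u : V) i j x : u \in sq -> D x ->
  cintegrable D (fun t => k x t i j * u t j ord0).
Proof.
move=> su Dx; have [mk [B B0 kB]] := bk.
apply: (cintegrable_kernelM (mk i j) (kB i j)) => //.
exact: sq_cintegrable.
Qed.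

Lemma kfunE (u : V) x i : u \in sq -> D x ->
  kfun k u x i ord0 = \sum_j cintegral D (fun t => k x t i j * u t j ord0).
Proof.
move=> su Dx; rewrite mxE -(@cintegral_sum _ _ _ _ (fun j t => k x t i j * u t j ord0))//.
  by apply: eq_cintegral => t _; rewrite mxE.
by move=> j; exact: kernelM_cintegrable.
Qed.

Lemma cmeasurable_kfun (u : V) i : u \in sq -> cmeasurable D (fun x => kfun k u x i ord0).
Proof.
move=> su; have [mk _] := bk.
apply: (@eq_cmeasurable _ _ _ _ (fun x => \sum_j cintegral D (fun t => k x t i j * u t j ord0))).
  by move=> x Dx; rewrite kfunE.
apply: cmeasurable_sum => j.
apply: (cmeasurable_cintegral (G := fun x t => k x t i j * u t j ord0)) => //.
by apply: cmeasurableM; [exact: mk|exact: (cmeasurable_snd (sq_cmeasurable j su))].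
Qed.

Lemma kfun_row_sq x i : D x -> (fun t => \col_j conjc (k x t i j)) \in sq.
Proof.
move=> Dx; have [mk [B B0 kB]] := bk.
apply: (@square_integrable_bounded _ _ _ _ B) => j.
  apply: (eq_cmeasurable (f := fun t => conjc (k x t i j))); first by move=> t _; rewrite mxE.
  apply: cmeasurable_conj; exact: (cmeasurable_section (G := fun x t => k x t i j) mD mD (mk i j) Dx).
by move=> t Dt; rewrite mxE norm1_conj kB.
Qed.

(** Each value of the image function is an inner product with a conjugated row of the kernel.
    Linearity, independence of the representative and boundedness of the operator are all inherited
    from [dotL2] through this formula. *)
Lemma kfun_dotL2 (u : V) x i : u \in sq -> D x ->
  kfun k u x i ord0 = dotL2 (cls u) (cls (fun t => \col_j conjc (k x t i j))).
Proof.
move=> su Dx; rewrite kfunE// dotL2_class ?kfun_row_sq//.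
by apply: eq_bigr => j _; apply: eq_cintegral => t _; rewrite mxE conjcK mulrC.
Qed.

Lemma kfun_bound : exists2 K, 0 <= K & forall (u : V) x i, u \in sq -> D x ->
  norm2sq (kfun k u x i ord0) <= K * normsqL2 (cls u).
Proof.
have [mk [B B0 kB]] := bk.
have m0 : 0 <= fine (mu D) by rewrite fine_ge0.
(* This bounds the squared norm of one row of the kernel; Cauchy-Schwarz then gives an estimate
   uniform in [x]. *)
exists (\sum_(j < n) B ^+ 2 * fine (mu D)).
  by apply: sumr_ge0 => j _; rewrite mulr_ge0// sqr_ge0.
move=> u x i su Dx; have sr := kfun_row_sq i Dx.
have := Cauchy_Schwarz (cls u) (cls (fun t => \col_j conjc (k x t i j))).
rewrite -(kfun_dotL2 i su Dx) => H; apply: (le_trans H); rewrite [leRHS]mulrC.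
apply: ler_wpM2l; first exact: normsqL2_ge0.
rewrite (normsqL2_class sr).
apply: ler_sum => j _; rewrite -Rintegral_cst//; apply: le_Rintegral => //.
- exact: (sq_integrable j sr).
- exact: integrable_cst_itv_oo.
- move=> t Dt; rewrite mxE (le_trans (norm2sq_le_norm1 _))// norm1_conj.
  by rewrite lerXn2r// ?nnegrE ?norm1_ge0// kB.
Qed.

Lemma kfun_sq (u : V) : u \in sq -> kfun k u \in sq.
Proof.
move=> su; have [K K0 uK] := kfun_bound.
apply: (@square_integrable_bounded _ _ _ _ (2 * (K * normsqL2 (cls u)) + 1)).
  by move=> i; exact: cmeasurable_kfun.
move=> i x Dx; have := uK u x i su Dx.
have := norm1_sqr_le (kfun k u x i ord0).
have := sqr_ge0 (norm1 (kfun k u x i ord0) - 1); have := norm1_ge0 (kfun k u x i ord0).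
have := norm2sq_ge0 (kfun k u x i ord0).
move: (K * _) (norm1 _) (norm2sq _) => *; nra.
Qed.

Lemma kfun_ae (u v : V) x : u \in sq -> v \in sq -> D x ->
  {ae mu, forall t, D t -> u t = v t} -> kfun k u x = kfun k v x.
Proof.
move=> su sv Dx uv; apply/colP => i.
apply: etrans (kfun_dotL2 i su Dx) (etrans _ (esym (kfun_dotL2 i sv Dx))).
by rewrite (L2class_eq su sv uv).
Qed.

Lemma kop_class (u : V) : u \in sq -> kop k (cls u) = cls (kfun k u).
Proof.
move=> su; apply: L2class_eq; rewrite ?kfun_sq ?L2rep_sq//.
apply: aeW => x Dx; apply: kfun_ae => //; first exact: L2rep_sq.
exact: L2classK.
Qed.

Lemma kop_linear : linear (kop k).
Proof.
move=> a f g; rewrite -(L2class_rep f) -(L2class_rep g).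
move: (L2rep f) (L2rep_sq f) (L2rep g) (L2rep_sq g) => u su v sv.
rewrite -L2classZ// -L2classD ?sqZ// !kop_class ?sqD ?sqZ//.
rewrite -L2classZ ?kfun_sq// -L2classD ?sqZ ?kfun_sq//.
have sw : (fun x => a *: u x + v x) \in sq by rewrite sqD ?sqZ.
apply: L2class_eq; rewrite ?sqD ?sqZ ?kfun_sq//.
apply: aeW => x Dx; apply/colP => i; rewrite [RHS]mxE [X in _ = X + _]mxE.
rewrite !kfun_dotL2// (@L2classD _ _ _ (fun x => a *: u x)) ?sqZ// L2classZ//.
by rewrite dotL2_linear.
Qed.

Lemma kop_bounded : bounded_operator (kop k).
Proof.
apply/bounded_operatorP; split; first exact: kop_linear.
have [K K0 uK] := kfun_bound.
have m0 : 0 <= fine (mu D) by rewrite fine_ge0.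
exists (\sum_(j < n) K * fine (mu D)); first by apply: sumr_ge0 => *; exact: mulr_ge0.
move=> f; rewrite -(L2class_rep f).
move: (L2rep f) (L2rep_sq f) => u su.
rewrite kop_class// normsqL2_class ?kfun_sq// mulr_suml; apply: ler_sum => i _.
rewrite mulrAC -Rintegral_cst//; apply: le_Rintegral => //.
- by apply: sq_integrable; exact: kfun_sq.
- exact: integrable_cst_itv_oo.
- by move=> x Dx; exact: uK.
Qed.

End BoundedKernel.

End KernelOperators.

(** * Adjoints and compositions of operators with bounded kernels *)

Section KernelComposition.
Context {R : realType}.
Local Notation mu := (@lebesgue_measure R).
Local Notation C := R[i].
Variables (l : R) (n : nat).
Local Notation D := (`]0, l[%classic : set R).
Local Notation V := (R -> 'cV[C]_n).
Local Notation sq := (square_integrable l n).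
Local Notation cls := (@L2class R l n).
Local Notation kernel := (R -> R -> 'M[C]_n).
Local Notation bounded_kernel := (@bounded_kernel R l n).
Local Notation kfun := (@kfun R l n).
Local Notation kop := (@kop R l n).

Let mD : measurable D. Proof. exact: measurable_itv. Qed.
Let mDD : measurable (D `*` D). Proof. exact: measurableX. Qed.

Definition kadj (k : kernel) : kernel := fun x t => adjmx (k t x).

Definition kcomp (k1 k2 : kernel) : kernel :=
  fun x t => mxintegral D (fun s => k1 x s *m k2 s t).

Lemma bounded_kernel_adj k : bounded_kernel k -> bounded_kernel (kadj k).
Proof.
move=> [mk [B B0 kB]]; split; last first.
  by exists B => // i j x t Dx Dt; rewrite !mxE norm1_conj kB.
move=> i j; apply: (eq_cmeasurable (f := fun z => conjc (k z.2 z.1 j i))).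
  by move=> z _; rewrite !mxE.
exact: (cmeasurable_swap (G := fun x t => conjc (k x t j i)) (cmeasurable_conj (mk j i))).
Qed.

Lemma kop_adjoint k (f g : L2 l n) : bounded_kernel k ->
  dotL2 (kop k f) g = dotL2 f (kop (kadj k) g).
Proof.
move=> bk; have bk' := bounded_kernel_adj bk; have [mk [B B0 kB]] := bk.
rewrite -(L2class_rep f) -(L2class_rep g).
move: (L2rep f) (L2rep_sq f) (L2rep g) (L2rep_sq g) => u su v sv.
rewrite (kop_class bk su) (kop_class bk' sv).
rewrite (dotL2_class (kfun_sq bk su) sv) (dotL2_class su (kfun_sq bk' sv)).
have iu j := sq_cintegrable j su.
have iv i : cintegrable D (fun x => conjc (v x i ord0)).
  by apply: cintegrable_conj => //; exact: sq_cintegrable.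
transitivity (\sum_i \sum_j cintegral D (fun x => conjc (v x i ord0) *
    cintegral D (fun t => k x t i j * u t j ord0))).
  apply: eq_bigr => i _.
  rewrite -(@cintegral_sum _ _ _ _ (fun j x => conjc (v x i ord0) *
    cintegral D (fun t => k x t i j * u t j ord0)))//.
    by apply: eq_cintegral => x Dx; rewrite kfunE// mulrC mulr_sumr.
  by move=> j; apply: (cintegrable_mul_kernel (mk i j) (kB i j)).
transitivity (\sum_j \sum_i cintegral D (fun t => u t j ord0 *
    cintegral D (fun x => k x t i j * conjc (v x i ord0)))).
  rewrite [LHS]exchange_big; apply: eq_bigr => j _; apply: eq_bigr => i _.
  exact: (cintegral_kernel_Fubini (mk i j) (kB i j)).
have mk' j i : cmeasurable (D `*` D) (fun z => k z.2 z.1 i j).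
  exact: (cmeasurable_swap (G := fun x t => k x t i j) (mk i j)).
have kB' j i x t : D x -> D t -> norm1 (k t x i j) <= B by move=> ? ?; exact: kB.
apply: eq_bigr => j _.
rewrite -(@cintegral_sum _ _ _ _ (fun i t => u t j ord0 *
    cintegral D (fun x => k x t i j * conjc (v x i ord0))))//; last first.
  by move=> i; apply: (cintegrable_mul_kernel (mk' j i) (kB' j i)).
apply: eq_cintegral => t Dt; rewrite kfunE// rmorph_sum mulr_sumr; apply: eq_bigr => i _.
congr (_ * _).
apply/esym; apply: etrans (esym (cintegral_conj mD (kernelM_cintegrable bk' j i sv Dt))) _.
by apply: eq_cintegral => x Dx; rewrite !mxE rmorphM /= conjcK.
Qed.

Lemma kcompE k1 k2 x t i m : bounded_kernel k1 -> bounded_kernel k2 -> D x -> D t ->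
  kcomp k1 k2 x t i m = \sum_j cintegral D (fun s => k1 x s i j * k2 s t j m).
Proof.
move=> [mk1 [B1 B10 kB1]] [mk2 [B2 B20 kB2]] Dx Dt; rewrite mxE.
rewrite -(@cintegral_sum _ _ _ _ (fun j s => k1 x s i j * k2 s t j m))//.
  by apply: eq_cintegral => s _; rewrite mxE.
move=> j; apply: (cintegrable_kernelM (mk1 i j) (kB1 i j)) => //.
apply: (cintegrable_dominated mD _ (integrable_cst_itv_oo l B2)).
  exact: (cmeasurable_section (G := fun t s => k2 s t j m) mD mD
    (cmeasurable_swap (G := fun s t => k2 s t j m) (mk2 j m)) Dt).
by move=> s Ds; exact: kB2.
Qed.

Lemma bounded_kernel_comp k1 k2 : bounded_kernel k1 -> bounded_kernel k2 ->
  bounded_kernel (kcomp k1 k2).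
Proof.
move=> bk1 bk2; have [mk1 [B1 B10 kB1]] := bk1; have [mk2 [B2 B20 kB2]] := bk2.
have m0 : 0 <= fine (mu D) by rewrite fine_ge0.
(* Joint measurability in [x], [t], [s] of the two factors is pulled back along the projections to
   [(x, s)] and to [(s, t)]. *)
have aux (h : R * R -> R -> R * R) : (h = fun z s => (z.1, s)) \/ (h = fun z s => (s, z.2)) ->
    forall G : R * R -> C, cmeasurable (D `*` D) G ->
    cmeasurable ((D `*` D) `*` D) (fun z : (R * R) * R => G (h z.1 z.2)).
  move=> hE G [G1 G2].
  have mh : measurable_fun ((D `*` D) `*` D) (fun z : (R * R) * R => h z.1 z.2).
    apply: measurable_funTS; case: hE => ->; apply: measurable_fun_pair => //.
      by apply: measurableT_comp.
    by apply: measurableT_comp.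
  have hD : (fun z : (R * R) * R => h z.1 z.2) @` ((D `*` D) `*` D) `<=` D `*` D.
    by move=> _ [[[x t] s] [[/= Dx Dt] Ds] <-]; case: hE => ->.
  by split; [exact: (measurable_comp mDD hD G1 mh)|exact: (measurable_comp mDD hD G2 mh)].
split=> [i m|].
  apply: (@eq_cmeasurable _ _ _ _ (fun z => \sum_j cintegral D (fun s => k1 z.1 s i j * k2 s z.2 j m))).
    by move=> [x t] [/= Dx Dt]; rewrite kcompE.
  apply: cmeasurable_sum => j.
  apply: (cmeasurable_cintegral (G := fun z s => k1 z.1 s i j * k2 s z.2 j m)) => //.
  apply: cmeasurableM.
    exact: (aux _ (or_introl erefl) (fun z => k1 z.1 z.2 i j)).
  exact: (aux _ (or_intror erefl) (fun z => k2 z.1 z.2 j m)).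
exists (\sum_(j < n) 2 * (B1 * B2 * fine (mu D))).
  by apply: sumr_ge0 => j _; rewrite !mulr_ge0.
move=> i m x t Dx Dt; rewrite kcompE//.
apply: (le_trans (norm1_sum _ _ _)); apply: ler_sum => j _; apply: norm1_cintegral_le.
  apply: cmeasurableM.
    exact: (cmeasurable_section (G := fun x s => k1 x s i j) mD mD (mk1 i j) Dx).
  exact: (cmeasurable_section (G := fun t s => k2 s t j m) mD mD
    (cmeasurable_swap (G := fun s t => k2 s t j m) (mk2 j m)) Dt).
move=> s Ds; rewrite (le_trans (norm1M _ _))//.
by apply: ler_pM; rewrite ?norm1_ge0// ?kB1// kB2.
Qed.

Lemma kfun_comp k1 k2 (u : V) x : bounded_kernel k1 -> bounded_kernel k2 -> u \in sq ->
  D x -> kfun k1 (kfun k2 u) x = kfun (kcomp k1 k2) u x.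
Proof.
move=> bk1 bk2 su Dx; have [mk1 [B1 B10 kB1]] := bk1; have [mk2 [B2 B20 kB2]] := bk2.
have bk := bounded_kernel_comp bk1 bk2.
have ik1 i j : cintegrable D (fun s => k1 x s i j).
  apply: (cintegrable_dominated mD _ (integrable_cst_itv_oo l B1)).
    exact: (cmeasurable_section (G := fun x s => k1 x s i j) mD mD (mk1 i j) Dx).
  by move=> s Ds; exact: kB1.
have iu m := sq_cintegrable m su.
apply/colP => i.
apply: etrans (kfunE bk1 i (kfun_sq bk2 su) Dx) (etrans _ (esym (kfunE bk i su Dx))).
transitivity (\sum_j \sum_m cintegral D (fun s => k1 x s i j *
    cintegral D (fun t => k2 s t j m * u t m ord0))).
  apply: eq_bigr => j _.
  rewrite -(@cintegral_sum _ _ _ _ (fun m s => k1 x s i j *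
    cintegral D (fun t => k2 s t j m * u t m ord0)))//.
    by apply: eq_cintegral => s Ds; rewrite kfunE// mulr_sumr.
  by move=> m; apply: (cintegrable_mul_kernel (mk2 j m) (kB2 j m)).
rewrite [LHS]exchange_big; apply: eq_bigr => m _ /=.
transitivity (\sum_j cintegral D (fun t => u t m ord0 *
    cintegral D (fun s => k2 s t j m * k1 x s i j))).
  by apply: eq_bigr => j _; exact: (cintegral_kernel_Fubini (mk2 j m) (kB2 j m)).
have mk2' j : cmeasurable (D `*` D) (fun z => k2 z.2 z.1 j m).
  exact: (cmeasurable_swap (G := fun s t => k2 s t j m) (mk2 j m)).
have kB2' j t s : D t -> D s -> norm1 (k2 s t j m) <= B2 by move=> ? ?; exact: kB2.
rewrite -(@cintegral_sum _ _ _ _ (fun j t => u t m ord0 *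
    cintegral D (fun s => k2 s t j m * k1 x s i j)))//; last first.
  by move=> j; apply: (cintegrable_mul_kernel (mk2' j) (kB2' j)).
apply: eq_cintegral => t Dt; rewrite -mulr_sumr mulrC kcompE//; congr (_ * _).
by apply: eq_bigr => j _; apply: eq_cintegral => s _; rewrite mulrC.
Qed.

End KernelComposition.

(** * The scalar kernel of S *)

Section DisplacementKernel.
Context {R : realType}.
Local Notation mu := (@lebesgue_measure R).

Lemma Rintegral_if (D : set R) (P : pred R) (f : R -> R) :
  \int[mu]_(z in D) (if P z then f z else 0) = \int[mu]_(z in D `&` [set z | P z]) f z.
Proof.
rewrite Rintegral_mkcondr; apply: eq_Rintegral => z _; rewrite /patch.
by case: ifPn => Pz; [rewrite mem_set|rewrite memNset//=; apply/negP].
Qed.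

Lemma integrable_bounded_itv (f : R -> R) (x y M : R) : measurable_fun setT f ->
  (forall t, t \in `[x, y] -> `|f t| <= M) -> mu.-integrable `[x, y] (EFin \o f).
Proof.
move=> mf fM.
apply: (@integrable_dominated _ _ _ (fun=> M)) => //; first exact: measurable_funTS.
apply: continuous_integrable; exact: cst_continuous.
Qed.

Lemma is_derive_reflect (F : R -> R) (c t : R) : derivable F (c - t) 1 ->
  is_derive t 1 (fun u => F (c - u)) (- derive1 F (c - t)).
Proof.
move=> dF.
have dFt : is_derive ((fun u => c - u) t) 1 F (derive1 F (c - t)).
  by apply: DeriveDef => //; rewrite derive1E.
have ds : is_derive t (1 : R) (fun u : R => c - u) (-1).
  by rewrite -[X in is_derive _ _ _ X]add0r; apply: is_deriveB.
have := @is_derive1_comp _ F (fun u : R => c - u) t _ _ dFt ds.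
by rewrite mulrN1.
Qed.

Lemma Rintegral_deriveE (F f : R -> R) (x y M : R) : x <= y ->
  (forall t : R, is_derive t 1 F (f t)) -> (forall t, t \in `[x, y + 1] -> `|f t| <= M) ->
  \int[mu]_(t in `[x, y]) f t = F y - F x.
Proof.
move=> xy dF fM.
have fE t : derive1 F t = f t by rewrite derive1E; apply: derive_val.
rewrite -(@FTC_bounded_derivative _ F M x y xy).
- by apply: eq_Rintegral => t _; rewrite fE.
- by move=> t; have [] := dF t.
- by move=> t txy; rewrite fE; exact: fM.
Qed.

Section Kernel.
Variables (a b : R -> R) (M : R).
Hypotheses (da : forall t, derivable a t 1) (db : forall t, derivable b t 1).
Hypotheses (aM : forall t, `|derive1 a t| <= M) (bM : forall t, `|derive1 b t| <= M).

Local Notation a' := (derive1 a).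
Local Notation b' := (derive1 b).

Let ma : measurable_fun setT a'. Proof. exact: measurable_derive1. Qed.
Let mb : measurable_fun setT b'. Proof. exact: measurable_derive1. Qed.
Let M0 : 0 <= M. Proof. exact: le_trans (normr_ge0 _) (aM 0). Qed.

Lemma Rintegral_derive_shift (F : R -> R) z x : (forall t, derivable F t 1) ->
  (forall t, `|derive1 F t| <= M) -> z <= x ->
  \int[mu]_(t in `[z, x]) derive1 F (t - z) = F (x - z) - F 0.
Proof.
move=> dF FM zx; rewrite -[X in _ - F X](subrr z).
apply: (@Rintegral_deriveE (fun t => F (t - z)) _ z x M) => // t.
exact: is_derive_shift.
Qed.

Lemma Rintegral_derive_reflect (F : R -> R) u p q : (forall t, derivable F t 1) ->
  (forall t, `|derive1 F t| <= M) -> p <= q ->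
  \int[mu]_(t in `[p, q]) derive1 F (u - t) = F (u - p) - F (u - q).
Proof.
move=> dF FM pq; rewrite addrC -[X in _ + X]opprK.
apply: (@Rintegral_deriveE (fun t => - F (u - t)) _ p q M) => // t; rewrite -[X in is_derive _ _ _ X]opprK; apply: is_deriveN.
exact: is_derive_reflect.
Qed.

Lemma measurable_comp_sub (h : R -> R) d (T : measurableType d) (f g : T -> R) :
  measurable_fun setT h -> measurable_fun setT f -> measurable_fun setT g ->
  measurable_fun setT (fun w => h (f w - g w)).
Proof.
move=> mh mf mg; apply: (measurableT_comp mh); exact: measurable_funB.
Qed.

Lemma measurable_if0 d (T : measurableType d) (P : T -> bool) (h : T -> R) :
  measurable_fun setT P -> measurable_fun setT h ->
  measurable_fun setT (fun w => if P w then h w else 0).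
Proof. by move=> mP mh; apply: measurable_fun_ifT. Qed.

(** Real bilinear counterpart of [kernel_s]: [a] stands for a real or imaginary part of an entry of
    the left factor, [b] for one of the right factor. [CC] reassembles the complex entries. *)
Definition skern (x t : R) : R :=
  \int[mu]_(z in `[0, Num.min x t]) (a' (x - z) * b' (t - z)) +
  (if t < x then a' (x - t) * b 0 else if x < t then a 0 * b' (t - x) else 0).

(** Moves the dependence on [t] from the limit [Num.min t u] into the integrand, so that the domain
    becomes a rectangle and Fubini applies. *)
Let G (u t z : R) : R := if z <= t then a' (t - z) * b' (u - z) else 0.

Let mG u : measurable_fun setT (fun w : R * R => G u w.1 w.2).
Proof.
apply: measurable_if0; first exact: measurable_fun_ler.
by apply: measurable_funM; apply: measurable_comp_sub.
Qed.

Let GM u t z : `|G u t z| <= M * M.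
Proof.
rewrite /G; case: ifP => _; last by rewrite normr0 mulr_ge0.
by rewrite normrM ler_pM.
Qed.

Let inner_E t u : \int[mu]_(z in `[0, Num.min t u]) (a' (t - z) * b' (u - z)) =
  \int[mu]_(z in `[0, u]) G u t z.
Proof.
rewrite /G (Rintegral_if _ (fun z => z <= t)); congr (Rintegral _ _ _).
apply/seteqP; split=> z /=; rewrite !in_itv/= le_min.
  by move=> /and3P[-> -> ->].
by move=> [/andP[-> ->] ->].
Qed.

Let iM x y : mu.-integrable `[x, y] (EFin \o (fun=> M : R)).
Proof. by apply: continuous_integrable; exact: cst_continuous. Qed.

Let mGD (u x : R) : measurable_fun (`[0, x]%classic `*` `[0, u]%classic : set (R * R)) (fun w : R * R => G u w.1 w.2).
Proof. by apply: measurable_funTS; exact: mG. Qed.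

Let integrable_inner x u :
  mu.-integrable `[0, x] (EFin \o (fun t => \int[mu]_(z in `[0, u]) G u t z)).
Proof.
by apply: (@integrable_Rintegral_section _ _ _ _ (fun=> M) (fun=> M)).
Qed.

(** After the exchange, [t] runs over [[z, x]] and only [a' (t - z)] depends on it; its integral is
    [a (x - z) - a 0]. *)
Let integral_first x u : 0 <= x -> 0 <= u ->
  \int[mu]_(t in `[0, x]) \int[mu]_(z in `[0, Num.min t u]) (a' (t - z) * b' (u - z)) =
  \int[mu]_(z in `[0, Num.min x u]) ((a (x - z) - a 0) * b' (u - z)).
Proof.
move=> x0 u0; under eq_Rintegral do rewrite inner_E.
rewrite (@Rintegral_Fubini _ _ _ _ (fun=> M) (fun=> M))//.
rewrite (_ : `[0, Num.min x u]%classic = `[0, u]%classic `&` [set z | z <= x]); last first.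
  apply/seteqP; split=> z /=; rewrite !in_itv/= le_min.
    by move=> /and3P[-> -> ->].
  by move=> [/andP[-> ->] ->].
rewrite -(Rintegral_if _ (fun z => z <= x)).
apply: eq_Rintegral => z /set_mem /=; rewrite in_itv/= => /andP[z0 zu].
rewrite /G (Rintegral_if _ (fun t => z <= t)).
case: ifPn => zx; last first.
  rewrite (_ : _ `&` _ = set0) ?Rintegral_set0//.
  apply/seteqP; split=> t //=; rewrite in_itv/= => -[/andP[_ tx] zt].
  by move: zx; rewrite (le_trans zt tx).
rewrite (_ : _ `&` _ = `[z, x]%classic); last first.
  apply/seteqP; split=> t /=; rewrite !in_itv/=; first by move=> [/andP[_ ->] ->].
  by move=> /andP[zt ->]; rewrite zt (le_trans z0 zt).
rewrite RintegralZr//; first by rewrite Rintegral_derive_shift.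
by apply: (@integrable_bounded_itv _ _ _ M) => //; apply: measurable_comp_sub.
Qed.

Let Qkern (t u : R) : R :=
  if u < t then a' (t - u) * b 0 else if t < u then a 0 * b' (u - t) else 0.

Let mQ1 (u : R) : measurable_fun setT (fun t : R => if u < t then a' (t - u) * b 0 else 0).
Proof.
apply: measurable_if0; first exact: measurable_fun_ltr.
by apply: measurable_funM => //; apply: measurable_comp_sub.
Qed.
Let mQ2 (u : R) : measurable_fun setT (fun t : R => if t < u then a 0 * b' (u - t) else 0).
Proof.
apply: measurable_if0; first exact: measurable_fun_ltr.
by apply: measurable_funM => //; apply: measurable_comp_sub.
Qed.

Let QE u t : Qkern t u = (if u < t then a' (t - u) * b 0 else 0) +
                    (if t < u then a 0 * b' (u - t) else 0).
Proof. by rewrite /Qkern; case: ltgtP; rewrite ?addr0 ?add0r. Qed.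

Let iQ1 (u x : R) : mu.-integrable `[0, x] (EFin \o (fun t : R => if u < t then a' (t - u) * b 0 else 0)).
Proof.
apply: (@integrable_bounded_itv _ _ _ (M * `|b 0|)) => // t ?.
by case: ifP => _; rewrite ?normr0 ?normrM ?mulr_ge0// ler_wpM2r.
Qed.
Let iQ2 (u x : R) : mu.-integrable `[0, x] (EFin \o (fun t : R => if t < u then a 0 * b' (u - t) else 0)).
Proof.
apply: (@integrable_bounded_itv _ _ _ (`|a 0| * M)) => // t ?.
by case: ifP => _; rewrite ?normr0 ?normrM ?mulr_ge0// ler_wpM2l.
Qed.

(** The two maxima treat both orders of [x] and [u] at once: the difference that is negative is
    replaced by [0]. The values of [a] and [b] at these maxima are what cancels in
    [skern_identity]. *)
Let integral_second x u : 0 <= x -> 0 <= u ->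
  \int[mu]_(t in `[0, x]) Qkern t u =
  (a (Num.max (x - u) 0) - a 0) * b 0 + a 0 * (b u - b (Num.max (u - x) 0)).
Proof.
move=> x0 u0; under eq_Rintegral do rewrite QE.
have ia p q : mu.-integrable `[p, q] (EFin \o (fun t => a' (t - u))).
  by apply: (@integrable_bounded_itv _ _ _ M) => //; apply: measurable_comp_sub.
have ib p q : mu.-integrable `[p, q] (EFin \o (fun t => b' (u - t))).
  by apply: (@integrable_bounded_itv _ _ _ M) => //; apply: measurable_comp_sub.
rewrite RintegralD//; congr (_ + _).
  rewrite (Rintegral_if _ (fun t => u < t)).
  have [xu|ux] := leP x u.
    rewrite (max_idPr _) ?subr_le0// subrr mul0r (_ : _ `&` _ = set0) ?Rintegral_set0//.
    apply/seteqP; split=> t //=; rewrite in_itv/= => -[/andP[_ tx] ut].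
    by have := lt_le_trans ut (le_trans tx xu); rewrite ltxx.
  rewrite (max_idPl _) ?subr_ge0 1?ltW//.
  rewrite (_ : _ `&` _ = `]u, x]%classic); last first.
    apply/seteqP; split=> t /=; rewrite !in_itv/=; first by move=> [/andP[_ ->] ->].
    by move=> /andP[ut ->]; rewrite ut (le_trans u0 (ltW ut)).
  have iu : mu.-integrable `]u, x] (EFin \o (fun t => a' (t - u))).
    by apply: integrableS (ia u x) => //; apply: subset_itvr; rewrite bnd_simp.
  rewrite RintegralZr// Rintegral_itv_obnd_cbnd//.
  by rewrite Rintegral_derive_shift// ltW.
rewrite (Rintegral_if _ (fun t => t < u)).
have [ux|xu] := leP u x.
  rewrite (max_idPr _) ?subr_le0//.
  rewrite (_ : _ `&` _ = `[0, u[%classic); last first.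
    apply/seteqP; split=> t /=; rewrite !in_itv/=; first by move=> [/andP[-> _] ->].
    by move=> /andP[-> tu]; rewrite tu (le_trans (ltW tu) ux).
  have iu : mu.-integrable `[0, u[ (EFin \o (fun t => b' (u - t))).
    by apply: integrableS (ib 0 u) => //; apply: subset_itvl; rewrite bnd_simp.
  rewrite RintegralZl// Rintegral_itv_bndo_bndc//.
  by rewrite Rintegral_derive_reflect// subr0 subrr.
rewrite (max_idPl _) ?subr_ge0 1?ltW//.
rewrite (_ : _ `&` _ = `[0, x]%classic); last first.
  apply/seteqP; split=> t /=; rewrite !in_itv/=; first by move=> [].
  by move=> /andP[-> tx]; rewrite tx (le_lt_trans tx xu).
by rewrite RintegralZl// Rintegral_derive_reflect// subr0.
Qed.

Let skernE t u : skern t u = \int[mu]_(z in `[0, u]) G u t z + Qkern t u.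
Proof. by rewrite /skern inner_E. Qed.

Lemma integrable_skern u x : mu.-integrable `[0, x] (EFin \o (fun t => skern t u)).
Proof.
have -> : (fun t => skern t u) = (fun t => \int[mu]_(z in `[0, u]) G u t z +
    ((if u < t then a' (t - u) * b 0 else 0) + (if t < u then a 0 * b' (u - t) else 0))).
  by apply/funext => t; rewrite skernE QE.
by apply: integrable_addr => //; apply: integrable_addr.
Qed.

Lemma Rintegral_skern x u : 0 <= x -> 0 <= u ->
  \int[mu]_(t in `[0, x]) skern t u =
  \int[mu]_(z in `[0, Num.min x u]) ((a (x - z) - a 0) * b' (u - z)) +
  ((a (Num.max (x - u) 0) - a 0) * b 0 + a 0 * (b u - b (Num.max (u - x) 0))).
Proof.
move=> x0 u0; rewrite -integral_first// -integral_second// -RintegralD//.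
- have -> : (fun t => \int[mu]_(z in `[0, Num.min t u]) (a' (t - z) * b' (u - z))) =
      (fun t => \int[mu]_(z in `[0, u]) G u t z).
    by apply/funext => t; rewrite inner_E.
  exact: integrable_inner.
- have -> : (fun t => Qkern t u) = (fun t => (if u < t then a' (t - u) * b 0 else 0) +
                    (if t < u then a 0 * b' (u - t) else 0)).
    by apply/funext => t; rewrite QE.
  exact: integrable_addr.
Qed.

Lemma measurable_skern (L : R) :
  measurable_fun (`]0, L[%classic `*` `]0, L[%classic : set (R * R)) (fun w : R * R => skern w.1 w.2).
Proof.
apply: measurable_funD; last first.
  apply: measurable_funTS; apply: measurable_fun_ifT; first exact: measurable_fun_ltr.
    by apply: measurable_funM => //; apply: measurable_comp_sub.
  apply: measurable_if0; first exact: measurable_fun_ltr.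
  by apply: measurable_funM => //; apply: measurable_comp_sub.
(* The limit [Num.min x t] becomes a pair of indicators on the fixed interval [[0, L]], so this is a
   parameter integral of a function measurable in three variables. *)
apply: (@eq_measurable_fun _ _ _ _ _ (fun w : R * R => \int[mu]_(z in `[0, L])
    (if z <= w.1 then if z <= w.2 then a' (w.1 - z) * b' (w.2 - z) else 0 else 0))).
  move=> [x t] /set_mem[/= /[!in_itv]/= /andP[x0 xL] /andP[t0 tL]].
  rewrite (Rintegral_if _ (fun z => z <= x)) (Rintegral_if _ (fun z => z <= t)).
  congr (Rintegral _ _ _); apply/seteqP; split=> z /=; rewrite !in_itv/= le_min.
    by move=> [[/andP[-> _] ->] ->].
  by move=> /and3P[-> zx zt]; rewrite zx zt (le_trans zx (ltW xL)).
apply: (@measurable_fun_Rintegral _ _ _ _ _ (fun v : (R * R) * R =>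
    if v.2 <= v.1.1 then if v.2 <= v.1.2 then a' (v.1.1 - v.2) * b' (v.1.2 - v.2) else 0 else 0)) => //.
  exact: measurableX.
apply: measurable_funTS.
have m1 : measurable_fun setT (fun v : (R * R) * R => v.1.1) by apply: measurableT_comp.
have m2 : measurable_fun setT (fun v : (R * R) * R => v.1.2) by apply: measurableT_comp.
have m3 : measurable_fun setT (fun v : (R * R) * R => v.2) by exact: measurable_snd.
apply: measurable_if0; first exact: measurable_fun_ler.
apply: measurable_if0; first exact: measurable_fun_ler.
by apply: measurable_funM; apply: measurable_comp_sub.
Qed.

Lemma skern_bounded (L x t : R) : 0 < x < L -> 0 < t < L ->
  `|skern x t| <= M * M * L + (M * `|b 0| + `|a 0| * M).
Proof.
move=> /andP[x0 xL] /andP[t0 tL]; rewrite /skern (le_trans (ler_normD _ _))// lerD//.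
  have [mx0 mL] : 0 <= Num.min x t /\ Num.min x t <= L.
    by split; [rewrite le_min !ltW|rewrite ge_min (ltW xL)].
  have mh : measurable_fun setT (fun z : R => a' (x - z) * b' (t - z)).
    by apply: measurable_funM; apply: measurable_comp_sub.
  have hM z : `|a' (x - z) * b' (t - z)| <= M * M by rewrite normrM ler_pM.
  have ih : mu.-integrable `[0, Num.min x t] (EFin \o (fun z => a' (x - z) * b' (t - z))).
    exact: (@integrable_bounded_itv _ _ _ (M * M)).
  apply: (le_trans (le_normr_Rintegral _ ih)) => //.
  apply: (@le_trans _ _ (\int[mu]_(z in `[0, Num.min x t]) (M * M))).
    apply: le_Rintegral => //; first exact: integrable_norm ih.
    by apply: continuous_integrable; exact: cst_continuous.
  rewrite Rintegral_cst//= lebesgue_measure_itv/= lte_fin.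
  by case: ifP => _ /=; rewrite ?mulr0 ?mulr_ge0 ?subr0 ?ler_wpM2l ?mulr_ge0// ltW// (lt_trans x0).
case: ifP => _; last case: ifP => _.
- by rewrite normrM (@le_trans _ _ (M * `|b 0|))// ?ler_wpM2r// lerDl mulr_ge0.
- by rewrite normrM (@le_trans _ _ (`|a 0| * M))// ?ler_wpM2l// lerDr mulr_ge0.
- by rewrite normr0 addr_ge0 ?mulr_ge0.
Qed.

End Kernel.

(** Lets the integral in the second argument be obtained from [Rintegral_skern] with [a] and [b]
    exchanged. *)
Lemma skernC (a b : R -> R) x t : skern a b x t = skern b a t x.
Proof.
rewrite /skern (minC t x) (_ : (if t < x then _ else _) =
  (if x < t then derive1 b (t - x) * a 0 else if t < x then b 0 * derive1 a (x - t) else 0)).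
  by apply: (congr1 (fun y => y + _)); apply: eq_Rintegral => z _; rewrite mulrC.
by case: ltgtP => // _; rewrite mulrC.
Qed.

(** The boundary terms of the two integrals, with [a] and [b] exchanged, cancel at the maxima. The
    two remaining integrals over [[0, m]] are the halves of a product rule and add up to
    [(a x - a 0) * (b u - b 0)]. *)
Lemma skern_identity (a b : R -> R) (M : R) x u :
  (forall t, derivable a t 1) -> (forall t, derivable b t 1) ->
  (forall t, `|derive1 a t| <= M) -> (forall t, `|derive1 b t| <= M) ->
  0 <= x -> 0 <= u ->
  a 0 * b 0 + \int[mu]_(t in `[0, x]) skern a b t u + \int[mu]_(t in `[0, u]) skern a b x t =
  a x * b u.
Proof.
move=> da db aM bM x0 u0.
under [X in _ + X = _]eq_Rintegral do rewrite skernC.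
rewrite (Rintegral_skern da db aM bM)// (Rintegral_skern db da bM aM)//.
set m := Num.min x u; have m0 : 0 <= m by rewrite le_min x0.
rewrite (minC u x) -/m.
(* Antiderivative of the sum of the two remaining integrands. It vanishes at [m], because there
   [x - z] or [u - z] is [0]. *)
pose F z := - ((a (x - z) - a 0) * (b (u - z) - b 0)).
have ca := derivable_continuous da; have cb := derivable_continuous db.
have cR (f : R -> R) c d : continuous f -> continuous (fun z => f (c - z) - d).
  move=> cf z; apply: cvgB; last exact: cvg_cst.
  apply: (@continuous_comp _ _ _ (fun z => c - z) f); last exact: cf.
  by apply: cvgB; [exact: cvg_cst|exact: cvg_id].
(* The derivative of [F] also contains undifferentiated factors. They are bounded by compactness, on
   [[0, m + 1]] because [Rintegral_deriveE] asks for a bound one unit beyond the interval. *)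
have bd (f : R -> R) : continuous f -> exists2 K, 0 <= K & forall t, t \in `[0, m + 1] -> `|f t| <= K.
  move=> cf; have := @compact_bounded _ _ (f @` `[0, m + 1]%classic).
  have : compact (f @` `[0, m + 1]%classic).
    by apply: continuous_compact; [exact: continuous_subspaceT|exact: segment_compact].
  move=> cpt /(_ cpt) [K [_ HK]]; exists (`|K| + 1) => // t tm.
  by apply: (HK (`|K| + 1)); [rewrite ltr_pwDr// ler_norm|exists t].
have [Ka Ka0 HKa] := bd _ (cR a x (a 0) ca).
have [Kb Kb0 HKb] := bd _ (cR b u (b 0) cb).
have M0 : 0 <= M by exact: le_trans (normr_ge0 _) (aM 0).
have ma := measurable_derive1 da; have mb := measurable_derive1 db.
have sub01 t : t \in `[0, m] -> t \in `[0, m + 1].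
  by rewrite !in_itv/= => /andP[-> tm]; rewrite (le_trans tm)// lerDl.
have J : \int[mu]_(z in `[0, m]) ((a (x - z) - a 0) * derive1 b (u - z)) +
         \int[mu]_(z in `[0, m]) ((b (u - z) - b 0) * derive1 a (x - z)) = F m - F 0.
  rewrite -RintegralD//.
  - apply: (@Rintegral_deriveE F _ _ _ (Ka * M + Kb * M)) => // [z|].
      have d1 : is_derive z 1 (fun z => a (x - z) - a 0) (- derive1 a (x - z)).
        by rewrite -[X in is_derive _ _ _ X]subr0; apply: is_deriveB; exact: is_derive_reflect.
      have d2 : is_derive z 1 (fun z => b (u - z) - b 0) (- derive1 b (u - z)).
        by rewrite -[X in is_derive _ _ _ X]subr0; apply: is_deriveB; exact: is_derive_reflect.
      have d3 := is_deriveN (is_deriveM d1 d2).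
      apply: (is_derive_eq (d3 : is_derive z 1 F _)); rewrite /GRing.scale/=; ring.
    move=> t tm; rewrite (le_trans (ler_normD _ _))// !normrM lerD// ler_pM//.
      exact: HKa.
    exact: HKb.
  - apply: (@integrable_bounded_itv _ _ _ (Ka * M)) => [|t tm].
      apply: measurable_funM; last by apply: measurable_comp_sub.
      by apply: continuous_measurable_fun; exact: cR.
    by rewrite normrM ler_pM// HKa// sub01.
  - apply: (@integrable_bounded_itv _ _ _ (Kb * M)) => [|t tm].
      apply: measurable_funM; last by apply: measurable_comp_sub.
      by apply: continuous_measurable_fun; exact: cR.
    by rewrite normrM ler_pM// HKb// sub01.
have Fm : F m = 0.
  rewrite /F /m; case: leP => _; rewrite subrr.
    by rewrite subrr mul0r oppr0.
  by rewrite (subrr (b 0)) mulr0 oppr0.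
move: J; rewrite Fm /F !subr0 sub0r opprK.
set I1 := Rintegral _ _ _; set I2 := Rintegral _ _ _ => J.
have -> : I1 = (a x - a 0) * (b u - b 0) - I2 by rewrite -J addrK.
ring.
Qed.

End DisplacementKernel.

(** * The matrix kernel of S *)

Section MatrixKernel.
Context {R : realType}.
Local Notation mu := (@lebesgue_measure R).
Local Notation C := R[i].
Local Notation Re := complex.Re.
Local Notation Im := complex.Im.
Variables (m1 m2 : nat) (l : R) (Phi : R -> 'M[C]_(m2, m1)).
Hypothesis l_gt0 : 0 < l.
Hypothesis hPhi : boundedly_differentiable `[0, l] Phi.
Local Notation D := (`]0, l[%classic : set R).
Local Notation dPhi := (mx_derive_within `[0, l] Phi).
Local Notation kernel := (kernel_s l Phi).

Let mD : measurable D. Proof. exact: measurable_itv. Qed.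

Definition RePhi i k : R -> R := tangent_extension l (fun y => Re (Phi y i k)).
Definition ImPhi i k : R -> R := tangent_extension l (fun y => Im (Phi y i k)).

(* The (i, j) entry of X *m adjmx Y when the bilinear form f stands for the product
   of a real part of X by a real part of Y. *)
Definition CC (f : (R -> R) -> (R -> R) -> R) i j : C :=
  \sum_k Complex (f (RePhi i k) (RePhi j k) + f (ImPhi i k) (ImPhi j k))
                 (f (ImPhi i k) (RePhi j k) - f (RePhi i k) (ImPhi j k)).

(** [CC] evaluates its form only at these functions, so derivability and bounds are required of them
    alone. *)
Definition Phi_part (a : R -> R) := exists i k, a = RePhi i k \/ a = ImPhi i k.

Lemma RePhi_part i k : Phi_part (RePhi i k). Proof. by exists i, k; left. Qed.
Lemma ImPhi_part i k : Phi_part (ImPhi i k). Proof. by exists i, k; right. Qed.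
#[local] Hint Resolve RePhi_part ImPhi_part : core.

Lemma eq_CC f g i j : (forall a b, Phi_part a -> Phi_part b -> f a b = g a b) ->
  CC f i j = CC g i j.
Proof. by move=> fg; apply: eq_bigr => k _; rewrite !fg. Qed.

Lemma CCD f g i j : CC (fun a b => f a b + g a b) i j = CC f i j + CC g i j.
Proof.
rewrite /CC -big_split; apply: eq_bigr => k _ /=.
by apply: complexP => /=; ring.
Qed.

Lemma CC0 i j : CC (fun _ _ => 0) i j = 0.
Proof. by rewrite /CC big1// => k _; rewrite addr0 subr0. Qed.

Lemma mulmx_adjE (X Y : 'M[C]_(m2, m1)) (p q : (R -> R) -> R) i j :
  (forall i k, X i k = Complex (p (RePhi i k)) (p (ImPhi i k))) ->
  (forall i k, Y i k = Complex (q (RePhi i k)) (q (ImPhi i k))) ->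
  (X *m adjmx Y) i j = CC (fun a b => p a * q b) i j.
Proof.
move=> XE YE; rewrite mxE; apply: eq_bigr => k _; rewrite !mxE XE YE.
by apply: complexP; rewrite ?ReMc ?ImMc /=; ring.
Qed.

Let derivable_parts x i k : `[0, l]%classic x ->
  derivable_within `[0, l] (fun y => Re (Phi y i k)) x /\
  derivable_within `[0, l] (fun y => Im (Phi y i k)) x.
Proof. by move=> x0l; have [dPhi _] := hPhi; exact: dPhi. Qed.

Lemma Phi_part_derivable a : Phi_part a -> forall t, derivable a t 1.
Proof.
by move=> [i [k [->|->]]] t; apply: derivable_tangent_extension => // x /(derivable_parts i k)[].
Qed.

Lemma Phi_part_bounded : exists2 M : R, 0 <= M & forall a, Phi_part a -> forall t,
  `|derive1 a t| <= M.
Proof.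
have [_ [M PM]] := hPhi; exists `|M| => // a [i [k aE]] t.
have := PM _ (clamp_itv l_gt0 t) i k; rewrite mxE normc_def lecR /=.
set p := derive_within _ _ _; set q := derive_within _ _ _ => pqM.
have pM : `|p| <= `|M|.
  rewrite (le_trans _ (ler_norm M))// (le_trans _ pqM)// -sqrtr_sqr.
  by apply: ler_wsqrtr; rewrite lerDl sqr_ge0.
have qM : `|q| <= `|M|.
  rewrite (le_trans _ (ler_norm M))// (le_trans _ pqM)// -sqrtr_sqr.
  by apply: ler_wsqrtr; rewrite lerDr sqr_ge0.
by case: aE => ->; rewrite derive1_tangent_extension// => x /(derivable_parts i k)[].
Qed.

Lemma PhiE x : 0 <= x <= l -> forall i k, Phi x i k = Complex (RePhi i k x) (ImPhi i k x).
Proof. by move=> xl i k; rewrite /RePhi /ImPhi !tangent_extensionE//; case: (Phi x i k). Qed.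

Lemma dPhiE x : 0 <= x <= l -> forall i k,
  dPhi x i k = Complex (derive1 (RePhi i k) x) (derive1 (ImPhi i k) x).
Proof.
move=> xl i k; rewrite mxE /RePhi /ImPhi !derive1_tangent_extension ?clamp_id//.
  by move=> y /(derivable_parts i k)[].
by move=> y /(derivable_parts i k)[].
Qed.

Lemma Phi_mul_adj x u i j : 0 <= x <= l -> 0 <= u <= l ->
  (Phi x *m adjmx (Phi u)) i j = CC (fun a b => a x * b u) i j.
Proof.
by move=> xl ul; apply: (@mulmx_adjE _ _ (fun a => a x) (fun b => b u)); exact: PhiE.
Qed.

Lemma CC_cintegral (E : set R) (f : (R -> R) -> (R -> R) -> R -> R) i j : measurable E ->
  (forall a b, Phi_part a -> Phi_part b -> mu.-integrable E (EFin \o f a b)) ->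
  cintegral E (fun t => CC (fun a b => f a b t) i j) =
  CC (fun a b => \int[mu]_(t in E) f a b t) i j.
Proof.
move=> mE fi; rewrite /CC.
have iN a b : Phi_part a -> Phi_part b -> mu.-integrable E (EFin \o (fun t => - f a b t)).
  move=> pa pb; under eq_fun do rewrite -mulN1r; exact: integrable_cstM (fi a b pa pb).
rewrite (@cintegral_sum _ _ _ _ (fun k t =>
    Complex (f (RePhi i k) (RePhi j k) t + f (ImPhi i k) (ImPhi j k) t)
            (f (ImPhi i k) (RePhi j k) t - f (RePhi i k) (ImPhi j k) t)))//.
  apply: eq_bigr => k _; apply: complexP => /=.
    by rewrite RintegralD//; exact: fi.
  by rewrite RintegralB//; exact: fi.
move=> k; split=> /=.
  by apply: integrable_addr => //; exact: fi.
by apply: integrable_addr => //; [exact: fi|exact: iN].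
Qed.

(** For [x] and [t] in the interval, all arguments [x - z], [t - z], [x - t], [t - x] that occur
    stay in [[0, l]], where the derivative within the interval and the derivative of the tangent
    extension coincide. *)
Lemma kernel_sE x t i j : 0 < x < l -> 0 < t < l ->
  kernel x t i j = CC (fun a b => skern a b x t) i j.
Proof.
move=> /andP[x0 xl] /andP[t0 tl]; have [M M0 pM] := Phi_part_bounded.
rewrite /skern (CCD (fun a b => \int[mu]_(z in `[0, Num.min x t]) (derive1 a (x - z) * derive1 b (t - z)))).
rewrite /kernel_s mxE; congr (_ + _).
  rewrite mxE -CC_cintegral//.
    apply: eq_cintegral => z /=; rewrite in_itv/= le_min => /and3P[z0 zx zt].
    apply: (@mulmx_adjE _ _ (fun a => derive1 a (x - z)) (fun b => derive1 b (t - z))); apply: dPhiE.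
      by rewrite subr_ge0 zx/= lerBlDr (le_trans (ltW xl))// lerDl.
    by rewrite subr_ge0 zt/= lerBlDr (le_trans (ltW tl))// lerDl.
  move=> a b pa pb; apply: (@integrable_bounded_itv _ _ _ _ (M * M)).
    by apply: measurable_funM; apply: measurable_comp_sub => //;
      apply: measurable_derive1; exact: Phi_part_derivable.
  by move=> z _; rewrite normrM ler_pM// pM.
have P0 := PhiE (_ : 0 <= 0 <= l); rewrite lexx ltW//= in P0.
have [tx|xt|_] := ltgtP t x.
- apply: (@mulmx_adjE _ _ (fun a => derive1 a (x - t)) (fun b => b 0)); last exact: P0.
  by apply: dPhiE; rewrite subr_ge0 ltW//= lerBlDr (le_trans (ltW xl))// lerDl ltW.
- apply: (@mulmx_adjE _ _ (fun a => a 0) (fun b => derive1 b (t - x))); first exact: P0.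
  by apply: dPhiE; rewrite subr_ge0 ltW//= lerBlDr (le_trans (ltW tl))// lerDl ltW.
- by rewrite CC0 mxE.
Qed.

Lemma cmeasurable_real d (T : measurableType d) (E : set T) (p q : T -> R) :
  measurable_fun E p -> measurable_fun E q -> cmeasurable E (fun x => Complex (p x) (q x)).
Proof. by []. Qed.

Lemma bounded_kernel_s : bounded_kernel l kernel.
Proof.
have [M M0 pM] := Phi_part_bounded; split.
  move=> i j; apply: (eq_cmeasurable (f := fun z => CC (fun a b => skern a b z.1 z.2) i j)).
    by move=> [x t] [/= /[!in_itv]/= xl tl]; rewrite kernel_sE.
  have ms a b : Phi_part a -> Phi_part b ->
      measurable_fun (D `*` D) (fun w : R * R => skern a b w.1 w.2).
    by move=> pa pb; apply: measurable_skern; exact: Phi_part_derivable.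
  apply: cmeasurable_sum => k; apply: cmeasurable_real.
    by apply: measurable_funD; exact: ms.
  by apply: measurable_funB; exact: ms.
pose N := \sum_i \sum_k (`|RePhi i k 0| + `|ImPhi i k 0|).
have N0 : 0 <= N by apply: sumr_ge0 => i _; apply: sumr_ge0 => k _; exact: addr_ge0.
have pN a : Phi_part a -> `|a 0| <= N.
  move=> [i [k aE]]; rewrite /N (bigD1 i)//= (bigD1 k)//=.
  apply: (@le_trans _ _ (`|RePhi i k 0| + `|ImPhi i k 0|)).
    by case: aE => ->; rewrite ?lerDl ?lerDr.
  rewrite -addrA lerDl addr_ge0//; apply: sumr_ge0 => k' _; rewrite ?addr_ge0//.
  by apply: sumr_ge0 => k'' _; exact: addr_ge0.
pose B0 := M * M * l + (M * N + N * M).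
have B00 : 0 <= B0 by rewrite /B0 !addr_ge0 ?mulr_ge0// ltW.
have sB a b x t : Phi_part a -> Phi_part b -> 0 < x < l -> 0 < t < l -> `|skern a b x t| <= B0.
  move=> pa pb xl tl; have da := Phi_part_derivable pa; have db := Phi_part_derivable pb.
  apply: (le_trans (skern_bounded da db (pM a pa) (pM b pb) xl tl)).
  by rewrite lerD2l lerD// ?ler_wpM2l ?ler_wpM2r ?pN.
exists (\sum_(k < m1) (B0 + B0 + (B0 + B0))).
  by apply: sumr_ge0 => k _; exact: addr_ge0 (addr_ge0 B00 B00) (addr_ge0 B00 B00).
move=> i j x t /=; rewrite !in_itv/= => xl tl; rewrite kernel_sE//.
apply: (le_trans (norm1_sum _ _ _)); apply: ler_sum => k _.
rewrite /norm1/=; apply: lerD.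
  by rewrite (le_trans (ler_normD _ _))// lerD// sB.
by rewrite (le_trans (ler_normB _ _))// lerD// sB.
Qed.

(** Every term is [CC] of a form, and [CC] is additive in the form and commutes with integration, so
    the scalar identity lifts entry by entry. *)
Lemma kernel_s_identity x u i j : 0 < x < l -> 0 < u < l ->
  (Phi 0 *m adjmx (Phi 0)) i j + cintegral `]0, x[ (fun t => kernel t u i j) +
    cintegral `]0, u[ (fun t => kernel x t i j) = (Phi x *m adjmx (Phi u)) i j.
Proof.
move=> /andP[x0 xl] /andP[u0 ul]; have [M M0 pM] := Phi_part_bounded.
have d_ a (pa : Phi_part a) := Phi_part_derivable pa.
have iS a b y z : Phi_part a -> Phi_part b -> mu.-integrable `[0, y] (EFin \o (fun t => skern a b t z)).
  move=> pa pb; apply: (@integrable_skern _ _ _ M); [exact: d_|exact: d_|exact: pM|exact: pM].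
have iSo a b y z : Phi_part a -> Phi_part b -> mu.-integrable `]0, y[ (EFin \o (fun t => skern a b t z)).
  by move=> pa pb; apply: integrableS (iS a b y z pa pb) => //; exact: subset_itv_oo_cc.
have oc (f : R -> R) y : mu.-integrable `[0, y] (EFin \o f) ->
    \int[mu]_(t in `]0, y[) f t = \int[mu]_(t in `[0, y]) f t.
  move=> fi; rewrite Rintegral_itv_obnd_cbnd; last first.
    by apply: integrableS fi => //; exact: subset_itv_oo_cc.
  by rewrite Rintegral_itv_bndo_bndc//; apply: integrableS fi => //; exact: subset_itv_co_cc.
rewrite (@eq_cintegral _ `]0, x[ _ (fun t => CC (fun a b => skern a b t u) i j)); last first.
  move=> t /=; rewrite in_itv/= => /andP[t0 tx]; rewrite kernel_sE//; last by rewrite u0.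
  by rewrite t0 (lt_trans tx).
rewrite (@eq_cintegral _ `]0, u[ _ (fun t => CC (fun a b => skern a b x t) i j)); last first.
  move=> t /=; rewrite in_itv/= => /andP[t0 tx]; rewrite kernel_sE//; first by rewrite x0.
  by rewrite t0 (lt_trans tx).
have xE a b : (fun t => skern a b x t) = (fun t => skern b a t x).
  by apply/funext => t; rewrite skernC.
have l0 : (0 : R) <= 0 <= l by apply/andP; split => //; exact: ltW.
have xl' : 0 <= x <= l by rewrite !ltW.
have ul' : 0 <= u <= l by rewrite !ltW.
rewrite !Phi_mul_adj//.
rewrite (@CC_cintegral _ (fun a b t => skern a b t u))//; last by move=> a b; exact: iSo.
rewrite (@CC_cintegral _ (fun a b t => skern a b x t))//; last first.
  by move=> a b pa pb; rewrite xE; exact: iSo.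
rewrite -!CCD; apply: eq_CC => a b pa pb.
have iC : mu.-integrable `[0, u] (EFin \o (fun t => skern a b x t)).
  by rewrite xE; exact: iS.
rewrite !oc//; last exact: iS.
apply: (@skern_identity _ _ _ M); rewrite ?ltW//; [exact: d_|exact: d_|exact: pM|exact: pM].
Qed.

Lemma Phi_cmeasurable i k : cmeasurable D (fun x => Phi x i k).
Proof.
apply: (eq_cmeasurable (f := fun x => Complex (RePhi i k x) (ImPhi i k x))).
  by move=> x /=; rewrite in_itv/= => /andP[x0 xl]; rewrite (PhiE _)// !ltW.
by apply: cmeasurable_real; apply: measurable_funTS; apply: continuous_measurable_fun;
  apply: derivable_continuous; exact: Phi_part_derivable.
Qed.

Lemma Phi_bounded : exists2 B : R, 0 <= B & forall i k x, D x -> norm1 (Phi x i k) <= B.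
Proof.
have [M M0 pM] := Phi_part_bounded.
pose N := \sum_i \sum_k (`|RePhi i k 0| + `|ImPhi i k 0|).
have N0 : 0 <= N by apply: sumr_ge0 => i _; apply: sumr_ge0 => k _; exact: addr_ge0.
have aN a x : Phi_part a -> 0 < x < l -> `|a x| <= `|a 0| + M * l.
  move=> pa /andP[x0 xl].
  have := @mean_value_bound _ a M 0 x (Phi_part_derivable pa) (fun t _ => pM a pa t) (ltW x0).
  rewrite subr0 => ax; rewrite -[a x](subrK (a 0)) addrC (le_trans (ler_normD _ _))// lerD2l.
  by rewrite (le_trans ax)// ler_wpM2l// ltW.
exists (N + (M * l + M * l)); first by rewrite !addr_ge0 ?mulr_ge0// ltW.
move=> i k x /=; rewrite in_itv/= => xl.
rewrite (PhiE _); last by case/andP: xl => ? ?; rewrite !ltW.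
rewrite /norm1/=; apply: (le_trans (lerD (aN _ x (RePhi_part i k) xl) (aN _ x (ImPhi_part i k) xl))).
rewrite addrACA lerD2r /N (bigD1 i)//= (bigD1 k)//= -addrA lerDl addr_ge0//.
  by apply: sumr_ge0 => k' _; exact: addr_ge0.
by apply: sumr_ge0 => k' _; apply: sumr_ge0 => k'' _; exact: addr_ge0.
Qed.

End MatrixKernel.

(** * The operators A and Pi *)

Section Operators.
Context {R : realType}.
Local Notation mu := (@lebesgue_measure R).
Local Notation C := R[i].
Local Notation Re := complex.Re.
Local Notation Im := complex.Im.

(** Exhibiting one adjoint shows that [xget] does not return its default; since [dU] separates
    points, the adjoint it picks must be the exhibited one. *)
Lemma adjointE (U V : lmodType C) (dU : U -> U -> C) (dV : V -> V -> C) (T : U -> V)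
    (T0 : V -> U) : is_adjoint dU dV T T0 ->
  (forall w w', (forall u, dU u w = dU u w') -> w = w') -> adjoint dU dV T = T0.
Proof.
move=> T0P ndU; rewrite /adjoint.
have : is_adjoint dU dV T (xget (fun=> 0) [set T' | is_adjoint dU dV T T']).
  have := @xgetPex _ (fun=> 0) [set T' | is_adjoint dU dV T T']; apply.
  by exists T0.
move=> T1P; apply/funext => v; apply: ndU => u.
by rewrite -T1P -T0P.
Qed.

Lemma dotC_nondegenerate n (w w' : 'cV[C]_n) : (forall u, dotC u w = dotC u w') -> w = w'.
Proof.
move=> ww'; apply/colP => i; have := ww' (delta_mx i ord0).
have dE (z : 'cV[C]_n) : dotC (delta_mx i ord0) z = conjc (z i ord0).
  rewrite /dotC (bigD1 i)//= !mxE !eqxx mul1r big1 ?addr0// => j ji.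
  by rewrite mxE (negbTE ji) mul0r.
by rewrite !dE => /(congr1 conjc); rewrite !conjcK.
Qed.

Section Vectors.
Variables (l : R) (n : nat).
Local Notation D := (`]0, l[%classic : set R).
Local Notation V := (R -> 'cV[C]_n).
Local Notation sq := (square_integrable l n).
Local Notation cls := (@L2class R l n).

Let mD : measurable D. Proof. exact: measurable_itv. Qed.

Lemma dotL2_nondegenerate (w w' : L2 l n) : (forall u, dotL2 u w = dotL2 u w') -> w = w'.
Proof.
move=> ww'; apply/eqP; rewrite -subr_eq0; apply/eqP; apply: normsqL2_eq0.
by rewrite /normsqL2 dotL2Dr dotL2Nr ww' subrr.
Qed.

Lemma sq_eq (u v : V) : (forall x, D x -> u x = v x) -> u \in sq -> v \in sq.
Proof.
move=> uv su; apply/square_integrableP => i; split.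
  by apply: eq_cmeasurable (sq_cmeasurable i su) => x Dx; rewrite uv.
have mv : cmeasurable D (fun x => v x i ord0).
  by apply: eq_cmeasurable (sq_cmeasurable i su) => x Dx; rewrite uv.
apply: integrable_dominated (sq_integrable i su) _ => //; first exact: measurable_norm2sq.
by move=> x Dx; rewrite uv// ger0_norm// norm2sq_ge0.
Qed.

Lemma L2class_eqD (u v : V) : (forall x, D x -> u x = v x) -> u \in sq -> cls u = cls v.
Proof.
by move=> uv su; apply: L2class_eq => //; [exact: sq_eq su|apply: aeW].
Qed.

(** Kernel of [V]; the strict inequality makes its operator integrate over []0, x[], exactly as in
    [opA]. *)
Definition volterra_kernel (x t : R) : 'M[C]_n := if t < x then 1%:M else 0.

Lemma bounded_volterra : bounded_kernel l volterra_kernel.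
Proof.
have m1 : measurable_fun (D `*` D) (fun z : R * R => if z.2 < z.1 then 1 else 0 : R).
  by apply: measurable_funTS; apply: measurable_fun_ifT => //; exact: measurable_fun_ltr.
split=> [i j|].
  apply: (eq_cmeasurable (f := fun z : R * R => Complex (if z.2 < z.1 then 1 else 0 : R) (0 : R) * (i == j)%:R)).
    move=> z _; rewrite /volterra_kernel; case: ifP => _; rewrite !mxE.
      by rewrite (_ : Complex 1 0 = 1)// mul1r.
    by rewrite (_ : Complex 0 0 = 0)// mul0r.
  by apply: cmeasurableM; [split|exact: cmeasurable_cst].
exists 1 => // i j x t _ _; rewrite /volterra_kernel.
case: ifP => _; rewrite !mxE ?norm1_0//.
by case: (i == j); rewrite ?mulr1n ?mulr0n /norm1/= ?normr0 ?normr1 ?addr0.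
Qed.

Lemma volterra_kernel_if x t p (B : 'M[C]_(n, p)) :
  volterra_kernel x t *m B = if t < x then B else 0.
Proof. by rewrite /volterra_kernel; case: ifP; rewrite ?mul1mx ?mul0mx. Qed.

Lemma adj_volterraE x t : kadj volterra_kernel x t = if x < t then 1%:M else 0.
Proof.
rewrite /kadj /volterra_kernel; case: ifP => _; apply/matrixP => i j; rewrite !mxE.
  by rewrite eq_sym; case: (_ == _); rewrite ?rmorph1 ?rmorph0.
by rewrite rmorph0.
Qed.

Lemma mxintegral_if m p (x : R) (F : R -> 'M[C]_(m, p)) : 0 < x < l ->
  mxintegral D (fun t => if t < x then F t else 0) = mxintegral `]0, x[ F.
Proof.
move=> /andP[x0 xl]; apply/matrixP => i j; rewrite !mxE.
have E : D `&` [set t | t < x] = `]0, x[%classic.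
  apply/seteqP; split=> t /=; rewrite !in_itv/=; first by move=> [/andP[-> _] ->].
  by move=> /andP[-> tx]; rewrite tx (lt_trans tx).
apply: complexP => /=.
  by rewrite -E -Rintegral_if; apply: eq_Rintegral => t _; case: ifP => _ //; rewrite mxE.
by rewrite -E -Rintegral_if; apply: eq_Rintegral => t _; case: ifP => _ //; rewrite mxE.
Qed.

Lemma kfun_volterra (u : V) x : D x -> kfun l volterra_kernel u x = mxintegral `]0, x[ u.
Proof.
move=> /= /[!in_itv]/= Dx; rewrite -(mxintegral_if _ Dx) /kfun; congr mxintegral.
by apply/funext => t; rewrite volterra_kernel_if.
Qed.

Lemma opAE (f : L2 l n) : opA f = - 'i%C *: kop volterra_kernel f.
Proof.
have su := kfun_sq bounded_volterra (L2rep_sq f).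
apply: etrans _ (L2classZ (- 'i%C) su); apply/esym/L2class_eqD; last exact: sqZ.
by move=> x Dx; rewrite kfun_volterra.
Qed.

Lemma opA_adjE : @opA_adj R l n = fun f => 'i%C *: kop (kadj volterra_kernel) f.
Proof.
apply: adjointE; last exact: dotL2_nondegenerate.
move=> f g; rewrite opAE dotL2Zl dotL2Zr kop_adjoint; last exact: bounded_volterra.
by congr (_ * _); apply: complexP => /=; rewrite ?oppr0.
Qed.

End Vectors.

(** * The operator [Pi], its adjoint, and the kernel of their product *)

Section Pi.
Variables (m1 m2 : nat) (l : R) (Phi : R -> 'M[C]_(m2, m1)).
Hypothesis l_gt0 : 0 < l.
Hypothesis hPhi : boundedly_differentiable `[0, l] Phi.
Local Notation D := (`]0, l[%classic : set R).
Local Notation sq := (square_integrable l m2).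
Local Notation cls := (@L2class R l m2).

Let mD : measurable D. Proof. exact: measurable_itv. Qed.

(** The first summand comes from [Phi1] and its adjoint; the summand [1%:M] comes from [Phi2] and
    its adjoint, whose product integrates a function over the whole interval. *)
Definition Pi_kernel (x t : R) : 'M[C]_m2 := Phi x *m adjmx (Phi t) + 1%:M.

Lemma Phi_mul_sq (g : 'cV[C]_m1) : (fun x => Phi x *m g) \in sq.
Proof.
have [B B0 PB] := Phi_bounded l_gt0 hPhi.
apply: (@square_integrable_bounded _ _ _ _ (\sum_k B * norm1 (g k ord0))) => i.
  apply: (eq_cmeasurable (f := fun x => \sum_k Phi x i k * g k ord0)).
    by move=> x _; rewrite mxE.
  apply: cmeasurable_sum => k; apply: cmeasurableM; last exact: cmeasurable_cst.
  exact: Phi_cmeasurable.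
move=> x Dx; rewrite mxE (le_trans (norm1_sum _ _ _))//; apply: ler_sum => k _.
by rewrite (le_trans (norm1M _ _))// ler_wpM2r ?norm1_ge0// PB.
Qed.

Lemma cst_sq (g : 'cV[C]_m2) : (fun=> g) \in sq.
Proof.
apply: (@square_integrable_bounded _ _ _ _ (\sum_i norm1 (g i ord0))) => i.
  exact: cmeasurable_cst.
by move=> x _; rewrite (bigD1 i)//= lerDl sumr_ge0// => j _; exact: norm1_ge0.
Qed.

Lemma opPiE g : opPi l Phi g = cls (fun x => Phi x *m usubmx g + dsubmx g).
Proof. by rewrite /opPi -L2classD ?Phi_mul_sq ?cst_sq. Qed.

Lemma bounded_Pi_kernel : bounded_kernel l Pi_kernel.
Proof.
have [B B0 PB] := Phi_bounded l_gt0 hPhi; split=> [i j|].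
  apply: (eq_cmeasurable (f := fun z : R * R =>
      (\sum_k Phi z.1 i k * conjc (Phi z.2 j k)) + (i == j)%:R)).
    by move=> z _; rewrite !mxE; congr (_ + _); apply: eq_bigr => k _; rewrite !mxE.
  apply: cmeasurableD; last exact: cmeasurable_cst.
  apply: cmeasurable_sum => k; apply: cmeasurableM.
    by apply: (cmeasurable_fst (b := fun x => Phi x i k)); exact: Phi_cmeasurable.
  by apply: (cmeasurable_snd (b := fun x => conjc (Phi x j k))); apply: cmeasurable_conj;
    exact: Phi_cmeasurable.
exists (\sum_(k < m1) B * B + 1); first by rewrite addr_ge0// sumr_ge0// => *; exact: mulr_ge0.
move=> i j x t Dx Dt; rewrite !mxE (le_trans (norm1D _ _))// lerD//.
  rewrite (le_trans (norm1_sum _ _ _))//; apply: ler_sum => k _.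
  by rewrite !mxE (le_trans (norm1M _ _))// norm1_conj ler_pM ?norm1_ge0// PB.
by case: (i == j); rewrite ?mulr1n ?mulr0n /norm1/= ?normr0 ?normr1 ?addr0.
Qed.

Definition Pi_adj_fun (u : R -> 'cV[C]_m2) : 'cV[C]_(m1 + m2) :=
  col_mx (mxintegral D (fun t => adjmx (Phi t) *m u t)) (mxintegral D u).

Let Phi_mul_cintegrable (u : R -> 'cV[C]_m2) i k : u \in sq ->
  cintegrable D (fun t => conjc (Phi t i k) * u t i ord0).
Proof.
move=> su; have [B B0 PB] := Phi_bounded l_gt0 hPhi; have iu := sq_cintegrable i su.
apply: (cintegrable_dominated mD _ (integrable_cstM B mD (integrable_norm1 mD iu))).
  apply: cmeasurableM; last exact: cintegrable_measurable.
  by apply: cmeasurable_conj; exact: Phi_cmeasurable.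
by move=> x Dx; rewrite (le_trans (norm1M _ _))// norm1_conj ler_wpM2r ?norm1_ge0// PB.
Qed.

Lemma Phi_adj_integralE (u : R -> 'cV[C]_m2) k : u \in sq ->
  mxintegral D (fun t => adjmx (Phi t) *m u t) k ord0 =
  \sum_i cintegral D (fun t => conjc (Phi t i k) * u t i ord0).
Proof.
move=> su; rewrite mxE -(@cintegral_sum _ _ _ _ (fun i t => conjc (Phi t i k) * u t i ord0))//.
  by apply: eq_cintegral => t _; rewrite mxE; apply: eq_bigr => i _; rewrite !mxE.
by move=> i; exact: Phi_mul_cintegrable.
Qed.

Lemma opPi_adjE : opPi_adj Phi = fun f : L2 l m2 => Pi_adj_fun (L2rep f).
Proof.
apply: adjointE; last exact: dotC_nondegenerate.
move=> g f; have su := L2rep_sq f; rewrite opPiE -{1}(L2class_rep f).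
move: (L2rep f) su => u su; rewrite dotL2_class ?sqD ?Phi_mul_sq ?cst_sq//.
have iu i := sq_cintegrable i su.
have iuc i := cintegrable_conj mD (iu i).
have iPc i k := cintegrable_conj mD (Phi_mul_cintegrable i k su).
rewrite /dotC big_split_ord/=.
transitivity (\sum_i (\sum_k usubmx g k ord0 * conjc (cintegral D (fun t => conjc (Phi t i k) * u t i ord0)) +
    dsubmx g i ord0 * conjc (cintegral D (fun t => u t i ord0)))).
  apply: eq_bigr => i _.
  rewrite -[X in _ = _ + _ * X](cintegral_conj mD (iu i)) -(cintegralZ _ mD (iuc i)).
  under [X in _ = X + _]eq_bigr => k _.
    rewrite -(cintegral_conj mD (Phi_mul_cintegrable i k su)) -(cintegralZ _ mD (iPc i k)); over.
  rewrite -(@cintegral_sum _ _ _ _ (fun k t => usubmx g k ord0 * conjc (conjc (Phi t i k) * u t i ord0)))//; last first.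
    by move=> k; exact: cintegrableZ.
  rewrite -cintegralD//; last 2 first.
  - by apply: cintegrable_sum => // k; exact: cintegrableZ.
  - exact: cintegrableZ.
  apply: eq_cintegral => t _; rewrite mxE mulrDl; congr (_ + _).
  rewrite mxE mulr_suml; apply: eq_bigr => k _.
  by rewrite rmorphM /= conjcK; ring.
rewrite big_split/= exchange_big/=; congr (_ + _).
  apply: eq_bigr => k _; rewrite col_mxEu Phi_adj_integralE// rmorph_sum mulr_sumr.
  by apply: eq_bigr => i _; rewrite mxE.
by apply: eq_bigr => i _; rewrite col_mxEd !mxE.
Qed.

Lemma opPi_opPi_adj (f : L2 l m2) : opPi l Phi (opPi_adj Phi f) = kop Pi_kernel f.
Proof.
rewrite opPi_adjE opPiE; apply/esym; apply: L2class_eqD; last first.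
  by apply: kfun_sq; [exact: bounded_Pi_kernel|exact: L2rep_sq].
have su := L2rep_sq f; move: (L2rep f) su => u su x Dx.
have [B B0 PB] := Phi_bounded l_gt0 hPhi.
rewrite /Pi_adj_fun col_mxKu col_mxKd; apply/colP => i.
rewrite kfunE//; last exact: bounded_Pi_kernel.
rewrite !mxE; under [X in _ = X + _]eq_bigr do rewrite Phi_adj_integralE// mulr_sumr.
rewrite exchange_big/=.
have -> : cintegral D (fun t => u t i ord0) =
    \sum_j (i == j)%:R * cintegral D (fun t => u t j ord0).
  rewrite (bigD1 i)//= eqxx mul1r big1 ?addr0// => j /negbTE ji.
  by rewrite eq_sym ji mul0r.
rewrite -big_split/=; apply: eq_bigr => j _.
have iu := sq_cintegrable j su.
under [X in _ = X + _]eq_bigr do rewrite -(cintegralZ _ mD (Phi_mul_cintegrable _ _ su)).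
rewrite -(@cintegral_sum _ _ _ _ (fun k t => Phi x i k * (conjc (Phi t j k) * u t j ord0)))//; last first.
  by move=> k; apply: cintegrableZ => //; exact: Phi_mul_cintegrable.
rewrite -cintegralZ// -cintegralD//; last 2 first.
- by apply: cintegrable_sum => // k; apply: cintegrableZ => //; exact: Phi_mul_cintegrable.
- exact: cintegrableZ.
apply: eq_cintegral => t _; rewrite !mxE mulrDl; congr (_ + _).
by rewrite mulr_suml; apply: eq_bigr => k _; rewrite !mxE mulrA.
Qed.

End Pi.
End Operators.

(** * The operator S satisfies the identity *)

Lemma mxintegralE (R : realType) m n (D : set R) (F : R -> 'M[R[i]]_(m, n)) i j :
  mxintegral D F i j = cintegral D (fun x => F x i j).
Proof. by rewrite mxE. Qed.

Section KernelAlgebra.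
Context {R : realType}.
Local Notation mu := (@lebesgue_measure R).
Local Notation C := R[i].
Variables (l : R) (n : nat).
Local Notation D := (`]0, l[%classic : set R).
Local Notation V := (R -> 'cV[C]_n).
Local Notation sq := (square_integrable l n).
Local Notation cls := (@L2class R l n).
Local Notation kernel := (R -> R -> 'M[C]_n).

Let mD : measurable D. Proof. exact: measurable_itv. Qed.

(** The power of 2 is the crude result of iterating [norm2sqD]; the estimate serves only to produce
    some bound for multiplication by a constant matrix. *)
Lemma norm2sq_sum (I : Type) (r : seq I) (F : I -> C) :
  norm2sq (\sum_(i <- r) F i) <= 2 ^+ size r * \sum_(i <- r) norm2sq (F i).
Proof.
elim: r => [|i r IH]; first by rewrite !big_nil /norm2sq/= expr0n addr0 mulr0.
rewrite !big_cons (le_trans (norm2sqD _ _))// [leRHS]mulrDr; apply: lerD.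
  by rewrite ler_wpM2r ?norm2sq_ge0//= exprS ler_peMr// exprn_ege1// ler1n.
by rewrite exprS -mulrA ler_wpM2l.
Qed.

Lemma mulmx_fun_bound (M : 'M[C]_n) : exists2 K : R, 0 <= K & forall (v : 'cV[C]_n) i,
  norm2sq ((M *m v) i ord0) <= K * \sum_j norm2sq (v j ord0).
Proof.
pose N := \sum_i \sum_j norm2sq (M i j).
have N0 : 0 <= N by apply: sumr_ge0 => i _; apply: sumr_ge0 => j _; exact: norm2sq_ge0.
exists (2 ^+ size (index_enum 'I_n) * N); first by rewrite mulr_ge0// exprn_ge0.
move=> v i; rewrite mxE (le_trans (norm2sq_sum _ _))// -mulrA ler_wpM2l ?exprn_ge0//.
rewrite mulr_sumr; apply: ler_sum => j _; rewrite norm2sqM ler_wpM2r ?norm2sq_ge0//.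
rewrite /N (bigD1 i)//= (bigD1 j)//= -addrA lerDl addr_ge0// sumr_ge0// => k _.
  exact: norm2sq_ge0.
by apply: sumr_ge0 => k' _; exact: norm2sq_ge0.
Qed.

Lemma integrable_sum_norm2sq (u : V) : u \in sq ->
  mu.-integrable D (EFin \o (fun x => \sum_j norm2sq (u x j ord0))).
Proof.
move=> su; rewrite (_ : EFin \o _ = (fun x => \sum_j (norm2sq (u x j ord0))%:E)%E).
  by apply: integrable_sum => // j _; exact: sq_integrable.
by apply/funext => x /=; rewrite sumEFin.
Qed.

Lemma Rintegral_sum_norm2sq (u : V) : u \in sq ->
  \int[mu]_(x in D) (\sum_j norm2sq (u x j ord0)) =
  \sum_j \int[mu]_(x in D) norm2sq (u x j ord0).
Proof.
move=> su; have iu j : cintegrable D (fun x => (norm2sq (u x j ord0))%:C%C).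
  by split => /=; [exact: sq_integrable|exact: integrable0].
have := @cintegral_sum _ D _ (index_enum 'I_n) (fun j x => (norm2sq (u x j ord0))%:C%C) mD iu.
move=> /(congr1 (@complex.Re R)); rewrite Re_sum /= => <-.
by apply: eq_Rintegral => x _; rewrite Re_sum.
Qed.

Lemma mulmx_sq (M : 'M[C]_n) (u : V) : u \in sq -> (fun x => M *m u x) \in sq.
Proof.
move=> su; have [K K0 MK] := mulmx_fun_bound M; apply/square_integrableP => i.
have mM : cmeasurable D (fun x => (M *m u x) i ord0).
  apply: (eq_cmeasurable (f := fun x => \sum_j M i j * u x j ord0)).
    by move=> x _; rewrite mxE.
  by apply: cmeasurable_sum => j; apply: cmeasurableM; [exact: cmeasurable_cst|exact: sq_cmeasurable].
split => //; apply: (integrable_dominated mD _ (integrable_cstM K mD (integrable_sum_norm2sq su))).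
  exact: measurable_norm2sq.
by move=> x _; rewrite ger0_norm ?norm2sq_ge0.
Qed.

Lemma normsqL2_mulmx (M : 'M[C]_n) : exists2 K : R, 0 <= K & forall u : V, u \in sq ->
  normsqL2 (cls (fun x => M *m u x)) <= K * normsqL2 (cls u).
Proof.
have [K K0 MK] := mulmx_fun_bound M; exists (\sum_(i < n) K); first exact: sumr_ge0.
move=> u su; rewrite !normsqL2_class ?mulmx_sq// mulr_suml; apply: ler_sum => i _.
rewrite -Rintegral_sum_norm2sq// -RintegralZl//; last exact: integrable_sum_norm2sq.
apply: le_Rintegral => //.
- exact: (sq_integrable i (mulmx_sq M su)).
- by apply: integrable_cstM => //; exact: integrable_sum_norm2sq.
Qed.

Lemma bounded_kernelD (k1 k2 : kernel) : bounded_kernel l k1 -> bounded_kernel l k2 ->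
  bounded_kernel l (fun x t => k1 x t + k2 x t).
Proof.
move=> [mk1 [B1 B10 kB1]] [mk2 [B2 B20 kB2]]; split.
  move=> i j; apply: (eq_cmeasurable (f := fun z => k1 z.1 z.2 i j + k2 z.1 z.2 i j)).
    by move=> z _; rewrite mxE.
  exact: cmeasurableD.
exists (B1 + B2); first exact: addr_ge0.
by move=> i j x t Dx Dt; rewrite mxE (le_trans (norm1D _ _))// lerD// ?kB1 ?kB2.
Qed.

Lemma bounded_kernel_cst (M : 'M[C]_n) : bounded_kernel l (fun _ _ => M).
Proof.
split; first by move=> i j; exact: cmeasurable_cst.
have N0 : 0 <= \sum_i \sum_j norm1 (M i j).
  by apply: sumr_ge0 => i _; apply: sumr_ge0 => j _; exact: norm1_ge0.
exists (\sum_i \sum_j norm1 (M i j)) => // i j x t _ _.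
rewrite (bigD1 i)//= (bigD1 j)//= -addrA lerDl addr_ge0// sumr_ge0// => k _.
  exact: norm1_ge0.
by apply: sumr_ge0 => k' _; exact: norm1_ge0.
Qed.

Lemma bounded_kernelM (k1 k2 : kernel) : bounded_kernel l k1 -> bounded_kernel l k2 ->
  bounded_kernel l (fun x t => k1 x t *m k2 x t).
Proof.
move=> [mk1 [B1 B10 kB1]] [mk2 [B2 B20 kB2]]; split.
  move=> i j; apply: (eq_cmeasurable (f := fun z => \sum_m k1 z.1 z.2 i m * k2 z.1 z.2 m j)).
    by move=> z _; rewrite mxE.
  by apply: cmeasurable_sum => m; exact: cmeasurableM.
exists (\sum_(m < n) B1 * B2); first by apply: sumr_ge0 => *; exact: mulr_ge0.
move=> i j x t Dx Dt; rewrite mxE (le_trans (norm1_sum _ _ _))//; apply: ler_sum => m _.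
by rewrite (le_trans (norm1M _ _))// ler_pM ?norm1_ge0 ?kB1 ?kB2.
Qed.

Lemma kfunD (k1 k2 : kernel) (u : V) x : bounded_kernel l k1 -> bounded_kernel l k2 ->
  u \in sq -> D x ->
  kfun l (fun x t => k1 x t + k2 x t) u x = kfun l k1 u x + kfun l k2 u x.
Proof.
move=> bk1 bk2 su Dx; apply/colP => i; apply: etrans (kfunE (bounded_kernelD bk1 bk2) i su Dx) _.
rewrite [RHS]mxE; apply: etrans (congr2 +%R (esym (kfunE bk1 i su Dx)) (esym (kfunE bk2 i su Dx))).
rewrite -big_split; apply: eq_bigr => j _ /=.
rewrite -cintegralD//; [|exact: (kernelM_cintegrable bk1)|exact: (kernelM_cintegrable bk2)].
by apply: eq_cintegral => t _; rewrite mxE mulrDl.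
Qed.

Lemma kfun_mull (k : kernel) (M : 'M[C]_n) (u : V) x : bounded_kernel l k ->
  u \in sq -> D x -> kfun l (fun x t => M *m k x t) u x = M *m kfun l k u x.
Proof.
move=> bk su Dx; apply/colP => i.
rewrite kfunE//; last exact: bounded_kernelM (bounded_kernel_cst M) bk.
rewrite [RHS]mxE.
under [RHS]eq_bigr => m _ do rewrite kfunE// mulr_sumr.
rewrite exchange_big/=; apply: eq_bigr => j _.
under [RHS]eq_bigr => m _ do rewrite -(cintegralZ _ mD (kernelM_cintegrable bk m j su Dx)).
rewrite -(@cintegral_sum _ _ _ _ (fun m t => M i m * (k x t m j * u t j ord0)))//.
  by apply: eq_cintegral => t _; rewrite mxE mulr_suml; apply: eq_bigr => m _; rewrite mulrA.
by move=> m; apply: cintegrableZ => //; exact: (kernelM_cintegrable bk).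
Qed.

Lemma kfun_mulr (k : kernel) (M : 'M[C]_n) (u : V) x :
  kfun l (fun x t => k x t *m M) u x = kfun l k (fun t => M *m u t) x.
Proof. by rewrite /kfun; congr mxintegral; apply/funext => t; rewrite mulmxA. Qed.

(** For fixed [x] the diagonal is a single point, hence null. This is what makes the arbitrary
    diagonal values of [kernel_s] and of the Volterra kernel harmless. *)
Lemma kfun_eq (k1 k2 : kernel) (u : V) x : bounded_kernel l k1 -> bounded_kernel l k2 ->
  u \in sq -> D x -> (forall t, D t -> t != x -> k1 x t = k2 x t) ->
  kfun l k1 u x = kfun l k2 u x.
Proof.
move=> bk1 bk2 su Dx k12; apply/colP => i; apply: etrans (kfunE bk1 i su Dx) _.
apply: etrans (esym (kfunE bk2 i su Dx)); apply: eq_bigr => j _; apply: ae_eq_cintegral => //.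
- exact/cintegrable_measurable/(kernelM_cintegrable bk1).
- exact/cintegrable_measurable/(kernelM_cintegrable bk2).
- exists [set x]; split; [exact: measurable_set1|exact: lebesgue_measure_set1|].
  move=> t /= /not_implyP[Dt kt]; apply: contrapT => /eqP tx.
  by apply: kt; rewrite k12.
Qed.

End KernelAlgebra.

(** * Boundedness of [S] and the operator identity, read off from kernels *)

Section Existence.
Context {R : realType}.
Local Notation mu := (@lebesgue_measure R).
Local Notation C := R[i].
Variables (m1 m2 : nat) (l : R) (Phi : R -> 'M[C]_(m2, m1)).
Hypothesis l_gt0 : 0 < l.
Hypothesis hPhi : boundedly_differentiable `[0, l] Phi.
Local Notation D := (`]0, l[%classic : set R).
Local Notation V := (R -> 'cV[C]_m2).
Local Notation sq := (square_integrable l m2).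
Local Notation cls := (@L2class R l m2).
Local Notation s := (kernel_s l Phi).
Local Notation M0 := (1%:M + Phi 0 *m adjmx (Phi 0)).
Local Notation v := (@volterra_kernel R m2).

Let mD : measurable D. Proof. exact: measurable_itv. Qed.
Let bs : bounded_kernel l s. Proof. exact: bounded_kernel_s. Qed.
Let bv : bounded_kernel l v. Proof. exact: bounded_volterra. Qed.
Let bv' : bounded_kernel l (kadj v). Proof. exact: bounded_kernel_adj. Qed.

Lemma S_fun_sq (u : V) : u \in sq -> S_fun l Phi u \in sq.
Proof. by move=> su; exact: (sqD (mulmx_sq M0 su) (kfun_sq bs su)). Qed.

Lemma opSE (f : L2 l m2) :
  opS Phi f = cls (fun x => M0 *m L2rep f x) + kop s f.
Proof.
have su := L2rep_sq f.
exact: (L2classD (mulmx_sq M0 su) (kfun_sq bs su)).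
Qed.

Lemma opS_class (u : V) : u \in sq -> opS Phi (cls u) = cls (S_fun l Phi u).
Proof.
move=> su; rewrite opSE kop_class//.
apply: etrans _ (esym (L2classD (mulmx_sq M0 su) (kfun_sq bs su))); congr (_ + _).
apply: L2class_eq; rewrite ?mulmx_sq ?L2rep_sq//.
by apply: (@filterS _ _ (ae_filter_ringOfSetsType mu) _ _ _ (L2classK su)) => x /[apply] ->.
Qed.

Lemma opS_bounded : bounded_operator (@opS R l m1 m2 Phi).
Proof.
apply/bounded_operatorP; split.
  move=> a f g; rewrite !opSE (kop_linear bs) scalerDr addrACA; congr (_ + _).
  have su := L2rep_sq f; have sv := L2rep_sq g; have sw := L2rep_sq (a *: f + g).
  have saf : (fun x => a *: L2rep f x) \in sq by exact: sqZ.
  have smaf : (fun x => a *: (M0 *m L2rep f x)) \in sq by exact/sqZ/mulmx_sq.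
  have E1 := L2classZ a (mulmx_sq M0 su).
  have E2 := L2classD smaf (mulmx_sq M0 sv).
  apply: etrans _ (etrans E2 (congr1 (fun z => z + _) E1)).
  apply: L2class_eq; [exact: mulmx_sq|exact: (sqD smaf (mulmx_sq M0 sv))|].
  have E3 : a *: f + g = cls (fun x => a *: L2rep f x + L2rep g x).
    have e1 := L2classZ a su; have e2 := L2classD saf sv.
    by apply/esym; apply: etrans e2 _; rewrite e1 !L2class_rep.
  have := L2classK (sqD saf sv); rewrite -E3.
  apply: (@filterS _ _ (ae_filter_ringOfSetsType mu)) => x /[apply] ->.
  by rewrite mulmxDr scalemxAr.
have /bounded_operatorP[_ [c c0 kc]] := kop_bounded bs.
have [K K0 MK] := normsqL2_mulmx l M0.
exists (2 * K + 2 * c); first by rewrite addr_ge0// mulr_ge0.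
move=> f; rewrite opSE (le_trans (normsqL2D _ _))// [leRHS]mulrDl -!mulrA.
rewrite lerD// ler_wpM2l//.
by rewrite -[in leRHS](L2class_rep f); apply: MK; exact: L2rep_sq.
Qed.

Lemma kcomp_volterra_l x t : D x -> D t -> kcomp l v s x t = mxintegral `]0, x[ (fun r => s r t).
Proof.
move=> /= /[!in_itv]/= Dx Dt; rewrite -(mxintegral_if _ Dx); congr mxintegral.
by apply/funext => r; rewrite volterra_kernel_if.
Qed.

Lemma kcomp_volterra_r x t : D x -> D t ->
  kcomp l s (kadj v) x t = mxintegral `]0, t[ (fun r => s x r).
Proof.
move=> Dx /= /[!in_itv]/= Dt; rewrite -(mxintegral_if _ Dt); congr mxintegral.
by apply/funext => r; rewrite adj_volterraE; case: ifP => _; rewrite ?mulmx1 ?mulmx0.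
Qed.

(** Off the diagonal exactly one of [v x t] and [kadj v x t] is the identity, so the two terms with
    [M0] add up to [M0]. Its summand [1%:M] matches that of [Pi_kernel], and [kernel_s_identity]
    accounts for the rest. At [t = x] both Volterra kernels vanish and [M0] would be lost. *)
Lemma displacement_kernel x t : D x -> D t -> t != x ->
  v x t *m M0 + kcomp l v s x t + M0 *m kadj v x t + kcomp l s (kadj v) x t =
  Pi_kernel Phi x t.
Proof.
move=> Dx Dt tx; rewrite kcomp_volterra_l// kcomp_volterra_r// [X in X + _]addrAC.
have -> : v x t *m M0 + M0 *m kadj v x t = M0.
  rewrite /volterra_kernel adj_volterraE; case: (ltgtP t x) tx => // _ _.
    by rewrite mul1mx mulmx0 addr0.
  by rewrite mul0mx mulmx1 add0r.
have xl : 0 < x < l by move: Dx; rewrite /= in_itv.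
have tl : 0 < t < l by move: Dt; rewrite /= in_itv.
rewrite -[_ + _ + _]addrA -[_ + _ + _]addrA addrC; apply: (congr1 (fun Z => Z + _)).
apply/matrixP => i j; rewrite -(kernel_s_identity l_gt0 hPhi i j xl tl).
have E (P A B : 'M[C]_m2) : (P + (A + B)) i j = P i j + A i j + B i j by rewrite !mxE addrA.
apply: etrans (E _ _ _) (congr2 +%R (congr2 +%R (erefl _) _) _); exact: mxintegralE.
Qed.

Lemma opS_displacement (f : L2 l m2) :
  'i%C *: (opA (opS Phi f) - opS Phi (opA_adj f)) = opPi l Phi (opPi_adj Phi f).
Proof.
have [linS _] := opS_bounded.
have linSZ a (g : L2 l m2) : opS Phi (a *: g) = a *: opS Phi g.
  have S0 : opS Phi (0 : L2 l m2) = 0.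
    have := linS (-1) 0 0; rewrite scaler0 addr0 scaleN1r addNr => ->//.
  by have := linS a g 0; rewrite S0 !addr0.
rewrite opA_adjE opAE linSZ opPi_opPi_adj//.
(* Since [A] is [- 'i] times [V] and its adjoint is ['i] times [V^*], the outer factor ['i] leaves
   coefficient 1 on [V S] and turns the minus sign before [S V^*] into a plus. *)
have ii : 'i%C * - 'i%C = 1 :> C by rewrite mulrN -expr2 sqr_i opprK.
have ii' : 'i%C * 'i%C = -1 :> C by rewrite -expr2 sqr_i.
rewrite scalerBr !scalerA ii ii' scale1r scaleN1r opprK.
rewrite -(L2class_rep f); move: (L2rep f) (L2rep_sq f) => u su.
have sv'u := kfun_sq bv' su; have sSu := S_fun_sq su.
have bP := bounded_Pi_kernel l_gt0 hPhi.
rewrite opS_class// !kop_class// opS_class//.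
apply: etrans (esym (L2classD (kfun_sq bv sSu) (S_fun_sq sv'u))) _.
apply: L2class_eqD; last exact: (sqD (kfun_sq bv sSu) (S_fun_sq sv'u)).
move=> x Dx.
have bvM := bounded_kernelM bv (bounded_kernel_cst l M0).
have bMv := bounded_kernelM (bounded_kernel_cst l M0) bv'.
have bvs := bounded_kernel_comp bv bs; have bsv := bounded_kernel_comp bs bv'.
have bvMs := bounded_kernelD bvM bvs; have b3 := bounded_kernelD bvMs bMv.
have b4 := bounded_kernelD b3 bsv.
rewrite -(kfun_eq b4 bP su Dx); last by move=> t Dt tx; exact: displacement_kernel.
rewrite !kfunD// (kfun_mull M0 bv' su Dx) (kfun_mulr l v M0 u x).
have sMu := mulmx_sq M0 su; have ssu := kfun_sq bs su.
have E1 := kfun_comp bv bs su Dx; have E2 := kfun_comp bs bv' su Dx.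
(* Additivity of [V] at the point [x] is read off from additivity of the inner product through
   [kfun_dotL2]. *)
have E3 : kfun l v (S_fun l Phi u) x =
    kfun l v (fun t => M0 *m u t) x + kfun l v (kfun l s u) x.
  apply/colP => i; apply: etrans (kfun_dotL2 bv i sSu Dx) _; rewrite [RHS]mxE.
  apply: etrans _ (congr2 +%R (esym (kfun_dotL2 bv i sMu Dx)) (esym (kfun_dotL2 bv i ssu Dx))).
  apply: etrans _ (dotL2Dl _ _ _).
  exact: (congr1 (fun z => dotL2 z _) (L2classD sMu ssu)).
apply: etrans (congr2 +%R E3 (erefl (S_fun l Phi (kfun l (kadj v) u) x))) _.
apply: etrans _ (addrA _ _ _); apply: congr2; first exact: (congr1 (fun Z => _ + Z) E1).
exact: (congr1 (fun Z => M0 *m kfun l (kadj v) u x + Z) E2).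
Qed.

End Existence.

(** * Steps and ramps *)

Section NullIntegrals.
Context {R : realType}.
Local Notation mu := (@lebesgue_measure R).

(** By Lebesgue differentiation the primitive of the extension by zero has derivative [g] almost
    everywhere, while near each interior point this primitive is constantly [0]. *)
Lemma Rintegral_primitive_eq0 (l : R) (g : R -> R) : mu.-integrable `]0, l[ (EFin \o g) ->
  (forall x, 0 < x < l -> \int[mu]_(t in `]0, x[) g t = 0) ->
  {ae mu, forall x, `]0, l[%classic x -> g x = 0}.
Proof.
move=> ig g0; have mD : measurable (`]0, l[%classic : set R) by exact: measurable_itv.
pose f := g \_ `]0, l[.
have iT : mu.-integrable setT (EFin \o f).
  by rewrite -restrict_EFin; move: ig => /integrable_mkcond; apply.
have iy y : mu.-integrable `]-oo, y] (EFin \o f) by exact: integrableS iT.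
have := FTC1Ny iy (integrable_locally mD ig).
apply: (@filterS _ _ (ae_filter_ringOfSetsType mu)) => x [_ fx] /= xl.
have fE : f x = g x by rewrite /f /patch mem_set.
rewrite -fE -fx.
move: xl; rewrite in_itv/= => /andP[x0 xl].
have F0 z : 0 < z < l -> \int[mu]_(t in `]-oo, z]) f t = 0.
  move=> /andP[z0 zl]; rewrite /f -Rintegral_mkcondr.
  rewrite (_ : _ `&` _ = `]0, z]%classic); last first.
    apply/seteqP; split=> t /=; rewrite !in_itv/=; first by move=> [tz /andP[-> _]].
    by move=> /andP[-> tz]; rewrite tz (le_lt_trans tz zl).
  rewrite -Rintegral_itv_bndo_bndc; first by apply: g0; rewrite z0.
  by apply: integrableS ig => //; apply: subset_itvl; rewrite bnd_simp ltW.
rewrite derive1E (@near_eq_derive _ _ _ _ (cst 0)) ?derive_cst//.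
near=> z; apply: F0; apply/andP; split; near: z.
  exact: lt_nbhsr.
exact: lt_nbhsl.
Unshelve. all: by end_near. Qed.

End NullIntegrals.

Section Profiles.
Context {R : realType}.
Local Notation mu := (@lebesgue_measure R).
Local Notation C := R[i].
Variables (l : R) (n : nat).
Hypothesis l_gt0 : 0 < l.
Local Notation D := (`]0, l[%classic : set R).
Local Notation V := (R -> 'cV[C]_n).
Local Notation sq := (square_integrable l n).
Local Notation cls := (@L2class R l n).
Local Notation v := (@volterra_kernel R n).

Let mD : measurable D. Proof. exact: measurable_itv. Qed.
Let bv : bounded_kernel l v. Proof. exact: bounded_volterra. Qed.
Let bv' : bounded_kernel l (kadj v). Proof. exact: bounded_kernel_adj. Qed.

Definition bounded_profile (phi : R -> R) : Prop :=
  measurable_fun D phi /\ exists2 B : R, 0 <= B & forall s, D s -> `|phi s| <= B.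

Definition bumpf (phi : R -> R) (j : 'I_n) : V := fun s => (phi s)%:C%C *: delta_mx j ord0.

Definition bump (phi : R -> R) (j : 'I_n) : L2 l n := cls (bumpf phi j).

Lemma bumpfE phi j s i : bumpf phi j s i ord0 = (phi s)%:C%C * (i == j)%:R.
Proof. by rewrite !mxE eqxx andbT. Qed.

Lemma bumpf_sq phi j : bounded_profile phi -> bumpf phi j \in sq.
Proof.
move=> [mphi [B B0 phiB]]; apply: (@square_integrable_bounded _ _ _ _ B) => i.
  apply: (eq_cmeasurable (f := fun s => (phi s)%:C%C * (i == j)%:R)).
    by move=> s _; rewrite bumpfE.
  by apply: cmeasurableM; [split|exact: cmeasurable_cst].
move=> s Ds; rewrite bumpfE; case: (i == j); rewrite ?mulr1 ?mulr0 ?norm1_0//.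
by rewrite /norm1/= normr0 addr0 phiB.
Qed.

Lemma bounded_profile_lin a phi chi : bounded_profile phi -> bounded_profile chi ->
  bounded_profile (fun s => a * phi s + chi s).
Proof.
move=> [mphi [B B0 phiB]] [mchi [B' B0' chiB]]; split.
  by apply: measurable_funD => //; exact: measurable_funM.
exists (`|a| * B + B'); first by rewrite addr_ge0// mulr_ge0.
by move=> s Ds; rewrite (le_trans (ler_normD _ _))// normrM lerD ?ler_wpM2l ?phiB ?chiB.
Qed.

Lemma bump_lin a phi chi j : bounded_profile phi -> bounded_profile chi ->
  bump (fun s => a * phi s + chi s) j = a%:C%C *: bump phi j + bump chi j.
Proof.
move=> bphi bchi; have sphi := bumpf_sq j bphi; have schi := bumpf_sq j bchi.
have e1 := L2classZ a%:C%C sphi; have e2 := L2classD (sqZ a%:C%C sphi) schi.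
apply: etrans (etrans e2 (congr1 (fun z => z + _) e1)); congr L2class.
by apply/funext => s; rewrite /bumpf rmorphD rmorphM scalerDl scalerA.
Qed.

Lemma eq_bump phi chi j : bounded_profile phi -> (forall s, D s -> phi s = chi s) ->
  bump phi j = bump chi j.
Proof.
by move=> bphi E; apply: L2class_eqD; [move=> s Ds; rewrite /bumpf E|exact: bumpf_sq].
Qed.

Lemma bump0 j : bump (fun=> 0) j = 0.
Proof.
have b0 : bounded_profile (fun=> 0) by split => //; exists 0 => // s _; rewrite normr0.
have := bump_lin (-1) j b0 b0; rewrite rmorphN1 scaleN1r addNr => <-.
by apply: (congr1 (fun phi => bump phi j)); apply/funext => s; rewrite mulr0 addr0.
Qed.

(** Height squared times length of support: the source of every norm estimate for steps, ramps and
    remainders. *)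
Lemma normsq_bump_le phi j (b p q : R) : bounded_profile phi -> p <= q ->
  (forall s, D s -> `|phi s| <= b) -> (forall s, D s -> ~~ (p <= s <= q) -> phi s = 0) ->
  normsqL2 (bump phi j) <= b ^+ 2 * (q - p).
Proof.
move=> bphi pq phib phi0; have sphi := bumpf_sq j bphi.
rewrite normsqL2_class// (bigD1 j)//= big1 ?addr0; last first.
  move=> i /negbTE ij; transitivity (\int[mu]_(s in D) (0 : R)); last by rewrite Rintegral_cst// mul0r.
  by apply: eq_Rintegral => s _; rewrite bumpfE ij mulr0 /norm2sq/= expr0n addr0.
have setE : [set z | p <= z <= q] = `[p, q]%classic.
  by apply/seteqP; split=> s /=; rewrite in_itv.
pose h (s : R) := if p <= s <= q then b ^+ 2 else 0.
have ih : mu.-integrable D (EFin \o h).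
  apply: (@integrable_dominated _ _ _ (fun=> b ^+ 2)) => //; last first.
  - by move=> z _; rewrite /h; case: ifP; rewrite ?normr0 ?ger0_norm ?sqr_ge0.
  - exact: integrable_cst_itv_oo.
  apply: measurable_funTS; apply: measurable_if0 => //.
  by apply: measurable_and; exact: measurable_fun_ler.
apply: (@le_trans _ _ (\int[mu]_(s in D) h s)).
  apply: le_Rintegral => //; first exact: (sq_integrable j sphi).
  move=> s Ds; rewrite bumpfE eqxx mulr1 /norm2sq/= expr0n addr0 /h; case: ifPn => ps.
    rewrite -(real_normK (num_real (phi s))) lerXn2r ?nnegrE// ?phib//.
    exact: le_trans (normr_ge0 _) (phib s Ds).
  by rewrite phi0// expr0n.
rewrite /h (Rintegral_if _ (fun s => p <= s <= q)) Rintegral_cst; last first.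
  rewrite setE; exact: measurableI.
rewrite ler_wpM2l ?sqr_ge0//.
have mpq : mu `[p, q]%classic = (q - p)%:E.
  rewrite lebesgue_measure_itv/= lte_fin; case: ifPn => [_|]; first by rewrite -EFinB.
  by rewrite -leNgt => qp; rewrite (_ : q = p) ?subrr//; apply/eqP; rewrite eq_le qp.
rewrite -[leRHS]/(fine (q - p)%:E) -mpq.
have mI : measurable (D `&` [set z | p <= z <= q]).
  rewrite setE; exact: measurableI.
have le : (mu (D `&` [set z | (p <= z <= q)%R]) <= mu `[p, q]%classic)%E.
  by apply: le_measure; rewrite ?inE//; rewrite setE; exact: subIsetr.
apply: fine_le => //; last by rewrite mpq.
by rewrite ge0_fin_numE// (le_lt_trans le)// mpq ltry.
Qed.

Lemma dotL2_bump (u : V) phi j : u \in sq -> bounded_profile phi ->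
  dotL2 (cls u) (bump phi j) = cintegral D (fun s => u s j ord0 * (phi s)%:C%C).
Proof.
move=> su bphi; have sphi := bumpf_sq j bphi; rewrite dotL2_class// (bigD1 j)//= big1.
  rewrite addr0; apply: eq_cintegral => s _.
  by rewrite bumpfE eqxx mulr1 conjc_real.
move=> i /negbTE ij; rewrite -(cintegral0 D); apply: eq_cintegral => s _.
by rewrite bumpfE ij mulr0 rmorph0 mulr0.
Qed.

Definition step (y s : R) : R := if s < y then 1 else 0.
Definition ramp (y s : R) : R := if s < y then y - s else 0.

Lemma bounded_step y : bounded_profile (step y).
Proof.
split; last by exists 1 => // s _; rewrite /step; case: ifP; rewrite ?normr1 ?normr0.
by apply: measurable_funTS; apply: measurable_if0 => //; exact: measurable_fun_ltr.
Qed.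

Lemma bounded_ramp y : bounded_profile (ramp y).
Proof.
split.
  apply: measurable_funTS; apply: measurable_if0; first exact: measurable_fun_ltr.
  exact: measurable_funB.
exists `|y| => // s /= /[!in_itv]/= /andP[s0 sl]; rewrite /ramp; case: ifP => sy; last by rewrite normr0.
rewrite ger0_norm; last by rewrite subr_ge0 ltW.
by have := ler_norm y; lra.
Qed.

Lemma step0 j : bump (step 0) j = 0.
Proof.
rewrite -(bump0 j); apply: eq_bump; first exact: bounded_step.
by move=> s /= /[!in_itv]/= /andP[s0 _]; rewrite /step ltNge (ltW s0).
Qed.

Lemma ramp0 j : bump (ramp 0) j = 0.
Proof.
rewrite -(bump0 j); apply: eq_bump; first exact: bounded_ramp.
by move=> s /= /[!in_itv]/= /andP[s0 _]; rewrite /ramp ltNge (ltW s0).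
Qed.

Lemma normsq_step y j : normsqL2 (bump (step y) j) <= l.
Proof.
rewrite -[leRHS]mul1r -(expr1n _ 2) -[X in _ * X]subr0.
apply: normsq_bump_le; [exact: bounded_step|exact: ltW|by move=> s _; rewrite /step;
  case: ifP; rewrite ?normr1 ?normr0|].
by move=> s /= /[!in_itv]/= /andP[s0 sl]; rewrite !ltW.
Qed.

Lemma normsq_ramp y j : 0 <= y <= l -> normsqL2 (bump (ramp y) j) <= l ^+ 3.
Proof.
move=> /andP[y0 yl]; rewrite [leRHS]exprSr -[X in _ * X]subr0.
apply: normsq_bump_le; [exact: bounded_ramp|exact: ltW| |].
  move=> s /= /[!in_itv]/= /andP[s0 sl]; rewrite /ramp; case: ifP => sy; last by rewrite normr0 ltW.
  by rewrite ger0_norm ?subr_ge0 ?ltW//; lra.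
by move=> s /= /[!in_itv]/= /andP[s0 sl]; rewrite !ltW.
Qed.

(* The derivative of y |-> ramp y in L2 is step y, with a remainder supported in
   [y, y + h] and bounded by h. *)
Definition ramp_rest (y h z s : R) : R := - h * step z s + (-1 * ramp y s + ramp (y + h) s).

Lemma bounded_ramp_rest y h z : bounded_profile (ramp_rest y h z).
Proof.
apply: bounded_profile_lin; first exact: bounded_step.
by apply: bounded_profile_lin; exact: bounded_ramp.
Qed.

(** The jump point [z] is kept free: [z = y] gives the forward increment used for diagonal steps,
    [z = y + h] the backward increment used in [step_vanish], which still works at the right end of
    the interval. *)
Lemma ramp_increment y h z j : bump (ramp (y + h)) j =
  bump (ramp y) j + h%:C%C *: bump (step z) j + bump (ramp_rest y h z) j.
Proof.
have b1 := bounded_profile_lin (-1) (bounded_ramp y) (bounded_ramp (y + h)).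
rewrite (bump_lin (- h) j (bounded_step z) b1) (bump_lin (-1) j (bounded_ramp y) (bounded_ramp (y + h))).
rewrite rmorphN rmorphN1 scaleNr scaleN1r.
have E (r t b : L2 l n) : b = r + t + (- t + (- r + b)) by rewrite addrA addrK addNKr.
exact: E.
Qed.

(** Height at most [h] on a support of length [h]. The main term [h] times a step has squared norm
    of order [h ^+ 2], and this extra power of [h] drives both limiting arguments of the uniqueness
    proof. *)
Lemma normsq_ramp_rest y h z j : 0 <= h -> y <= z <= y + h ->
  normsqL2 (bump (ramp_rest y h z) j) <= h ^+ 3.
Proof.
move=> h0 /andP[yz zh]; rewrite [leRHS]exprSr (_ : h ^+ 2 * h = h ^+ 2 * ((y + h) - y)); last first.
  by congr (_ * _); rewrite addrAC subrr add0r.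
apply: normsq_bump_le; [exact: bounded_ramp_rest|by rewrite lerDl| |].
  move=> s _; rewrite /ramp_rest /step /ramp ler_norml.
  by case: (ltP s z); case: (ltP s y); case: (ltP s (y + h)) => *; apply/andP; split; lra.
move=> s _; rewrite /ramp_rest /step /ramp negb_and -!ltNge => /orP[sy|ys].
  have -> : s < z by lra.
  have -> : s < y + h by lra.
  by rewrite sy; ring.
have -> : (s < z) = false by apply/negbTE; rewrite -leNgt; lra.
have -> : (s < y) = false by apply/negbTE; rewrite -leNgt; lra.
have -> : (s < y + h) = false by apply/negbTE; rewrite -leNgt; lra.
by ring.
Qed.

Lemma volterra_adj_step y j : 0 <= y <= l -> kop (kadj v) (bump (step y) j) = bump (ramp y) j.
Proof.
move=> /andP[y0 yl]; have su := bumpf_sq j (bounded_step y).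
rewrite kop_class//; apply: L2class_eqD; last exact: kfun_sq.
move=> x /= Dx; have := Dx; rewrite in_itv/= => /andP[x0 xl].
apply/colP => i; rewrite bumpfE mxE.
pose g t : R := if x < t then step y t else 0.
have mg : measurable_fun D g.
  apply: measurable_funTS; apply: measurable_if0; first exact: measurable_fun_ltr.
  by apply: measurable_if0 => //; exact: measurable_fun_ltr.
have ig : cintegrable D (fun t => (g t)%:C%C).
  split => /=; last exact: integrable0.
  apply: (@integrable_dominated _ _ _ (fun=> 1)) => //; first exact: integrable_cst_itv_oo.
  by move=> t _; rewrite /g /step; case: ifP => _; [case: ifP => _|]; rewrite ?normr1 ?normr0.
transitivity (cintegral D (fun t => (i == j)%:R * (g t)%:C%C)).
  apply: eq_cintegral => t _; rewrite adj_volterraE /g; case: ifP => _.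
    by rewrite mul1mx bumpfE mulrC.
  by rewrite mul0mx mxE mulr0.
rewrite cintegralZ// mulrC; congr (_ * _).
apply: complexP => /=; last by rewrite Rintegral_cst ?mul0r.
rewrite /g (Rintegral_if _ (fun t => x < t)) /step (Rintegral_if _ (fun t => t < y)).
rewrite (_ : _ `&` _ = `]x, y[%classic); last first.
  apply/seteqP; split=> t /=; rewrite !in_itv/=; first by move=> [[_ ->] ->].
  by move=> /andP[xt ty]; rewrite (lt_trans x0 xt) (lt_le_trans ty yl).
rewrite Rintegral_cst//= lebesgue_measure_itv/= lte_fin /ramp mul1r.
by case: ifP => // _; rewrite -EFinB.
Qed.

(** Differentiates the hypothesis on ramps: if [Lam] vanishes on two ramps at distance [h], then [h]
    times its value on the step equals, up to sign, its value on the remainder, so the squared value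
    on the step is at most [c * h]. Only real homogeneity is asked, so that the conjugate-linear
    slot of an inner product qualifies. *)
Lemma step_vanish (Lam : L2 l n -> C) (c : R) j : 0 <= c ->
  (forall f g, Lam (f + g) = Lam f + Lam g) ->
  (forall (a : R) f, Lam (a%:C%C *: f) = a%:C%C * Lam f) ->
  (forall f, norm2sq (Lam f) <= c * normsqL2 f) ->
  (forall y, 0 <= y <= l -> Lam (bump (ramp y) j) = 0) ->
  forall y, 0 <= y <= l -> Lam (bump (step y) j) = 0.
Proof.
move=> c0 LD LZ Lc L0 y /andP[y0 yl].
have [->|yn0] := eqVneq y 0.
  by rewrite step0 -(scale0r (bump (step 0) j)) (LZ 0) mul0r.
have {yn0}y0 : 0 < y by rewrite lt_def yn0.
apply: norm2sq_eq0; apply/eqP; rewrite eq_le norm2sq_ge0 andbT leNgt; apply/negP => N0.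
set N := norm2sq _ in N0.
have key h : 0 < h <= y -> N <= c * h.
  move=> /andP[h0 hy].
  have gen (A S r B : L2 l n) : B = A + h%:C%C *: S + r -> Lam B = 0 -> Lam A = 0 ->
      h ^+ 2 * norm2sq (Lam S) = norm2sq (Lam r).
    move=> ->; rewrite !LD LZ => + A0; rewrite A0 add0r => /eqP.
    rewrite addr_eq0 => /eqP /(congr1 norm2sq).
    by rewrite norm2sqN norm2sqM {1}/norm2sq/= expr0n addr0.
  have E : h ^+ 2 * N = norm2sq (Lam (bump (ramp_rest (y - h) h y) j)).
    apply: (gen _ _ _ _ (ramp_increment (y - h) h y j)).
      by apply: L0; rewrite subrK yl ltW.
    by apply: L0; apply/andP; split; lra.
  have := Lc (bump (ramp_rest (y - h) h y) j); rewrite -E => H.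
  have H2 : normsqL2 (bump (ramp_rest (y - h) h y) j) <= h ^+ 3.
    by apply: normsq_ramp_rest; [exact: ltW|apply/andP; split; lra].
  have H3 : h ^+ 2 * N <= h ^+ 2 * (c * h).
    apply: (le_trans H); rewrite (_ : h ^+ 2 * (c * h) = c * h ^+ 3); last by ring.
    exact: ler_wpM2l.
  by move: H3; rewrite ler_pM2l// exprn_gt0.
(* The second term makes [c * h] at most half of [N], contradicting [key]; the first keeps [y - h]
   nonnegative. *)
pose h := Num.min y (N / (2 * (c + 1))).
have h0 : 0 < h by rewrite lt_min y0 divr_gt0// mulr_gt0// ltr_wpDl.
have hy : h <= y by rewrite ge_min lexx.
have := key h; rewrite h0 hy => /(_ isT) Nh.
have hN : h <= N / (2 * (c + 1)) by rewrite ge_min lexx orbT.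
have : h * (2 * (c + 1)) <= N by rewrite -ler_pdivlMr// mulr_gt0// ltr_wpDl.
nra.
Qed.

(** Pairing with [step y] in coordinate [j] gives the primitive of that coordinate at [y]; by
    [Rintegral_primitive_eq0] all coordinates vanish almost everywhere. *)
Lemma steps_total (f : L2 l n) :
  (forall j y, 0 <= y <= l -> dotL2 f (bump (step y) j) = 0) -> f = 0.
Proof.
move=> orth; rewrite -(L2class_rep f) in orth *; move: (L2rep f) (L2rep_sq f) orth => u su orth.
have uj j : {ae mu, forall x, D x -> u x j ord0 = 0}.
  have [iRe iIm] := sq_cintegrable j su.
  have aux x : 0 < x < l -> \int[mu]_(t in `]0, x[) complex.Re (u t j ord0) = 0 /\
      \int[mu]_(t in `]0, x[) complex.Im (u t j ord0) = 0.
    move=> /andP[x0 xl]; have := orth j x; rewrite !ltW//= => /(_ isT).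
    rewrite dotL2_bump//; last exact: bounded_step.
    have E : D `&` [set t | t < x] = `]0, x[%classic.
      apply/seteqP; split=> t /=; rewrite !in_itv/=; first by move=> [/andP[-> _] ->].
      by move=> /andP[-> tx]; rewrite tx (lt_trans tx).
    move=> H; split.
      apply: etrans _ (congr1 (@complex.Re R) H) => /=.
      rewrite -E -Rintegral_if; apply: eq_Rintegral => t _; rewrite ReMc /step /=.
      by case: ifP; rewrite ?mulr1 ?mulr0 ?subr0.
    apply: etrans _ (congr1 (@complex.Im R) H) => /=.
    rewrite -E -Rintegral_if; apply: eq_Rintegral => t _; rewrite ImMc /step /=.
    by case: ifP; rewrite ?mulr1 ?mulr0 ?add0r.
  have A1 := Rintegral_primitive_eq0 iRe (fun x xl => (aux x xl).1).
  have A2 := Rintegral_primitive_eq0 iIm (fun x xl => (aux x xl).2).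
  apply: (@filterS2 _ _ (ae_filter_ringOfSetsType mu) _ _ _ _ A1 A2) => x a1 a2 Dx.
  by apply: complexP; [exact: a1|exact: a2].
apply: normsqL2_eq0; rewrite normsqL2_class// big1// => j _.
have sj := sq_cmeasurable j su.
have := @ae_eq_cintegral _ D (fun x => (norm2sq (u x j ord0))%:C%C) (fun=> 0) mD.
move=> /(_ _ _ _) /(congr1 (@complex.Re R)) /=.
rewrite Rintegral_cst// mul0r; apply.
- by split => //=; exact: measurable_norm2sq.
- exact: cmeasurable_cst.
- apply: (@filterS _ _ (ae_filter_ringOfSetsType mu) _ _ _ (uj j)) => x /[apply] ->.
  by rewrite /norm2sq/= expr0n addr0.
Qed.

(** If [V f = 0], then [f] is orthogonal to each ramp, a ramp being [V^*] of a step; [step_vanish]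
    then makes [f] orthogonal to the steps themselves. *)
Lemma volterra_inj (f : L2 l n) : kop v f = 0 -> f = 0.
Proof.
move=> vf0; apply: steps_total => j y.
apply: (step_vanish (normsqL2_ge0 f)) => [g h|a g|g|z zl].
- exact: dotL2Dr.
- by rewrite dotL2Zr conjc_real.
- exact: Cauchy_Schwarz.
- by rewrite -(volterra_adj_step j zl) -kop_adjoint// vf0 dotL20l.
Qed.

End Profiles.

(** * Uniqueness *)

Section Uniqueness.
Context {R : realType}.
Local Notation mu := (@lebesgue_measure R).
Local Notation C := R[i].
Variables (l : R) (n : nat).
Hypothesis l_gt0 : 0 < l.
Local Notation D := (`]0, l[%classic : set R).
Local Notation V := (R -> 'cV[C]_n).
Local Notation sq := (square_integrable l n).
Local Notation cls := (@L2class R l n).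
Local Notation v := (@volterra_kernel R n).
Local Notation bump := (@bump R l n).

Let mD : measurable D. Proof. exact: measurable_itv. Qed.
Let bv : bounded_kernel l v. Proof. exact: bounded_volterra. Qed.
Let bv' : bounded_kernel l (kadj v). Proof. exact: bounded_kernel_adj. Qed.

Lemma le_inv_nat_eq0 (A K : R) : 0 <= A -> (forall N : nat, A <= K / N.+1%:R) -> A = 0.
Proof.
move=> A0 AK; apply/eqP; rewrite eq_le A0 andbT leNgt; apply/negP => Ap.
pose N := Num.bound (K / A).
have KN : K / A < N%:R.
  have [KA|KA] := leP 0 (K / A); first exact: archi_boundP.
  exact: lt_le_trans KA _.
have := AK N; rewrite ler_pdivlMr ?ltr0n// mulrC.
rewrite ltr_pdivrMr// in KN => H.
have : N%:R * A <= N.+1%:R * A by rewrite ler_wpM2r// ler_nat.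
by lra.
Qed.

Lemma sq_sum (I : Type) (r : seq I) (F : I -> V) : (forall i, F i \in sq) ->
  (fun x => \sum_(i <- r) F i x) \in sq.
Proof.
move=> sF; elim: r => [|i r IH].
  have -> : (fun x => \sum_(i <- [::]) F i x) = 0 :> V by apply/funext => x; rewrite big_nil.
  exact: rpred0.
have -> : (fun x => \sum_(j <- i :: r) F j x) = (fun x => F i x + \sum_(j <- r) F j x).
  by apply/funext => x; rewrite big_cons.
exact: sqD.
Qed.

Lemma L2class_sum (I : Type) (r : seq I) (F : I -> V) : (forall i, F i \in sq) ->
  cls (fun x => \sum_(i <- r) F i x) = \sum_(i <- r) cls (F i).
Proof.
move=> sF; elim: r => [|i r IH].
  have s0 : (fun=> 0 : 'cV[C]_n) \in sq.
    have -> : (fun=> 0) = 0 :> V by [].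
    exact: rpred0.
  rewrite big_nil -(scale0r (cls (fun=> 0))); apply: etrans _ (L2classZ 0 s0).
  by apply: congr1; apply/funext => x; rewrite big_nil scale0r.
rewrite big_cons -IH; apply: etrans _ (L2classD (sF i) (sq_sum r sF)).
by apply: congr1; apply/funext => x; rewrite big_cons.
Qed.

Lemma profile_vec phi (w : 'cV[C]_n) : bounded_profile l phi ->
  (fun s => (phi s)%:C%C *: w) \in sq /\
  cls (fun s => (phi s)%:C%C *: w) = \sum_i w i ord0 *: bump phi i.
Proof.
move=> bphi; have sb (i : 'I_n) := bumpf_sq i bphi.
have sF i := sqZ (w i ord0) (sb i).
have E : (fun s => (phi s)%:C%C *: w) = (fun s => \sum_i w i ord0 *: bumpf phi i s).
  apply/funext => s; apply/colP => i; rewrite mxE summxE (bigD1 i)//= mxE bumpfE eqxx mulr1.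
  rewrite mulrC big1 ?addr0// => j ji; rewrite mxE bumpfE eq_sym (negbTE ji).
  by rewrite !mulr0.
rewrite E; split; first exact: (sq_sum _ sF).
apply: etrans (L2class_sum _ sF) _; apply: eq_bigr => i _; exact: (L2classZ (w i ord0) (sb i)).
Qed.

(** * Bounded solutions of the homogeneous equation [V X = - X V^*] *)

Section Intertwining.
Variables (X : L2 l n -> L2 l n) (c : R).
Hypothesis linX : linear X.
Hypothesis c_ge0 : 0 <= c.
Hypothesis Xc : forall f, normsqL2 (X f) <= c * normsqL2 f.
Hypothesis skewX : forall f, kop v (X f) = - X (kop (kadj v) f).

Lemma X0 : X 0 = 0.
Proof. by have := linX (-1) 0 0; rewrite scaler0 addr0 scaleN1r addNr. Qed.
Lemma XD f g : X (f + g) = X f + X g.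
Proof. by have := linX 1 f g; rewrite !scale1r. Qed.
Lemma XZ a f : X (a *: f) = a *: X f.
Proof. by have := linX a f 0; rewrite X0 !addr0. Qed.
Lemma X_sum0 (I : Type) (r : seq I) (F : I -> L2 l n) : (forall i, X (F i) = 0) ->
  X (\sum_(i <- r) F i) = 0.
Proof.
by move=> XF; elim: r => [|i r IH]; rewrite ?big_nil ?X0// big_cons XD XF IH addr0.
Qed.

Let B f g := dotL2 (X f) g.

Let BDl f f' g : B (f + f') g = B f g + B f' g.
Proof. by rewrite /B XD dotL2Dl. Qed.
Let BZl a f g : B (a *: f) g = a * B f g.
Proof. by rewrite /B XZ dotL2Zl. Qed.
Let BDr f g g' : B f (g + g') = B f g + B f g'.
Proof. exact: dotL2Dr. Qed.
Let BZr (a : R) f g : B f (a%:C%C *: g) = a%:C%C * B f g.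
Proof. by rewrite /B dotL2Zr conjc_real. Qed.
Let B_le f g : norm2sq (B f g) <= c * normsqL2 f * normsqL2 g.
Proof.
by apply: (le_trans (Cauchy_Schwarz _ _)); rewrite ler_wpM2r ?normsqL2_ge0.
Qed.
(** Weak form of [skewX]: moving [V^*] out of the second slot produces [V X f], which is
    [- X (V^* f)]. *)
Let Bskew f g : B (kop (kadj v) f) g + B f (kop (kadj v) g) = 0.
Proof.
rewrite /B -kop_adjoint// skewX dotL2Nl subrr//.
Qed.

Let B_le_bd f g a b : normsqL2 f <= a -> normsqL2 g <= b -> norm2sq (B f g) <= c * a * b.
Proof.
move=> fa gb; apply: (le_trans (B_le f g)); apply: ler_pM; rewrite ?mulr_ge0 ?normsqL2_ge0//.
exact: ler_wpM2l.
Qed.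

(** On expanding, the first-order terms [h * (B S Q + B P T)] cancel. Four terms remain, each of
    squared modulus at most [c * l ^+ 3 * h ^+ 3], by [h <= l] where there are spare powers of [h];
    the factor 4 of [norm2sqD4] makes the total 16. *)
Let B_increment (h : R) P P' S r Q Q' T t : 0 <= h -> h <= l ->
  P' = P + h%:C%C *: S + r -> Q' = Q + h%:C%C *: T + t ->
  B S Q + B P T = 0 ->
  normsqL2 S <= l -> normsqL2 T <= l -> normsqL2 r <= h ^+ 3 -> normsqL2 t <= h ^+ 3 ->
  normsqL2 Q' <= l ^+ 3 -> normsqL2 P <= l ^+ 3 ->
  norm2sq (B P' Q' - B P Q) <= 16 * c * l ^+ 3 * h ^+ 3.
Proof.
move=> h0 hl PE QE skew Sl Tl rh th Ql Pl; have l0 := ltW l_gt0.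
have hn : norm2sq (h%:C%C) = h ^+ 2 :> R by rewrite /norm2sq/= expr0n addr0.
have -> : B P' Q' - B P Q = (h%:C%C * (h%:C%C * B S T) + h%:C%C * B S t) + (B r Q' + B P t).
  rewrite {1}PE 2!BDl BZl.
  have -> : B P Q' = B P Q + h%:C%C * B P T + B P t by rewrite QE 2!BDr BZr.
  have -> : B S Q' = B S Q + h%:C%C * B S T + B S t by rewrite QE 2!BDr BZr.
  have -> : B P T = - B S Q by apply/eqP; rewrite -addr_eq0 addrC skew.
  move: (B P Q) (B S Q) (B S T) (B S t) (B r Q') (B P t) => *; ring.
have t1 : norm2sq (h%:C%C * (h%:C%C * B S T)) <= c * l ^+ 3 * h ^+ 3.
  rewrite !norm2sqM hn; have := B_le_bd Sl Tl.
  have : c * l * l * h ^+ 3 * h <= c * l * l * h ^+ 3 * l.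
    by rewrite ler_wpM2l// !mulr_ge0// exprn_ge0.
  have h4 : 0 <= h ^+ 2 * h ^+ 2 by rewrite mulr_ge0 ?sqr_ge0.
  move=> H1 /(ler_wpM2l h4) H2; rewrite mulrA (le_trans H2)//.
  rewrite (_ : _ * (c * l * l) = c * l * l * h ^+ 3 * h); last by ring.
  by rewrite (le_trans H1)// le_eqVlt; apply/orP; left; apply/eqP; ring.
have t2 : norm2sq (h%:C%C * B S t) <= c * l ^+ 3 * h ^+ 3.
  rewrite norm2sqM hn; have := B_le_bd Sl th => /(ler_wpM2l (sqr_ge0 h)) H2.
  rewrite (le_trans H2)//.
  rewrite (_ : h ^+ 2 * _ = (c * l * h ^+ 3) * h ^+ 2); last by ring.
  rewrite (_ : c * l ^+ 3 * h ^+ 3 = (c * l * h ^+ 3) * l ^+ 2); last by ring.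
  by rewrite ler_wpM2l ?mulr_ge0 ?exprn_ge0// lerXn2r.
have t3 : norm2sq (B r Q') <= c * l ^+ 3 * h ^+ 3.
  by rewrite (le_trans (B_le_bd rh Ql))// mulrAC.
have t4 : norm2sq (B P t) <= c * l ^+ 3 * h ^+ 3 by exact: B_le_bd.
apply: (le_trans (norm2sqD4 _ _ _ _)).
rewrite (_ : 16 * c * l ^+ 3 * h ^+ 3 = 4 * (c * l ^+ 3 * h ^+ 3 + c * l ^+ 3 * h ^+ 3 +
  (c * l ^+ 3 * h ^+ 3 + c * l ^+ 3 * h ^+ 3))); last by ring.
by rewrite ler_wpM2l//; apply: lerD; apply: lerD.
Qed.

Let W j k x y := B (bump (ramp x) j) (bump (ramp y) k).

Let W_increment j k h x y : 0 <= h -> 0 <= x -> 0 <= y -> x + h <= l -> y + h <= l ->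
  norm2sq (W j k (x + h) (y + h) - W j k x y) <= 16 * c * l ^+ 3 * h ^+ 3.
Proof.
move=> h0 x0 y0 xl yl.
have xl' : 0 <= x <= l by apply/andP; split; lra.
have yl' : 0 <= y <= l by apply/andP; split; lra.
apply: (B_increment h0 _ (ramp_increment l x h x j) (ramp_increment l y h y k)).
- by lra.
- rewrite -(volterra_adj_step j xl') -(volterra_adj_step k yl').
  by rewrite addrC; exact: Bskew.
- exact: normsq_step.
- exact: normsq_step.
- by apply: normsq_ramp_rest => //; rewrite lexx lerDl.
- by apply: normsq_ramp_rest => //; rewrite lexx lerDl.
- by apply: normsq_ramp => //; apply/andP; split; lra.
- exact: normsq_ramp.
Qed.

(* W moves by O(h^(3/2)) along a diagonal step of length h and vanishes on the two
   coordinate axes; N steps of length m / N give W = O(N^(-1/2)). *)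
Let W_eq0 j k x y : 0 <= x <= l -> 0 <= y <= l -> W j k x y = 0.
Proof.
move=> /andP[x0 xl] /andP[y0 yl].
pose m := Num.min x y.
have m0 : 0 <= m by rewrite le_min x0.
have mx : m <= x by rewrite ge_min lexx.
have my : m <= y by rewrite ge_min lexx orbT.
suff : norm1 (W j k x y) ^+ 2 = 0.
  move=> /eqP; rewrite sqrf_eq0 => /eqP W1; apply: norm2sq_eq0; apply/eqP.
  by rewrite eq_le norm2sq_ge0 (le_trans (norm2sq_le_norm1 _))// W1 expr0n.
apply: (@le_inv_nat_eq0 _ (32 * c * l ^+ 6)); first exact: sqr_ge0.
move=> N; pose h := m / N.+1%:R.
have N0 : 0 < N.+1%:R :> R by rewrite ltr0n.
have h0 : 0 <= h by rewrite divr_ge0.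
have Nh : N.+1%:R * h = m by rewrite mulrC divfK// gt_eqF.
(* A bound for [norm1] of one increment: 32 is twice the 16 of [B_increment], the factor 2 being the
   cost of [norm1_sqr_le]. As [h] is [m / N.+1%:R], the square of [N.+1%:R * d] is of order
   [1 / N.+1%:R]. *)
pose d := Num.sqrt (32 * c * l ^+ 3 * h ^+ 3).
have l0 := ltW l_gt0.
have d2 : d ^+ 2 = 32 * c * l ^+ 3 * h ^+ 3 by rewrite sqr_sqrtr// !mulr_ge0// exprn_ge0.
(* The walk starts at [(x - m, y - m)], where one coordinate is [0] and the corresponding ramp
   vanishes, and it reaches [(x, y)] after [N.+1] increments. *)
have ind i : (i <= N.+1)%N ->
    norm1 (W j k (x - m + i%:R * h) (y - m + i%:R * h)) <= i%:R * d.
  elim: i => [_|i IH iN].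
    rewrite !mul0r !addr0; suff -> : W j k (x - m) (y - m) = 0 by rewrite norm1_0.
    rewrite /W /m; case: leP => _; rewrite subrr ramp0.
      by rewrite /B X0 dotL20l.
    by rewrite /B dotL20r.
  have ih : i%:R * h + h <= m.
    by rewrite -Nh -[X in _ + X]mul1r -mulrDl ler_wpM2r// natr1 ler_nat.
  have := IH (ltnW iN); set w := W j k _ _ => Hw.
  have ih0 : 0 <= i%:R * h by rewrite mulr_ge0.
  have iS : i.+1%:R = i%:R + 1 :> R by rewrite natr1.
  rewrite iS !mulrDl !mul1r !addrA; set w' := W j k _ _.
  have : norm2sq (w' - w) <= 16 * c * l ^+ 3 * h ^+ 3.
    by apply: W_increment => //; rewrite -?addrA; lra.
  have := norm1_sqr_le (w' - w) => H1 H2.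
  have dw : norm1 (w' - w) <= d.
    rewrite -(ler_pXn2r (ltn0Sn 1)) ?nnegrE ?norm1_ge0 ?sqrtr_ge0// d2.
    by apply: (le_trans H1); lra.
  by rewrite -[w'](subrK w) addrC (le_trans (norm1D _ _))// lerD.
have := ind N.+1 (leqnn _); rewrite Nh !subrK => H.
apply: (@le_trans _ _ ((N.+1%:R * d) ^+ 2)).
  by rewrite lerXn2r// ?nnegrE ?norm1_ge0// mulr_ge0 ?sqrtr_ge0.
rewrite exprMn d2 (_ : N.+1%:R ^+ 2 * _ = 32 * c * l ^+ 3 * (N.+1%:R * h) ^+ 3 / N.+1%:R); last first.
  by field; rewrite gt_eqF.
rewrite Nh ler_wpM2r ?invr_ge0 ?(ltW N0)// (_ : 32 * c * l ^+ 6 = 32 * c * l ^+ 3 * l ^+ 3); last by ring.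
rewrite ler_wpM2l ?mulr_ge0 ?exprn_ge0// lerXn2r// ?nnegrE//.
exact: le_trans mx xl.
Qed.

(** [W] is differentiated one slot at a time by [step_vanish]: first the left ramp becomes a step
    against a fixed right ramp, then the right ramp becomes a step against the fixed left step. *)
Lemma X_step j x : 0 <= x <= l -> X (bump (step x) j) = 0.
Proof.
move=> xl; apply: (@steps_total R l n) => k y yl.
have H z : 0 <= z <= l -> B (bump (step x) j) (bump (ramp z) k) = 0.
  move=> zl; apply: (@step_vanish R l n (fun f => B f (bump (ramp z) k))
    (c * normsqL2 (bump (ramp z) k)) j) _ xl.
  - by rewrite mulr_ge0 ?normsqL2_ge0.
  - by move=> f g; exact: BDl.
  - by move=> a f; exact: BZl.
  - by move=> f; rewrite mulrAC; exact: B_le.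
  - by move=> w wl; exact: W_eq0.
apply: (@step_vanish R l n (fun g => B (bump (step x) j) g)
  (c * normsqL2 (bump (step x) j)) k) _ yl.
- by rewrite mulr_ge0 ?normsqL2_ge0.
- by move=> f g; exact: BDr.
- by move=> a f; exact: BZr.
- by move=> f; exact: B_le.
- exact: H.
Qed.

(** Row of the kernel of [V^*] at [x]: pairing with it integrates a function over the part of the
    interval beyond [x]. *)
Let after (x t : R) : R := if x < t then 1 else 0.

Let bounded_after x : bounded_profile l (after x).
Proof.
split; last by exists 1 => // s _; rewrite /after; case: ifP; rewrite ?normr1 ?normr0.
by apply: measurable_funTS; apply: measurable_if0 => //; exact: measurable_fun_ltr.
Qed.

Let coef (u : V) x i := dotL2 (cls u) (bump (after x) i).

Let coefE (u : V) x i : u \in sq -> D x -> kfun l (kadj v) u x i ord0 = coef u x i.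
Proof.
move=> su Dx; rewrite (kfun_dotL2 bv' i su Dx) /coef; apply: (congr1 (dotL2 (cls u))).
apply: (congr1 cls); apply/funext => t; apply/colP => j; rewrite bumpfE mxE adj_volterraE /after.
case: ifP => _; rewrite ?mxE ?rmorph0 ?mul0r// mul1r eq_sym.
by case: (_ == _); rewrite ?mulr1n ?mulr0n ?rmorph1 ?rmorph0.
Qed.

(** Cauchy-Schwarz against the indicator of []x, y]]: functions in the range of [V^*] are Hoelder of
    exponent 1/2, here in squared form. *)
Let coef_holder (u : V) x y i : u \in sq -> x <= y ->
  norm2sq (coef u y i - coef u x i) <= normsqL2 (cls u) * (y - x).
Proof.
move=> su xy.
have -> : coef u y i - coef u x i = - dotL2 (cls u) (bump (fun s => -1 * after y s + after x s) i).
  rewrite /coef bump_lin; [|exact: bounded_after..].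
  by rewrite dotL2Dr rmorphN1 scaleN1r dotL2Nr opprD opprK.
rewrite norm2sqN; apply: (le_trans (Cauchy_Schwarz _ _)); rewrite ler_wpM2l ?normsqL2_ge0//.
rewrite -[leRHS]mul1r -(expr1n _ 2).
apply: normsq_bump_le => //.
- by apply: bounded_profile_lin; exact: bounded_after.
- by move=> s _; rewrite /after ler_norml; case: (ltP x s); case: (ltP y s) => *; apply/andP; split; lra.
- move=> s _; rewrite /after negb_and -!ltNge => /orP[sx|ys].
    have -> : (x < s) = false by apply/negbTE; rewrite -leNgt ltW.
    have -> : (y < s) = false by apply/negbTE; rewrite -leNgt; lra.
    by rewrite mulr0 addr0.
  have -> : x < s by lra.
  by rewrite ys; ring.
Qed.

(** [V^* u] is compared with the function that freezes it at the left end of each of [N.+1] equal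
    cells. [X] kills that step function, and by [coef_holder] the squared error is of order
    [1 / N.+1%:R] uniformly, so boundedness of [X] finishes. *)
Lemma X_volterra_adj f : X (kop (kadj v) f) = 0.
Proof.
rewrite -(L2class_rep f); move: (L2rep f) (L2rep_sq f) => u su.
rewrite (kop_class bv' su); have sF := kfun_sq bv' su; have l0 := ltW l_gt0.
apply: normsqL2_eq0.
apply: (@le_inv_nat_eq0 _ (c * (\sum_(i < n) 2 * normsqL2 (cls u) * l * l))).
  exact: normsqL2_ge0.
move=> N; pose h := l / N.+1%:R.
have N0 : 0 < N.+1%:R :> R by rewrite ltr0n.
have h0 : 0 <= h by rewrite divr_ge0.
pose x k : R := k%:R * h.
have x0 k : 0 <= x k by rewrite mulr_ge0.
have xS k : x k.+1 = x k + h by rewrite /x -natr1 mulrDl mul1r.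
have xN : x N.+1 = l by rewrite /x mulrC divfK// gt_eqF.
have xl k : (k <= N.+1)%N -> 0 <= x k <= l.
  by move=> kN; rewrite x0 -xN ler_wpM2r// ler_nat.
(* Indicator of the cell from [x k] included to [x k.+1] excluded, written as a difference of steps
   so that [X_step] applies. *)
pose q (k : 'I_N.+1) s := -1 * step (x k) s + step (x k.+1) s.
have bq k : bounded_profile l (q k) by apply: bounded_profile_lin; exact: bounded_step.
pose w (k : 'I_N.+1) : 'cV[C]_n := \col_i coef u (x k) i.
pose F (k : 'I_N.+1) s := (q k s)%:C%C *: w k.
have sFk k : F k \in sq by have [] := profile_vec (w k) (bq k).
have sg := sq_sum (index_enum 'I_N.+1) sFk.
have Xg : X (cls (fun s => \sum_k F k s)) = 0.
  rewrite (L2class_sum (index_enum 'I_N.+1) sFk); apply: X_sum0 => k.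
  have [_ ->] := profile_vec (w k) (bq k); apply: X_sum0 => i.
  rewrite XZ (bump_lin (-1) i (bounded_step l (x k)) (bounded_step l (x k.+1))) XD XZ.
  have e1 := X_step i (xl k (ltnW (ltn_ord k))); have e2 := X_step i (xl k.+1 (ltn_ord k)).
  have gen a b (y z : L2 l n) : y = 0 -> z = 0 -> a *: (b *: y + z) = 0.
    by move=> -> ->; rewrite scaler0 addr0 scaler0.
  exact: gen e1 e2.
pose r s := kfun l (kadj v) u s - \sum_k F k s.
have sr : r \in sq by exact: (sqD sF (sqN sg)).
have Fr : cls (kfun l (kadj v) u) = cls r + cls (fun s => \sum_k F k s).
  apply: etrans _ (L2classD sr sg); apply: (congr1 cls); apply/funext => s.
  by rewrite /r subrK.
have rd i s : D s -> norm2sq (r s i ord0) <= 2 * normsqL2 (cls u) * h.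
  move=> Ds; have := Ds; rewrite /= in_itv/= => /andP[s0 sl].
  pose d := Num.sqrt (2 * normsqL2 (cls u) * h).
  have d2 : d ^+ 2 = 2 * normsqL2 (cls u) * h.
    by rewrite sqr_sqrtr// !mulr_ge0// normsqL2_ge0.
  (* The cells form a partition of unity on []0, l[], by telescoping. The error at [s] is therefore
     a weighted sum of [coef u s i - coef u (x k) i], with only the cell containing [s]
     contributing. *)
  have sumq : \sum_k q k s = 1.
    have := @telescope_sumr _ 0 N.+1 (fun k => step (x k) s) (leq0n _).
    rewrite big_mkord xN /step sl (_ : (s < x 0%N) = false) ?subr0; last first.
      by apply/negbTE; rewrite -leNgt /x mul0r ltW.
    by move=> <-; apply: eq_bigr => k _; rewrite /q /step mulN1r addrC.
  have -> : r s i ord0 = \sum_k (q k s)%:C%C * (coef u s i - coef u (x k) i).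
    have gen (a : C) (b : 'I_N.+1 -> C) :
        a - \sum_k (q k s)%:C%C * b k = \sum_k (q k s)%:C%C * (a - b k).
      under [RHS]eq_bigr do rewrite mulrBr.
      by rewrite sumrB -mulr_suml -(rmorph_sum (real_complex R)) sumq mul1r.
    apply: etrans _ (gen _ _); rewrite /r mxE coefE//; apply: congr1.
    by rewrite mxE summxE; apply: congr1; apply: eq_bigr => k _; rewrite !mxE.
  apply: (le_trans (norm2sq_le_norm1 _)); rewrite -d2.
  rewrite lerXn2r ?nnegrE ?norm1_ge0 ?sqrtr_ge0//.
  apply: (le_trans (norm1_sum _ _ _)); rewrite -[leRHS]mul1r -sumq mulr_suml.
  apply: ler_sum => k _; rewrite (le_trans (norm1M _ _))//.
  rewrite {1}/norm1/= normr0 addr0 /q /step xS.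
  case: (ltP s (x k)) => sk; case: (ltP s (x k + h)) => sk'.
  - by rewrite mulr1 addNr normr0 !mul0r.
  - by have := le_lt_trans sk' sk; rewrite gtrDl ltNge h0.
  - rewrite mulr0 add0r normr1 !mul1r -(ler_pXn2r (ltn0Sn 1)) ?nnegrE ?norm1_ge0 ?sqrtr_ge0// d2.
    apply: (le_trans (norm1_sqr_le _)); rewrite -mulrA ler_wpM2l//.
    apply: (le_trans (coef_holder _ su sk)); rewrite ler_wpM2l ?normsqL2_ge0//; lra.
  - by rewrite mulr0 addr0 normr0 !mul0r.
rewrite Fr XD Xg addr0 (le_trans (Xc _))// -mulrA ler_wpM2l//.
rewrite (normsqL2_class sr) mulr_suml; apply: ler_sum => i _.
apply: (@le_trans _ _ (\int[mu]_(s in D) (2 * normsqL2 (cls u) * h))).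
  apply: le_Rintegral => //; first exact: (sq_integrable i sr).
    exact: integrable_cst_itv_oo.
  by move=> s Ds; exact: rd.
rewrite Rintegral_cst//= lebesgue_measure_itv/= lte_fin l_gt0 -EFinB subr0/=.
by rewrite /h; rewrite le_eqVlt; apply/orP; left; apply/eqP; ring.
Qed.

Lemma intertwining_eq0 f : X f = 0.
Proof. by apply: (@volterra_inj R l n); rewrite skewX X_volterra_adj oppr0. Qed.

End Intertwining.
End Uniqueness.

(** The first conjunct certifies that [opS] never falls back on the default value of [L2class]. *)
Theorem theorem3p1 (R : realType) (m1 m2 : nat) (hm1 : (0 < m1)%N) (hm2 : (0 < m2)%N)
    (l : R) (hl : 0 < l) (Phi1 : R -> 'M[R[i]]_(m2, m1))
    (hPhi1 : boundedly_differentiable `[0, l] Phi1) :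
  (forall f : L2 l m2, S_fun l Phi1 (L2rep f) \in square_integrable l m2) /\
  unique
    (fun T : L2 l m2 -> L2 l m2 =>
       bounded_operator T /\
       forall f : L2 l m2,
         'i%C *: (opA (T f) - T (opA_adj f)) = opPi l Phi1 (opPi_adj Phi1 f))
    (opS Phi1).
Proof.
split; first by move=> f; exact: (S_fun_sq hl hPhi1 (L2rep_sq f)).
have bS := opS_bounded hl hPhi1; have dS := opS_displacement hl hPhi1.
split=> [//|T [bT dT]].
have /bounded_operatorP[linS [cS cS0 Scs]] := bS.
have /bounded_operatorP[linT [cT cT0 Tct]] := bT.
pose X f := T f - opS Phi1 f.
have linX : linear X.
  by move=> a f g; rewrite /X linT linS scalerBr opprD addrACA.
have Xc f : normsqL2 (X f) <= (2 * cT + 2 * cS) * normsqL2 f.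
  rewrite /X (le_trans (normsqL2D _ _))// normsqL2N [leRHS]mulrDl -!mulrA.
  by apply: lerD; rewrite ler_wpM2l.
have c0 : 0 <= 2 * cT + 2 * cS by rewrite addr_ge0// mulr_ge0.
have i0 : 'i%C != 0 :> R[i] by rewrite eq_complex /= oner_eq0 andbF.
have bv := bounded_volterra l m2.
(* After cancelling the factor ['i], subtracting the two identities gives [A X = X A^*]. With [A]
   equal to [- 'i] times [V] and [A^*] equal to ['i] times [V^*], this becomes [V X = - X V^*]. *)
have skewX f : kop (@volterra_kernel R m2) (X f) = - X (kop (kadj (@volterra_kernel R m2)) f).
  have E : opA (T f) - T (opA_adj f) = opA (opS Phi1 f) - opS Phi1 (opA_adj f).
    by apply: (scalerI i0); rewrite dT dS.
  have XA : opA (T f) - opA (opS Phi1 f) = X (opA_adj f).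
    have gen (p q r t : L2 l m2) : p - q = r - t -> p - r = q - t.
      by move=> /eqP; rewrite subr_eq => /eqP ->; rewrite addrAC [r - t - r]addrAC subrr add0r addrC.
    exact: gen E.
  have linK := kop_linear bv.
  have KB : kop (@volterra_kernel R m2) (X f) =
      kop (@volterra_kernel R m2) (T f) - kop (@volterra_kernel R m2) (opS Phi1 f).
    have := linK (-1) (opS Phi1 f) (T f); rewrite !scaleN1r => H.
    by rewrite /X addrC H addrC.
  move: XA; rewrite !opAE opA_adjE -scalerBr -KB.
  have -> g : X ('i%C *: g) = 'i%C *: X g.
    have X0' : X 0 = 0 by have := linX (-1) 0 0; rewrite scaler0 addr0 scaleN1r addNr.
    by have := linX 'i%C g 0; rewrite X0' !addr0.
  by rewrite scaleNr -scalerN => /(scalerI i0) /(congr1 -%R); rewrite opprK.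
apply/funext => f; apply/eqP; rewrite eq_sym -subr_eq0; apply/eqP.
exact: (intertwining_eq0 hl linX c0 Xc skewX f).
Qed.
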